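(* Suppose there is a $\rho$-approximation for Minkowski's problem for polytopes $K\subseteq\mathbb{R}^n$ with $O(n)$ facets. Then there is a $\delta$-approximation for number balancing where $\delta := 2^{-n^{\Theta(1/\rho)}}$.
   Context: For $\rho\ge 1$ (possibly depending on $n$), a $\rho$-approximation for the Minkowski problem is a polynomial time algorithm that, on input of a symmetric convex set $K\subseteq\mathbb{R}^n$ with $\mathrm{vol}_n(K)>2^n$ (here: a polytope with $O(n)$ facets), finds a vector in $(\rho\cdot K)\cap(\mathbb{Z}^n\setminus\{\mathbf{0}\})$. For $\delta>0$ (possibly depending on $n$), a $\delta$-approximation for number balancing is a polynomial time algorithm that receives $\mathbf{a}\in[0,1]^n$ as input and produces a vector $\mathbf{x}\in\{-1,0,1\}^n\setminus\{\mathbf{0}\}$ with $|\langle\mathbf{a},\mathbf{x}\rangle|\le\delta$. *)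

(* Defs.v *)
From HB Require Import structures.
From mathcomp Require Import all_boot all_order all_algebra.
From mathcomp Require Import all_classical all_reals all_analysis.
Import Order.TTheory GRing.Theory Num.Theory.
Import numFieldNormedType.Exports.

Set Implicit Arguments.
Unset Strict Implicit.
Unset Printing Implicit Defensive.

Local Open Scope classical_set_scope.

(** The machine model is a deterministic while-language whose values are binary
    trees (cons cells) with integers at the leaves.  Moving a value is a pointer
    copy of cost 1; arithmetic is charged the product of the bit lengths of its
    operands, as in the schoolbook algorithms.  With this logarithmic cost the
    model is polynomially equivalent to Turing machines. *)

Inductive data : Type :=
| Int of int
| Pair of data & data.

Definition bit_length (z : int) : nat := (trunc_log 2 `|z|%N).+1.

Fixpoint data_size (d : data) : nat :=
  match d with
  | Int z => bit_length z
  | Pair d1 d2 => (data_size d1 + data_size d2).+1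
  end.

Inductive arith : Type := Add | Sub | Mul | Div | Leq.

Inductive expr : Type :=
| Var of nat
| Const of int
| Cons of expr & expr
| Hd of expr
| Tl of expr
| IsPair of expr
| Arith of arith & expr & expr.

Inductive cmd : Type :=
| Skip
| Assign of nat & expr
| Seq of cmd & cmd
| Cond of expr & cmd & cmd
| While of expr & cmd.

Definition store : Type := nat -> data.

Definition update (s : store) (x : nat) (d : data) : store :=
  fun y => if y == x then d else s y.

(* All operations are total: an ill-typed operand counts as [Int 0]. *)
Definition to_int (d : data) : int := if d is Int z then z else 0%R.
Definition hd (d : data) : data := if d is Pair d1 _ then d1 else Int 0%R.
Definition tl (d : data) : data := if d is Pair _ d2 then d2 else Int 0%R.
Definition is_pair (d : data) : bool := if d is Pair _ _ then true else false.
Definition of_bool (b : bool) : data := Int (Posz b).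
Definition truthy (d : data) : bool := if d is Int z then z != 0%R else true.

(* [Div] is the Euclidean quotient [divz], with [x / 0 = 0]. *)
Definition eval_arith (op : arith) (x y : int) : data :=
  match op with
  | Add => Int (x + y)%R
  | Sub => Int (x - y)%R
  | Mul => Int (x * y)%R
  | Div => Int (x %/ y)%Z
  | Leq => of_bool (x <= y)%R
  end.

Fixpoint eval (e : expr) (s : store) : data :=
  match e with
  | Var x => s x
  | Const z => Int z
  | Cons e1 e2 => Pair (eval e1 s) (eval e2 s)
  | Hd e1 => hd (eval e1 s)
  | Tl e1 => tl (eval e1 s)
  | IsPair e1 => of_bool (is_pair (eval e1 s))
  | Arith op e1 e2 =>
      eval_arith op (to_int (eval e1 s)) (to_int (eval e2 s))
  end.

Fixpoint cost (e : expr) (s : store) : nat :=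
  match e with
  | Var _ | Const _ => 1
  | Cons e1 e2 => (cost e1 s + cost e2 s).+1
  | Hd e1 | Tl e1 | IsPair e1 => (cost e1 s).+1
  | Arith _ e1 e2 =>
      (cost e1 s + cost e2 s
       + bit_length (to_int (eval e1 s)) * bit_length (to_int (eval e2 s))).+1
  end.

(* [exec c s t s']: started in [s], [c] halts in [s'] after total cost [t]. *)
Inductive exec : cmd -> store -> nat -> store -> Prop :=
| exec_skip s : exec Skip s 1 s
| exec_assign s x e :
    exec (Assign x e) s (cost e s).+1 (update s x (eval e s))
| exec_seq c1 c2 s1 s2 s3 t1 t2 :
    exec c1 s1 t1 s2 -> exec c2 s2 t2 s3 -> exec (Seq c1 c2) s1 (t1 + t2) s3
| exec_cond_true e c1 c2 s s' t :
    truthy (eval e s) -> exec c1 s t s' ->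
    exec (Cond e c1 c2) s (cost e s + t).+1 s'
| exec_cond_false e c1 c2 s s' t :
    ~~ truthy (eval e s) -> exec c2 s t s' ->
    exec (Cond e c1 c2) s (cost e s + t).+1 s'
| exec_while_false e c s :
    ~~ truthy (eval e s) -> exec (While e c) s (cost e s).+1 s
| exec_while_true e c s1 s2 s3 t1 t2 :
    truthy (eval e s1) -> exec c s1 t1 s2 -> exec (While e c) s2 t2 s3 ->
    exec (While e c) s1 (cost e s1 + t1 + t2).+1 s3.

(* Input and output are passed in variable 0. *)
Definition runs (p : cmd) (input : data) (t : nat) (output : data) : Prop :=
  exists2 s', exec p (update (fun=> Int 0%R) 0 input) t s' & s' 0 = output.

(** A search problem: on every instance [i] with [dom i], produce some [o] with
    [spec i o], in time polynomial in the size of the encoding of [i].  Nothing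
    is asked of the program outside [dom]. *)
Definition poly_time_solvable (I : Type) (O : I -> Type)
    (encI : I -> data) (encO : forall i, O i -> data)
    (dom : I -> Prop) (spec : forall i, O i -> Prop) : Prop :=
  exists (p : cmd) (k : nat), forall i : I, dom i ->
    exists (t : nat) (o : O i),
      [/\ runs p (encI i) t (encO i o),
          t <= k * data_size (encI i) ^ k
        & spec i o].

Local Open Scope ring_scope.

Definition encode_seq (s : seq data) : data := foldr Pair (Int 0) s.

Definition encode_rat (r : rat) : data := Pair (Int (numq r)) (Int (denq r)).

Definition encode_row (T : Type) n (f : T -> data) (v : 'rV[T]_n) : data :=
  encode_seq [seq f (v 0 i) | i <- enum 'I_n].

(** n-dimensional Lebesgue volume, as an iterated integral over slices along
    the first coordinate. *)
Fixpoint vol (R : realType) (n : nat) : set 'rV[R]_n -> \bar R :=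
  match n return set 'rV[R]_n -> \bar R with
  | 0 => fun A => (\1_A 0)%:E
  | n'.+1 => fun A =>
      (\int[@lebesgue_measure R]_x
         vol [set v : 'rV[R]_n' | A (row_mx (x%:M : 'rV[R]_1) v)])%E
  end.

(** Real data are rational, so that instances have a finite encoding.  An
    instance denotes the polyhedron [{x | mk_lhs x <= mk_rhs}].  [mk_rows]
    inequalities give at most [mk_rows] facets; conversely a full-dimensional
    polyhedron is given by one inequality for each of its facets. *)
Record minkowski_instance := MinkowskiInstance {
  mk_dim : nat;
  mk_rows : nat;
  mk_lhs : 'M[rat]_(mk_rows, mk_dim);
  mk_rhs : 'cV[rat]_mk_rows
}.

Definition polyhedron (R : realType) (I : minkowski_instance) :
    set 'rV[R]_(mk_dim I) :=
  [set x : 'rV[R]_(mk_dim I) | forall i : 'I_(mk_rows I),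
     \sum_(j < mk_dim I) ratr (mk_lhs I i j) * x 0 j <= ratr (mk_rhs I i 0)].
Arguments polyhedron : clear implicits.

Definition encode_minkowski_instance (I : minkowski_instance) : data :=
  encode_seq
    [seq Pair (encode_row encode_rat (row i (mk_lhs I))) (encode_rat (mk_rhs I i 0))
    | i <- enum 'I_(mk_rows I)].

Definition symmetric_set (R : realType) n (K : set 'rV[R]_n) : Prop :=
  forall x, K x -> K (- x).

Definition coord_bounded (R : realType) n (K : set 'rV[R]_n) : Prop :=
  exists B : R, forall x, K x -> forall i, `|x 0 i| <= B.

Definition minkowski_dom (R : realType) (C : nat) (I : minkowski_instance) :
    Prop :=
  let K := polyhedron R I in
  [/\ (0 < mk_dim I)%N, (mk_rows I <= C * mk_dim I)%N,
      coord_bounded K, symmetric_set K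
    & ((2 ^+ mk_dim I)%:E < vol K)%E].

Definition minkowski_approximation (R : realType) (C : nat) (rho : nat -> R) :
    Prop :=
  poly_time_solvable (O := fun I => 'rV[int]_(mk_dim I))
    encode_minkowski_instance (fun I => encode_row Int)
    (minkowski_dom R C)
    (fun I x => x != 0 /\
       [set rho (mk_dim I) *: y | y in polyhedron R I] (map_mx intr x)).

Record balancing_instance := BalancingInstance {
  nb_dim : nat;
  nb_vec : 'rV[rat]_nb_dim
}.

Definition balancing_dom (I : balancing_instance) : Prop :=
  (0 < nb_dim I)%N /\ forall i, 0 <= nb_vec I 0 i <= 1.

Definition number_balancing_approximation (R : realType) (delta : nat -> R) :
    Prop :=
  poly_time_solvable (O := fun I => 'rV[int]_(nb_dim I))
    (fun I => encode_row encode_rat (nb_vec I)) (fun I => encode_row Int)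
    balancing_dom
    (fun I x =>
       [/\ forall i, x 0 i \in [:: -1; 0; 1],
           x != 0
         & `| \sum_(i < nb_dim I) ratr (nb_vec I 0 i) * (x 0 i)%:~R |
             <= delta (nb_dim I)]).

(* Main.v *)
Require Import Defs.
From mathcomp Require Import all_boot all_order all_algebra.
From mathcomp Require Import all_classical all_reals all_analysis measurable_realfun.
From mathcomp Require Import zify ring lra.
Import Order.TTheory GRing.Theory Num.Theory.
Import numFieldNormedType.Exports.
Import Defs.

Set Implicit Arguments.
Unset Strict Implicit.
Unset Printing Implicit Defensive.

(** Scale the input to integers [a_1, ..., a_n].  For a block of [b] numbers [v],
    intersect the cube [|x_i| <= 2] with a slab [|M z + <v, x>| <= d] in one more
    coordinate [z]: a lattice point of [rho K] must have [z = 0] when [M] is large,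
    so it is a relation with coefficients at most [2 rho] and error about [2^(-b)].
    The constraints are triangular, so volumes are products.  As [rho] is an
    arbitrary function of the dimension, the oracle is only useful in dimension
    exactly [n]: the block is repeated to fill up [n] coordinates, and any nonzero
    copy in the answer is a relation for [v].

    Coefficients are halved at the price of squaring the number of inputs.  Let
    relations [x] with coefficients at most [2c+1] be computable for [B] numbers.
    Given [B] blocks of [B] numbers, let [s] be the sign of [x] where [|x| > c] and
    [0] elsewhere, and let [y] be a relation, with coefficients at most [2c+1],
    between the [B] numbers [<v, s>].  Replacing [y s] by [y s - sgn(y) x] in the
    blocks with [|y| > c] leaves coefficients at most [c], because [|y|] and [|x|]
    both lie in [[c+1, 2c+1]] where [s] does not vanish.  Starting from
    coefficients below [2^(T+1)], where [rho < 2^T], after [T] rounds all coefficients are in [{-1, 0, 1}],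
    and [b^(2^T) <= n] allows [b = n^(1/2^T) = n^(Theta(1/rho))].

    The program does not know [rho]: it tries all [T], and all differences
    [a_i - a_j], and keeps the best vector.  The differences suffice, by
    pigeonhole, when [b] is at most polylogarithmic in [n]. *)

(** * Polynomial-time functions *)

(** The slab has to be wide and narrow at once. Its width enters the volume, which must exceed $2^n$
    although each coordinate that fits into no block costs a factor $1/n$; yet after dilation by
    $\rho$ it must still force $z = 0$. A slack of relative width $n^3/2^b$ meets both demands once
    $2^b$ exceeds a suitable power of $n$, and otherwise the differences take over.

    Each round has to avoid the zero vector, which $ys - \mathrm{sgn}(y)x$ as well as $ys$ may
    become on a block. If $s$ vanishes there, $x$ is already small; if the residue $ys -
    \mathrm{sgn}(y)x$ vanishes, $s$ alone is a relation at least as good as $x$.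

    One call treats all blocks of the array at once. A round therefore costs only two recursive
    calls, and depth $T$ with $2^T \le \log n$ fits into a loop of $n$ steps.

    Since subtrees are shared at unit cost, a value may be exponentially larger than the time that
    built it; sizes are thus controlled along with time, and what the recursion stores is
    clamped. *)

Lemma data_size_gt0 d : 0 < data_size d.
Proof. by case: d. Qed.

Lemma absz_lt_bit_length z : `|z|%N < 2 ^ bit_length z.
Proof. exact: trunc_log_ltn. Qed.

Lemma bit_length_le z k : 0 < k -> `|z|%N < 2 ^ k -> bit_length z <= k.
Proof.
move=> k0 zk; rewrite /bit_length; case: (posnP `|z|%N) => [->|z0].
  by rewrite trunc_log0.
by rewrite -(ltn_exp2l _ _ (isT : 1 < 2)) (leq_ltn_trans _ zk)// trunc_logP.
Qed.

Lemma bit_length_mono x y : `|x|%N <= `|y|%N -> bit_length x <= bit_length y.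
Proof.
by move=> xy; apply: bit_length_le => //; apply: leq_ltn_trans xy (absz_lt_bit_length y).
Qed.

Lemma exp2_addn_ge a b : 0 < a -> 0 < b -> 2 ^ a + 2 ^ b <= 2 ^ (a + b).
Proof.
case: a => // a _; case: b => // b _.
rewrite expnD; have := leq_pexp2l (isT : 0 < 2) (isT : 1 <= a.+1).
have := leq_pexp2l (isT : 0 < 2) (isT : 1 <= b.+1); nia.
Qed.

Lemma bit_lengthD x y : bit_length (x + y)%R <= bit_length x + bit_length y.
Proof.
apply: bit_length_le => //.
have := absz_lt_bit_length x; have := absz_lt_bit_length y.
have := @exp2_addn_ge (bit_length x) (bit_length y) isT isT.
lia.
Qed.

Lemma bit_lengthN x : bit_length (- x)%R = bit_length x.
Proof. by rewrite /bit_length abszN. Qed.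

Lemma bit_lengthM x y : bit_length (x * y)%R <= bit_length x + bit_length y.
Proof.
apply: bit_length_le => //; rewrite abszM expnD.
by have := absz_lt_bit_length x; have := absz_lt_bit_length y; nia.
Qed.

Lemma absz_divz_le (x y : int) : `|(x %/ y)%Z|%N <= `|x|%N.
Proof.
case: (eqVneq y 0%R) => [->|y0]; first by rewrite divz0.
have := divz_eq x y; have := modz_ge0 x y0; have := ltz_mod x y0; nia.
Qed.

Lemma bit_length_div x y : bit_length (x %/ y)%Z <= bit_length x.
Proof. exact/bit_length_mono/absz_divz_le. Qed.

Lemma bit_length_bool (b : bool) : bit_length b = 1.
Proof. by case: b. Qed.

Lemma bit_length_to_int d : bit_length (to_int d) <= data_size d.
Proof. by case: d. Qed.

Lemma data_size_eval_arith op x y :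
  data_size (eval_arith op x y) <= bit_length x + bit_length y.
Proof.
case: op => /=; first exact: bit_lengthD.
- by rewrite -(bit_lengthN y) bit_lengthD.
- exact: bit_lengthM.
- exact: leq_trans (bit_length_div _ _) (leq_addr _ _).
- by rewrite bit_length_bool.
Qed.

Lemma data_size_hd d : data_size (hd d) <= data_size d.
Proof. by case: d => //= a b; rewrite leqW// leq_addr. Qed.

Lemma data_size_tl d : data_size (tl d) <= data_size d.
Proof. by case: d => //= a b; rewrite leqW// leq_addl. Qed.

Definition poly_bounded (F : nat -> nat) :=
  exists K, forall x, 0 < x -> F x <= K * x ^ K.

Lemma monomial_le K K' x y : 0 < x -> x <= y -> K <= K' -> K * x ^ K <= K' * y ^ K'.
Proof.
move=> x0 xy KK; apply: leq_mul => //.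
apply: leq_trans (leq_pexp2l x0 KK) _.
by case: K' {KK} => // k; rewrite leq_exp2r.
Qed.

Lemma poly_bounded_const c : poly_bounded (fun=> c).
Proof. by exists c => x x0; rewrite leq_pmulr// expn_gt0 x0. Qed.

Lemma poly_bounded_id : poly_bounded id.
Proof. by exists 1 => x x0; rewrite mul1n expn1. Qed.

Lemma poly_boundedD F G : poly_bounded F -> poly_bounded G ->
  poly_bounded (fun x => F x + G x).
Proof.
move=> [K HK] [L HL]; exists (K + L) => x x0; rewrite mulnDl.
apply: leq_add.
  by apply: leq_trans (HK _ x0) _; rewrite leq_mul// leq_pexp2l// leq_addr.
by apply: leq_trans (HL _ x0) _; rewrite leq_mul// leq_pexp2l// leq_addl.
Qed.

Lemma poly_boundedM F G : poly_bounded F -> poly_bounded G ->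
  poly_bounded (fun x => F x * G x).
Proof.
move=> [K HK] [L HL]; exists (K * L + K + L) => x x0.
apply: leq_trans (leq_mul (HK _ x0) (HL _ x0)) _.
rewrite mulnACA -expnD; apply: leq_mul; first by nia.
by rewrite leq_pexp2l// -addnA leq_addl.
Qed.

Lemma poly_boundedX F k : poly_bounded F -> poly_bounded (fun x => F x ^ k).
Proof.
move=> HF; elim: k => [|k IH]; first exact: poly_bounded_const.
have [K HK] := poly_boundedM HF IH.
by exists K => x x0; rewrite expnS HK.
Qed.

Lemma poly_boundedS F : poly_bounded F -> poly_bounded (fun x => (F x).+1).
Proof.
move=> HF; have [K HK] := poly_boundedD HF (poly_bounded_const 1).
by exists K => x x0; rewrite -addn1 HK.
Qed.

Ltac pbnd := repeat first
  [ exact: poly_bounded_const | exact: poly_bounded_id | apply: poly_boundedD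
  | apply: poly_boundedM | apply: poly_boundedX | apply: poly_boundedS ].

(* The program runs from any store, whatever garbage it holds outside variable
   0, and leaves all variables from [m] on untouched. *)
Definition computes (c : cmd) (m K : nat) (D : data -> Prop) (f : data -> data) :=
  forall s, D (s 0) ->
    data_size (f (s 0)) <= K * data_size (s 0) ^ K /\
    exists t s', [/\ exec c s t s', s' 0 = f (s 0),
      t <= K * data_size (s 0) ^ K & forall y, m <= y -> s' y = s y].

Definition FP (D : data -> Prop) (f : data -> data) :=
  exists c m K, computes c m K D f.

Lemma FP_intro D f c m F : poly_bounded F ->
  (forall s, D (s 0) -> data_size (f (s 0)) <= F (data_size (s 0)) /\
    exists t s', [/\ exec c s t s', s' 0 = f (s 0),
      t <= F (data_size (s 0)) & forall y, m <= y -> s' y = s y]) ->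
  FP D f.
Proof.
move=> [K HK] H; exists c, m, K => s Ds; have s0 := data_size_gt0 (s 0).
have [H1 [t [s' [H2 H3 H4 H5]]]] := H s Ds; split.
  exact: leq_trans H1 (HK _ s0).
by exists t, s'; split => //; apply: leq_trans H4 (HK _ s0).
Qed.

Lemma FP_elim D f : FP D f -> exists c m K, 0 < m /\ computes c m K D f.
Proof.
move=> [c [m [K H]]]; exists c, m.+1, K; split=> // s /H[H1 [t [s' [H2 H3 H4 H5]]]].
by split => //; exists t, s'; split => // y my; apply: H5; apply: ltnW.
Qed.

Lemma FP_sub D D' f : (forall d, D' d -> D d) -> FP D f -> FP D' f.
Proof. by move=> DD [c [m [K H]]]; exists c, m, K => s /DD; apply: H. Qed.

Lemma update_same s x d : update s x d x = d.
Proof. by rewrite /update eqxx. Qed.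

Lemma update_other s x d y : y != x -> update s x d y = s y.
Proof. by rewrite /update => /negbTE ->. Qed.

Lemma FP_id D : FP D id.
Proof.
apply: (@FP_intro _ _ Skip 1 (fun x => x + 1)); first by pbnd.
move=> s Ds; split; first by rewrite leq_addr.
by exists 1, s; split; [constructor| |rewrite leq_addl|].
Qed.

Lemma FP_const D z : FP D (fun=> Int z).
Proof.
apply: (@FP_intro _ _ (Assign 0 (Const z)) 1 (fun x => 2 + bit_length z)); first by pbnd.
move=> s Ds; split; first by rewrite leq_addl.
exists 2, (update s 0 (Int z)); split => //.
- by constructor.
- by move=> y y0; rewrite update_other// -lt0n.
Qed.

Lemma FP_comp D D' f g : FP D f -> FP D' g -> (forall d, D d -> D' (f d)) ->
  FP D (fun d => g (f d)).
Proof.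
move=> /FP_elim[c1 [m1 [K1 [m10 H1]]]] /FP_elim[c2 [m2 [K2 [m20 H2]]]] DD.
apply: (@FP_intro _ _ (Seq c1 c2) (maxn m1 m2)
  (fun x => K1 * x ^ K1 + K2 * (K1 * x ^ K1) ^ K2)); first by pbnd.
move=> s Ds; have [S1 [t1 [s1 [E1 V1 T1 F1]]]] := H1 s Ds.
have Ds1 : D' (s1 0) by rewrite V1; apply: DD.
have [S2 [t2 [s2 [E2 V2 T2 F2]]]] := H2 s1 Ds1.
have le2 : K2 * data_size (s1 0) ^ K2 <= K2 * (K1 * data_size (s 0) ^ K1) ^ K2.
  by rewrite V1 monomial_le// data_size_gt0.
split; first by rewrite -V1 (leq_trans S2)// (leq_trans le2)// leq_addl.
exists (t1 + t2), s2; split.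
- exact: exec_seq E1 E2.
- by rewrite V2 V1.
- by apply: leq_add => //; apply: leq_trans le2.
- by move=> y; rewrite geq_max => /andP[y1 y2]; rewrite F2// F1.
Qed.

Lemma FP_expr D f (e : expr) F (h : data -> data) : FP D f -> poly_bounded F ->
  (forall s, eval e s = h (s 0)) ->
  (forall s, cost e s <= F (data_size (s 0))) ->
  (forall d, data_size (h d) <= F (data_size d)) ->
  FP D (fun d => h (f d)).
Proof.
move=> Ff [K HK] eh ec hs; apply: (@FP_comp D (fun=> True)) => //.
apply: (@FP_intro _ _ (Assign 0 e) 1 (fun x => (K * x ^ K).+1)); first by pbnd.
move=> s _; have s0 := data_size_gt0 (s 0); split.
  by apply: leqW; apply: leq_trans (hs _) (HK _ s0).
exists (cost e s).+1, (update s 0 (eval e s)); split.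
- by constructor.
- by rewrite update_same eh.
- by rewrite ltnS; apply: leq_trans (ec _) (HK _ s0).
- by move=> y y0; rewrite update_other// -lt0n.
Qed.

Lemma FP_hd D f : FP D f -> FP D (fun d => hd (f d)).
Proof.
move=> Ff; apply: (@FP_expr _ _ (Hd (Var 0)) (fun x => x.+2)) => //=; first by pbnd.
by move=> d; rewrite !leqW// data_size_hd.
Qed.

Lemma FP_tl D f : FP D f -> FP D (fun d => tl (f d)).
Proof.
move=> Ff; apply: (@FP_expr _ _ (Tl (Var 0)) (fun x => x.+2)) => //=; first by pbnd.
by move=> d; rewrite !leqW// data_size_tl.
Qed.

Lemma FP_is_pair D f : FP D f -> FP D (fun d => of_bool (is_pair (f d))).
Proof.
move=> Ff; apply: (@FP_expr _ _ (IsPair (Var 0)) (fun x => x.+2) (fun d => of_bool (is_pair d))) => //=; first by pbnd.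
by move=> d; rewrite /= bit_length_bool.
Qed.

Lemma FP_pair D f g : FP D f -> FP D g -> FP D (fun d => Pair (f d) (g d)).
Proof.
move=> /FP_elim[c1 [m1 [K1 [m10 H1]]]] /FP_elim[c2 [m2 [K2 [m20 H2]]]].
pose m := maxn m1 m2.
have m0 : 0 < m by rewrite /m leq_max m10.
have mm : (m == m.+1) = false by apply/negbTE; rewrite neq_ltn ltnSn.
(* Variables from [m] on survive both programs: [m] keeps the input for the second one and [m.+1]
   keeps the first result. *)
pose c := Seq (Assign m (Var 0)) (Seq c1 (Seq (Assign m.+1 (Var 0))
  (Seq (Assign 0 (Var m)) (Seq c2 (Assign 0 (Cons (Var m.+1) (Var 0))))))).
apply: (@FP_intro _ _ c m.+2 (fun x => K1 * x ^ K1 + K2 * x ^ K2 + 10)); first by pbnd.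
move=> s Ds.
pose s1 := update s m (s 0).
have s10 : s1 0 = s 0 by rewrite /s1 update_other// eq_sym -lt0n.
have Ds1 : D (s1 0) by rewrite s10.
have [S2 [t2 [s2 [E2 V2 T2 F2]]]] := H1 s1 Ds1.
pose s3 := update s2 m.+1 (s2 0).
pose s4 := update s3 0 (s3 m).
have s40 : s4 0 = s 0.
  by rewrite /s4 update_same /s3 update_other ?mm// F2 ?leq_maxl// /s1 update_same.
have Ds4 : D (s4 0) by rewrite s40.
have [S5 [t5 [s5 [E5 V5 T5 F5]]]] := H2 s4 Ds4.
pose s6 := update s5 0 (Pair (s5 m.+1) (s5 0)).
split.
  rewrite /=; rewrite s10 in S2; rewrite s40 in S5.
  by move: S2 S5; lia.
exists (2 + (t2 + (2 + (2 + (t5 + 4))))), s6; split.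
- apply: (exec_seq (exec_assign s m (Var 0))).
  apply: (exec_seq E2); apply: (exec_seq (exec_assign s2 m.+1 (Var 0))).
  apply: (exec_seq (exec_assign s3 0 (Var m))).
  apply: (exec_seq E5); exact: (exec_assign s5 0 (Cons (Var m.+1) (Var 0))).
- rewrite /s6 update_same V5 s40; congr Pair.
  rewrite F5 ?leqW ?leq_maxr// /s4 update_other// /s3 update_same V2 s10//.
- by move: T2 T5; rewrite s10 s40; lia.
- move=> y my; have y0 : y != 0 by rewrite -lt0n (leq_trans _ my).
  have ym1 : y != m.+1 by rewrite gtn_eqF.
  have ym : y != m by rewrite gtn_eqF// ltnW.
  have [y1 y2] : m1 <= y /\ m2 <= y.
    by split; rewrite (leq_trans _ my)// !leqW// ?leq_maxl ?leq_maxr.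
  by rewrite /s6 update_other// F5// /s4 update_other// /s3 update_other// F2//
     /s1 update_other.
Qed.

Definition darith op (a b : data) := eval_arith op (to_int a) (to_int b).

Lemma data_size_darith op a b :
  data_size (darith op a b) <= data_size a + data_size b.
Proof.
apply: leq_trans (data_size_eval_arith _ _ _) _.
by apply: leq_add; apply: bit_length_to_int.
Qed.

Lemma FP_arith D op f g : FP D f -> FP D g -> FP D (fun d => darith op (f d) (g d)).
Proof.
move=> Ff Fg.
apply: (@FP_expr D (fun d => Pair (f d) (g d)) (Arith op (Hd (Var 0)) (Tl (Var 0)))
  (fun x => (2 + 2 + x * x).+1) (fun d => darith op (hd d) (tl d))) => //=.
- exact: FP_pair.
- by pbnd.
- move=> s; rewrite ltnS leq_add2l leq_mul//.
    exact: leq_trans (bit_length_to_int _) (data_size_hd _).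
  exact: leq_trans (bit_length_to_int _) (data_size_tl _).
- move=> d; apply: leq_trans (data_size_darith _ _ _) _.
  have := data_size_hd d; have := data_size_tl d; have := data_size_gt0 d; nia.
Qed.

Definition dif (c a b : data) : data := if truthy c then a else b.

(** Each branch only has to work where the test leads to it, so a test can protect a partial
    function such as the oracle. *)
Lemma FP_if D f g h : FP D f -> FP (fun d => D d /\ truthy (f d)) g ->
  FP (fun d => D d /\ ~~ truthy (f d)) h -> FP D (fun d => dif (f d) (g d) (h d)).
Proof.
move=> Ff /FP_elim[c1 [m1 [K1 [m10 H1]]]] /FP_elim[c2 [m2 [K2 [m20 H2]]]].
apply: (@FP_comp D (fun p => D (tl p) /\ hd p = f (tl p)) (fun d => Pair (f d) d)
  (fun p => dif (hd p) (g (tl p)) (h (tl p)))) => //.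
  exact: FP_pair Ff (FP_id D).
pose c := Cond (Hd (Var 0)) (Seq (Assign 0 (Tl (Var 0))) c1) (Seq (Assign 0 (Tl (Var 0))) c2).
apply: (@FP_intro _ _ c (maxn m1 m2) (fun x => K1 * x ^ K1 + K2 * x ^ K2 + 10)); first by pbnd.
move=> s [Ds hs].
pose s1 := update s 0 (tl (s 0)).
have s10 : s1 0 = tl (s 0) by rewrite /s1 update_same.
have le K : K * data_size (s1 0) ^ K <= K * data_size (s 0) ^ K.
  by rewrite monomial_le ?data_size_gt0// s10 data_size_tl.
rewrite /dif; have [th|th] := boolP (truthy (hd (s 0))).
- have [|S [t [s2 [E V T F]]]] := H1 s1; first by rewrite s10 -hs.
  split; first by rewrite -s10; move: S (le K1); lia.
  exists (2 + (3 + t)).+1, s2; split.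
  + apply: (@exec_cond_true (Hd (Var 0))) => //.
    by apply: exec_seq E; apply: (exec_assign s 0 (Tl (Var 0))).
  + by rewrite V s10.
  + by move: T (le K1); lia.
  + move=> y; rewrite geq_max => /andP[y1 y2]; rewrite F// /s1 update_other//.
    by rewrite -lt0n (leq_trans m10).
- have [|S [t [s2 [E V T F]]]] := H2 s1; first by rewrite s10 -hs.
  split; first by rewrite -s10; move: S (le K2); lia.
  exists (2 + (3 + t)).+1, s2; split.
  + apply: (@exec_cond_false (Hd (Var 0))) => //.
    by apply: exec_seq E; apply: (exec_assign s 0 (Tl (Var 0))).
  + by rewrite V s10.
  + by move: T (le K2); lia.
  + move=> y; rewrite geq_max => /andP[y1 y2]; rewrite F// /s1 update_other//.
    by rewrite -lt0n (leq_trans m10).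
Qed.

Fixpoint dfold (g : data -> data -> data) (l a : data) : data :=
  if l is Pair e l' then dfold g l' (g e a) else a.

Lemma dfold_size (g : data -> data -> data) P l a :
  (forall e a', data_size e <= data_size l ->
     data_size (g e a') <= data_size a' + P) ->
  data_size (dfold g l a) <= data_size a + data_size l * P.
Proof.
elim: l a => [z|e _ l IH] a H /=; first exact: leq_addr.
have Hl e' a' : data_size e' <= data_size l -> data_size (g e' a') <= data_size a' + P.
  by move=> el; apply: H => /=; rewrite (leq_trans el)// leqW// leq_addl.
apply: leq_trans (IH _ Hl) _.
have /(H e a) : data_size e <= data_size (Pair e l) by rewrite /= leqW// leq_addr.
by have := data_size_gt0 e; nia.
Qed.

(* The body may enlarge the accumulator only by an amount that depends on the
   rest of its environment: iterating it then keeps sizes polynomial. *)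
Lemma FP_fold D (g : data -> data -> data -> data) l i :
  FP D l -> FP D i ->
  FP (fun q => D (hd q)) (fun q => g (hd q) (hd (tl q)) (tl (tl q))) ->
  (exists K, forall d e a, D d ->
     data_size (g d e a) <= data_size a + K * data_size (Pair d e) ^ K) ->
  FP D (fun d => dfold (g d) (l d) (i d)).
Proof.
move=> Fl Fi /FP_elim[cg [m [K [m0 Hg]]]] [K' gr].
apply: (@FP_comp D (fun p => D (hd p)) (fun d => Pair d (Pair (l d) (i d)))
  (fun p => dfold (g (hd p)) (hd (tl p)) (tl (tl p)))) => //.
  exact: FP_pair (FP_id D) (FP_pair Fl Fi).
pose body := Seq (Assign 0 (Cons (Var m) (Cons (Hd (Var m.+1)) (Var m.+2))))
  (Seq cg (Seq (Assign m.+2 (Var 0)) (Assign m.+1 (Tl (Var m.+1))))).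
pose loop := While (IsPair (Var m.+1)) body.
pose c := Seq (Assign m (Hd (Var 0))) (Seq (Assign m.+1 (Hd (Tl (Var 0))))
  (Seq (Assign m.+2 (Tl (Tl (Var 0)))) (Seq loop (Assign 0 (Var m.+2))))).
(* bounds for one increment of the accumulator, for the accumulator, and for the
   time of one iteration *)
pose P x := K' * (x + x).+1 ^ K'.
pose A x := x + x * P x.
pose G x := K * ((x + (x + A x).+1).+1) ^ K + 20.
have PP : poly_bounded P by pbnd.
have PA : poly_bounded A by pbnd.
have PG : poly_bounded G by pbnd.
apply: (@FP_intro _ _ c m.+3 (fun x => A x + x * G x + 20)); first by pbnd.
move=> s0 Ds.
set d := hd (s0 0); set L := hd (tl (s0 0)); set a0 := tl (tl (s0 0)).
set X := data_size (s0 0).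
have dX : data_size d <= X by apply: data_size_hd.
have LX : data_size L <= X by apply: leq_trans (data_size_hd _) (data_size_tl _).
have a0X : data_size a0 <= X by apply: leq_trans (data_size_tl _) (data_size_tl _).
have gP e a : data_size e <= X -> data_size (g d e a) <= data_size a + P X.
  move=> eX; have := gr d e a Ds; move=> /leq_trans; apply.
  by rewrite leq_add2l monomial_le//= ltnS leq_add.
have szA : data_size (dfold (g d) L a0) <= A X.
  have := @dfold_size (g d) (P X) L a0 (fun e a' eL => gP e a' (leq_trans eL LX)).
  by move=> /leq_trans; apply; rewrite /A leq_add// leq_mul.
split; first by move: szA; lia.
have neq : [/\ (m == m.+1) = false, (m == m.+2) = false & (m.+1 == m.+2) = false].
  by split; apply/negbTE; rewrite neq_ltn; apply/orP; left; lia.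
have [mn1 mn2 mn3] := neq.
have mS0 : (m == 0) = false by apply/negbTE; rewrite -lt0n.
(* The last hypothesis reserves [P X] for every cell still to be read; this budget keeps the
   accumulator below [A X] in every round. *)
have loopE : forall l' s, s m = d -> s m.+1 = l' ->
    data_size l' <= X -> data_size (s m.+2) + data_size l' * P X <= A X ->
    exists t s', [/\ exec loop s t s', s' m.+2 = dfold (g d) l' (s m.+2),
      t <= data_size l' * G X + 3
      & forall y, m.+3 <= y -> s' y = s y].
  elim=> [z|e _ l' IH] s sm sm1 lX sA.
    exists 3, s; split => //; rewrite ?leq_addl//.
    by apply: exec_while_false; rewrite /= sm1.
  pose s1 := update s 0 (Pair (s m) (Pair (hd (s m.+1)) (s m.+2))).
  have s10 : s1 0 = Pair d (Pair e (s m.+2)) by rewrite /s1 update_same sm sm1.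
  have [|S [t2 [s2 [E2 V2 T2 F2]]]] := Hg s1; first by rewrite s10.
  pose s3 := update s2 m.+2 (s2 0).
  pose s4 := update s3 m.+1 (tl (s3 m.+1)).
  have s2m k : m <= k -> s2 k = s k.
    by move=> mk; rewrite F2// /s1 update_other// -lt0n (leq_trans m0).
  have s4m : s4 m = d.
    by rewrite /s4 update_other ?mn1// /s3 update_other ?mn2// s2m.
  have s4m1 : s4 m.+1 = l'.
    by rewrite /s4 update_same /s3 update_other ?mn3// s2m ?leqnSn// sm1.
  have s4m2 : s4 m.+2 = g d e (s m.+2).
    by rewrite /s4 update_other ?(eq_sym m.+2) ?mn3// /s3 update_same V2 s10.
  have eX : data_size e <= X by rewrite (leq_trans _ lX)//= leqW// leq_addr.
  have lX' : data_size l' <= X by rewrite (leq_trans _ lX)//= leqW// leq_addl.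
  have := gP e (s m.+2) eX; rewrite -s4m2 => g4.
  have e1 := data_size_gt0 e.
  have [|t5 [s5 [E5 V5 T5 F5]]] := IH s4 s4m s4m1 lX'.
    by apply: leq_trans sA => /=; nia.
  pose t1 := cost (Cons (Var m) (Cons (Hd (Var m.+1)) (Var m.+2))) s.
  have t1E : t1 = 6 by [].
  exists (2 + (t1.+1 + (t2 + (2 + 3))) + t5).+1, s5; split.
  - apply: (@exec_while_true (IsPair (Var m.+1)) _ _ s4) => //; first by rewrite /= sm1.
    apply: (exec_seq (exec_assign s 0 _)); apply: (exec_seq E2).
    apply: (exec_seq (exec_assign s2 m.+2 (Var 0))).
    exact: (exec_assign s3 m.+1 (Tl (Var m.+1))).
  - by rewrite V5 s4m2.
  - have t2G : t2 + 20 <= G X.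
      rewrite /G leq_add2r; apply: leq_trans T2 _.
      rewrite s10 monomial_le//= !ltnS leq_add// ltnS leq_add//.
      by apply: leq_trans sA; rewrite leq_addr.
    rewrite t1E /=; move: T5 t2G; nia.
  - move=> y my.
    rewrite F5// /s4 update_other; last by rewrite gtn_eqF//; lia.
    by rewrite /s3 update_other ?gtn_eqF// s2m//; lia.
pose s1 := update s0 m (hd (s0 0)).
pose s2 := update s1 m.+1 (hd (tl (s1 0))).
pose s3 := update s2 m.+2 (tl (tl (s2 0))).
have s10 : s1 0 = s0 0 by rewrite /s1 update_other// eq_sym mS0.
have s20 : s2 0 = s0 0 by rewrite /s2 update_other// s10.
have s3m : s3 m = d.
  by rewrite /s3 update_other ?mn2// /s2 update_other ?mn1// /s1 update_same.
have s3m1 : s3 m.+1 = L.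
  by rewrite /s3 update_other ?mn3// /s2 update_same s10.
have s3m2 : s3 m.+2 = a0 by rewrite /s3 update_same s20.
have [||t4 [s4 [E4 V4 T4 F4]]] := loopE L s3 s3m s3m1 => //.
  by rewrite s3m2 /A leq_add// leq_mul.
exists (3 + (4 + (4 + (t4 + 2)))), (update s4 0 (s4 m.+2)); split.
- apply: (exec_seq (exec_assign s0 m (Hd (Var 0)))).
  apply: (exec_seq (exec_assign s1 m.+1 (Hd (Tl (Var 0))))).
  apply: (exec_seq (exec_assign s2 m.+2 (Tl (Tl (Var 0))))).
  by apply: (exec_seq E4); apply: (exec_assign s4 0 (Var m.+2)).
- by rewrite update_same V4 s3m2.
- by move: T4 LX; nia.
- move=> y my; rewrite update_other; last by rewrite -lt0n; lia.
  rewrite F4// /s3 update_other ?gtn_eqF// /s2 update_other ?gtn_eqF ?(ltnW my)//.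
  by rewrite /s1 update_other// gtn_eqF//; lia.
Qed.

(** * Running a given program as a subroutine *)

Lemma exec_deterministic c s t1 s1 t2 s2 :
  exec c s t1 s1 -> exec c s t2 s2 -> t1 = t2 /\ s1 = s2.
Proof.
move=> E; elim: E t2 s2 => {c s t1 s1}.
all: intros; match goal with H : exec _ _ _ _ |- _ =>
  match goal with |- _ = ?t /\ _ = ?u => match type of H with exec _ _ t u =>
    inversion H; subst end end end.
all: try by match goal with H : is_true (~~ ?b), H' : is_true ?b |- _ =>
  rewrite H' in H end.
all: repeat match goal with
  IH : forall t s, exec ?c ?s0 t s -> _, H : exec ?c ?s0 _ _ |- _ =>
    let e1 := fresh in let e2 := fresh in
    destruct (IH _ _ H) as [e1 e2]; clear IH; subst end.
all: by [].
Qed.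

Fixpoint shift_expr k (e : expr) : expr :=
  match e with
  | Var x => Var (k + x)
  | Const z => Const z
  | Cons e1 e2 => Cons (shift_expr k e1) (shift_expr k e2)
  | Hd e1 => Hd (shift_expr k e1)
  | Tl e1 => Tl (shift_expr k e1)
  | IsPair e1 => IsPair (shift_expr k e1)
  | Arith op e1 e2 => Arith op (shift_expr k e1) (shift_expr k e2)
  end.

Fixpoint shift k (c : cmd) : cmd :=
  match c with
  | Skip => Skip
  | Assign x e => Assign (k + x) (shift_expr k e)
  | Seq c1 c2 => Seq (shift k c1) (shift k c2)
  | Cond e c1 c2 => Cond (shift_expr k e) (shift k c1) (shift k c2)
  | While e c1 => While (shift_expr k e) (shift k c1)
  end.

Fixpoint expr_vars (e : expr) : nat :=
  match e with
  | Var x => x.+1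
  | Const _ => 0
  | Cons e1 e2 | Arith _ e1 e2 => maxn (expr_vars e1) (expr_vars e2)
  | Hd e1 | Tl e1 | IsPair e1 => expr_vars e1
  end.

Fixpoint cmd_vars (c : cmd) : nat :=
  match c with
  | Skip => 0
  | Assign x e => maxn x.+1 (expr_vars e)
  | Seq c1 c2 => maxn (cmd_vars c1) (cmd_vars c2)
  | Cond e c1 c2 => maxn (expr_vars e) (maxn (cmd_vars c1) (cmd_vars c2))
  | While e c1 => maxn (expr_vars e) (cmd_vars c1)
  end.

Lemma eval_shift k m e s s2 : expr_vars e <= m ->
  (forall x, x < m -> s2 (k + x) = s x) ->
  eval (shift_expr k e) s2 = eval e s /\ cost (shift_expr k e) s2 = cost e s.
Proof.
move=> + ss; elim: e => //=.
- by move=> x /ss ->.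
- by move=> e1 IH1 e2 IH2; rewrite geq_max => /andP[/IH1[-> ->] /IH2[-> ->]].
- by move=> e1 IH1 /IH1[-> ->].
- by move=> e1 IH1 /IH1[-> ->].
- by move=> e1 IH1 /IH1[-> ->].
- by move=> op e1 IH1 e2 IH2; rewrite geq_max => /andP[/IH1[-> ->] /IH2[-> ->]].
Qed.

(** Costs do not depend on the names of variables, so a window of [m] variables starting at [k]
    replays the run step by step. Leaving everything outside the window alone is what lets a foreign
    program run next to saved values. *)
Lemma exec_shift k m c s t s' s2 : exec c s t s' -> cmd_vars c <= m ->
  (forall x, x < m -> s2 (k + x) = s x) ->
  exists s2', [/\ exec (shift k c) s2 t s2',
    forall x, x < m -> s2' (k + x) = s' x
    & forall y, y < k \/ k + m <= y -> s2' y = s2 y].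
Proof.
move=> E; elim: E s2 => {c s t s'}.
- by move=> s s2 _ ss; exists s2; split => //; constructor.
- move=> s x e s2 /=; rewrite geq_max => /andP[xm em] ss.
  have [ev ec] := eval_shift em ss.
  exists (update s2 (k + x) (eval e s)); split.
  + by rewrite -ev -ec; constructor.
  + by move=> y ym; rewrite /update eqn_add2l; case: ifP => // _; apply: ss.
  + by move=> y yk; rewrite update_other//; apply/negP => /eqP; lia.
- move=> c1 c2 s1 s2 s3 t1 t2 _ IH1 _ IH2 s4 /=; rewrite geq_max => /andP[m1 m2] ss.
  have [s5 [E5 V5 F5]] := IH1 _ m1 ss; have [s6 [E6 V6 F6]] := IH2 _ m2 V5.
  exists s6; split => //; first exact: exec_seq E5 E6.
  by move=> y yk; rewrite F6// F5.
- move=> e c1 c2 s s' t th _ IH s2 /=; rewrite !geq_max => /and3P[em m1 m2] ss.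
  have [ev ec] := eval_shift em ss; have [s3 [E3 V3 F3]] := IH _ m1 ss.
  by exists s3; split => //; rewrite -ec; apply: exec_cond_true; rewrite ?ev.
- move=> e c1 c2 s s' t th _ IH s2 /=; rewrite !geq_max => /and3P[em m1 m2] ss.
  have [ev ec] := eval_shift em ss; have [s3 [E3 V3 F3]] := IH _ m2 ss.
  by exists s3; split => //; rewrite -ec; apply: exec_cond_false; rewrite ?ev.
- move=> e c s th s2 /=; rewrite geq_max => /andP[em m1] ss.
  have [ev ec] := eval_shift em ss.
  by exists s2; split => //; rewrite -ec; apply: exec_while_false; rewrite ev.
- move=> e c s1 s2 s3 t1 t2 th _ IH1 _ IH2 s4 /[dup] m0 /=.
  rewrite geq_max => /andP[em m1] ss.
  have [ev ec] := eval_shift em ss.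
  have [s5 [E5 V5 F5]] := IH1 _ m1 ss; have [s6 [E6 V6 F6]] := IH2 _ m0 V5.
  exists s6; split => //; last by move=> y yk; rewrite F6// F5.
  by rewrite -ec; apply: exec_while_true E5 E6; rewrite ev.
Qed.

(** A program is only specified on stores that are zero outside the input, so its window has to be
    wiped before every call. *)
Fixpoint clear k m : cmd :=
  if m is m'.+1 then Seq (clear k m') (Assign (k + m') (Const 0%R)) else Skip.

Lemma exec_clear k m s : exists s',
  exec (clear k m) s (m * 2 + 1) s' /\
  forall y, s' y = if k <= y < k + m then Int 0%R else s y.
Proof.
elim: m => [|m [s' [E V]]].
  by exists s; split; [constructor|move=> y; case: ifP => //; lia].
exists (update s' (k + m) (Int 0%R)); split.
  have -> : m.+1 * 2 + 1 = (m * 2 + 1) + 2 by lia.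
  exact: exec_seq E (exec_assign s' (k + m) (Const 0%R)).
move=> y; rewrite /update V; case: eqP => [->|yk].
  by case: ifP => //; lia.
by case: ifP; case: ifP => //; lia.
Qed.

(** Unlike the size of a tree, the length of its leaves grows by no more than the time spent. *)
Fixpoint leaf_size (d : data) : nat :=
  match d with
  | Int z => bit_length z
  | Pair d1 d2 => maxn (leaf_size d1) (leaf_size d2)
  end.

Lemma leaf_size_gt0 d : 0 < leaf_size d.
Proof. by elim: d => //= d1 H1 d2 H2; rewrite leq_max H1. Qed.

Lemma leaf_size_le d : leaf_size d <= data_size d.
Proof. by elim: d => //= d1 H1 d2 H2; rewrite geq_max; lia. Qed.

Fixpoint expr_const (e : expr) : nat :=
  match e with
  | Var x => 0
  | Const z => bit_length z
  | Cons e1 e2 | Arith _ e1 e2 => maxn (expr_const e1) (expr_const e2)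
  | Hd e1 | Tl e1 | IsPair e1 => expr_const e1
  end.

Fixpoint cmd_const (c : cmd) : nat :=
  match c with
  | Skip => 0
  | Assign x e => expr_const e
  | Seq c1 c2 => maxn (cmd_const c1) (cmd_const c2)
  | Cond e c1 c2 => maxn (cmd_const c1) (cmd_const c2)
  | While e c1 => cmd_const c1
  end.

(** An arithmetic result is no longer than its operands together, and lengths $a, b \ge 1$ satisfy
    $a + b \le ab + 1$, which has been charged. *)
Lemma leaf_size_eval L e s : (forall x, leaf_size (s x) <= L) ->
  expr_const e <= L -> leaf_size (eval e s) <= L + cost e s.
Proof.
move=> sL; have L0 : 0 < L by apply: leq_trans (leaf_size_gt0 _) (sL 0).
elim: e => /=.
- by move=> x _; apply: leq_trans (sL x) (leq_addr _ _).
- by move=> z zL; rewrite (leq_trans zL)// leq_addr.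
- move=> e1 IH1 e2 IH2; rewrite geq_max => /andP[/IH1 H1 /IH2 H2].
  by rewrite geq_max; lia.
- move=> e1 IH1 /IH1; case: (eval e1 s) => /= [z _|d1 d2]; last by rewrite geq_max; lia.
  by rewrite (_ : bit_length 0 = 1)//; lia.
- move=> e1 IH1 /IH1; case: (eval e1 s) => /= [z _|d1 d2]; last by rewrite geq_max; lia.
  by rewrite (_ : bit_length 0 = 1)//; lia.
- by move=> e1 IH1 _; rewrite bit_length_bool; lia.
- move=> op e1 _ e2 _ _.
  have := data_size_eval_arith op (to_int (eval e1 s)) (to_int (eval e2 s)).
  have := leaf_size_le (eval_arith op (to_int (eval e1 s)) (to_int (eval e2 s))).
  have b0 z : 0 < bit_length z by [].
  have := b0 (to_int (eval e1 s)); have := b0 (to_int (eval e2 s)).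
  by nia.
Qed.

Lemma leaf_size_exec c s t s' L : exec c s t s' ->
  (forall x, leaf_size (s x) <= L) -> cmd_const c <= L ->
  forall x, leaf_size (s' x) <= L + t.
Proof.
move=> E; elim: E L => {c s t s'} /=.
- by move=> s L sL _ x; rewrite (leq_trans (sL x))// leq_addr.
- move=> s x e L sL eL y; rewrite /update; case: eqP => _.
    by rewrite addnS leqW// leaf_size_eval.
  by rewrite (leq_trans (sL y))// leq_addr.
- move=> c1 c2 s1 s2 s3 t1 t2 _ IH1 _ IH2 L sL; rewrite geq_max => /andP[c1L c2L].
  by rewrite addnA; apply: IH2; [apply: IH1|rewrite (leq_trans c2L)// leq_addr].
- move=> e c1 c2 s s' t _ _ IH L sL; rewrite geq_max => /andP[c1L c2L] x.
  by rewrite (leq_trans (IH L sL c1L x))//; lia.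
- move=> e c1 c2 s s' t _ _ IH L sL; rewrite geq_max => /andP[c1L c2L] x.
  by rewrite (leq_trans (IH L sL c2L x))//; lia.
- by move=> e c s _ L sL _ x; rewrite (leq_trans (sL x))// leq_addr.
- move=> e c s1 s2 s3 t1 t2 _ _ IH1 _ IH2 L sL cL x.
  have cL' : cmd_const c <= L + t1 by rewrite (leq_trans cL)// leq_addr.
  by rewrite (leq_trans (IH2 _ (IH1 L sL cL) cL' x))//; lia.
Qed.

(** The running time bounds the leaves of the output but not the tree. The second hypothesis closes
    this gap: it holds for outputs that are lists of integers of controlled length. *)
Lemma FP_oracle (p : cmd) (k : nat) (D : data -> Prop) (orc : data -> data) :
  (forall d, D d -> exists2 t, runs p d t (orc d) & t <= k * data_size d ^ k) ->
  (forall d, D d ->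
     data_size (orc d) <= (data_size d).+1 * (leaf_size (orc d)).+1) ->
  FP D orc.
Proof.
move=> Hrun Hshape; pose m := (cmd_vars p).+1.
pose c := Seq (clear 1 m) (Seq (Assign 1 (Var 0)) (Seq (shift 1 p) (Assign 0 (Var 1)))).
pose T x := k * x ^ k.
apply: (@FP_intro _ _ c m.+1
  (fun x => x.+1 * (x + cmd_const p + 1 + T x).+1 + (T x + m * 2 + 10))); first by rewrite /T; pbnd.
move=> s Ds; have [t [s1 E1 V1] T1] := Hrun _ Ds.
have [s2 [E2 V2]] := exec_clear 1 m s.
pose s3 := update s2 1 (s2 0).
have [|s4 [E4 V4 F4]] := @exec_shift 1 m _ _ _ _ s3 E1 (leqnSn _).
  move=> x xm; rewrite /s3 /update V2 add1n.
  by case: x xm => [//|x] xm /=; rewrite V2 add1n; case: ifP => //; lia.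
have sz := data_size_gt0 (s 0).
split.
  apply: leq_trans (Hshape _ Ds) _; rewrite -[X in X <= _]addn0 leq_add//.
  rewrite leq_mul// ltnS -V1.
  have init x : leaf_size (update (fun=> Int 0%R) 0 (s 0) x) <= data_size (s 0) + cmd_const p + 1.
    rewrite /update; case: eqP => _; last by rewrite /= (_ : bit_length 0 = 1)//; lia.
    by have := leaf_size_le (s 0); lia.
  apply: leq_trans (leaf_size_exec E1 init _ 0) _; first by lia.
  by rewrite leq_add2l.
exists ((m * 2 + 1) + (2 + (t + 2))), (update s4 0 (s4 1)); split.
- apply: (exec_seq E2); apply: (exec_seq (exec_assign s2 1 (Var 0))).
  by apply: (exec_seq E4); apply: (exec_assign s4 0 (Var 1)).
- by rewrite update_same (V4 0).
- by rewrite /T; lia.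
- move=> y my; rewrite update_other; last by lia.
  rewrite F4; last by right.
  rewrite /s3 update_other; last by lia.
  by rewrite V2; case: ifP => //; lia.
Qed.

(** * Derived operations on integers and arrays *)

Notation dadd := (darith Add).
Notation dsub := (darith Sub).
Notation dmul := (darith Mul).
Notation ddiv := (darith Div).
Notation dle := (darith Leq).
Notation dint k := (Int (Posz k)).

Definition dlt (a b : data) := dif (dle b a) (dint 0) (dint 1).
Definition deq (a b : data) := dif (dle a b) (dle b a) (dint 0).
Definition dand (a b : data) := dif a b (dint 0).
Definition dmod (a b : data) := dsub a (dmul (ddiv a b) b).
(** Adding 0 turns an ill-typed value into an integer. Hence the size of the result is bounded by
    that of [W] whatever [a] is, which is the main device for keeping loops polynomial. *)
Definition dclamp (W a : data) :=
  dif (dle (dsub (dint 0) W) a) (dif (dle a W) (dadd a (dint 0)) (dint 0)) (dint 0).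

(* Arrays are indexed through [idx], the list [n-1, ..., 0]: folding over it
   counts, and consing up along it builds an array in increasing order. *)
Definition drep (f : data -> data) (idx x a : data) :=
  dfold (fun e acc => dif (dlt e x) (f acc) acc) idx a.
Definition dnth (idx l i : data) := hd (drep tl idx i l).
Definition dpow2 (idx x : data) := drep (dmul (dint 2)) idx x (dint 1).
Definition dmk (idx : data) (F : data -> data) (t : data) :=
  dfold (fun e acc => Pair (F e) acc) idx t.
Definition dsum (idx : data) (F : data -> data) :=
  dfold (fun e acc => dadd acc (F e)) idx (dint 0).

Definition FP2 (D : data -> Prop) (F : data -> data -> data) :=
  FP (fun q => D (hd q)) (fun q => F (hd q) (tl q)).

Lemma FP_lift D D' f g : FP D f -> FP D' g -> (forall d, D' d -> D (g d)) ->
  FP D' (fun q => f (g q)).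
Proof. by move=> Ff Fg H; apply: FP_comp Fg Ff H. Qed.

Lemma FP_if_simple D f g h : FP D f -> FP D g -> FP D h ->
  FP D (fun d => dif (f d) (g d) (h d)).
Proof. by move=> Ff Fg Fh; apply: FP_if => //; [apply: FP_sub Fg|apply: FP_sub Fh] => d []. Qed.

Lemma FP_dlt D f g : FP D f -> FP D g -> FP D (fun d => dlt (f d) (g d)).
Proof.
by move=> Ff Fg; apply: FP_if_simple; [apply: FP_arith|apply: FP_const|apply: FP_const].
Qed.

Lemma FP_deq D f g : FP D f -> FP D g -> FP D (fun d => deq (f d) (g d)).
Proof.
by move=> Ff Fg; apply: FP_if_simple; [apply: FP_arith|apply: FP_arith|apply: FP_const].
Qed.

Lemma FP_dand D f g : FP D f -> FP D g -> FP D (fun d => dand (f d) (g d)).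
Proof. by move=> Ff Fg; apply: FP_if_simple => //; apply: FP_const. Qed.

Lemma FP_dmod D f g : FP D f -> FP D g -> FP D (fun d => dmod (f d) (g d)).
Proof. by move=> Ff Fg; do ![apply: FP_arith => //]. Qed.

Lemma FP_dclamp D f g : FP D f -> FP D g -> FP D (fun d => dclamp (f d) (g d)).
Proof.
move=> Ff Fg; do ?[apply: FP_if_simple|apply: FP_arith|apply: FP_const] => //.
Qed.

(** When each round adds one polynomial-time value to the accumulator, the size bound of that value
    already controls the increment. *)
Lemma FP_fold_FP D (g h : data -> data -> data -> data) l i :
  FP D l -> FP D i ->
  FP (fun q => D (hd q)) (fun q => g (hd q) (hd (tl q)) (tl (tl q))) ->
  FP2 D (fun d e => h d e (dint 0)) ->
  (forall d e a, D d -> data_size (g d e a) <= data_size a + (data_size (h d e (dint 0))).+1) ->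
  FP D (fun d => dfold (g d) (l d) (i d)).
Proof.
move=> Fl Fi Fg [c [m [K Fh]]] gh; apply: FP_fold => //.
have [K' HK'] : poly_bounded (fun x => (K * x ^ K).+1) by pbnd.
exists K' => d e a Dd; apply: leq_trans (gh _ _ _ Dd) _; rewrite leq_add2l.
apply: leq_trans _ (HK' _ (data_size_gt0 _)); rewrite ltnS.
by have [|+ _] := Fh (fun=> Pair d e).
Qed.

Lemma FP2_arg D D' F f g : FP2 D F -> FP D' f -> FP D' g ->
  (forall d, D' d -> D (f d)) -> FP D' (fun q => F (f q) (g q)).
Proof. by move=> FF Ff Fg H; apply: (FP_lift FF) (FP_pair Ff Fg) H. Qed.

Lemma FP_dmk D idx F t : FP D idx -> FP2 D F -> FP D t ->
  FP D (fun d => dmk (idx d) (F d) (t d)).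
Proof.
move=> Fi FF Ft; apply: (@FP_fold_FP D (fun d e a => Pair (F d e) a) (fun d e _ => F d e)) => //.
- apply: FP_pair; last by apply/FP_tl/FP_tl/FP_id.
  by apply: (FP2_arg FF) => //; [apply/FP_hd/FP_id|apply/FP_hd/FP_tl/FP_id].
- by move=> d e a _ /=; lia.
Qed.

Lemma FP_dsum D idx F : FP D idx -> FP2 D F ->
  FP D (fun d => dsum (idx d) (F d)).
Proof.
move=> Fi FF; apply: (@FP_fold_FP D (fun d e a => dadd a (F d e)) (fun d e _ => F d e)) => //.
- exact: FP_const.
- apply: FP_arith; first by apply/FP_tl/FP_tl/FP_id.
  by apply: (FP2_arg FF) => //; [apply/FP_hd/FP_id|apply/FP_hd/FP_tl/FP_id].
- by move=> d e a _; rewrite (leq_trans (data_size_darith _ _ _))// addnS leqnSn.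
Qed.

Lemma FP_drep D f idx x a : FP (fun=> True) f ->
  (forall d, data_size (f d) <= (data_size d).+2) ->
  FP D idx -> FP D x -> FP D a -> FP D (fun d => drep f (idx d) (x d) (a d)).
Proof.
move=> Ff fs Fi Fx Fa.
apply: (@FP_fold D (fun d e a => dif (dlt e (x d)) (f a) a)) => //.
- apply: FP_if_simple; last by apply/FP_tl/FP_tl/FP_id.
  + apply: FP_dlt; first by apply/FP_hd/FP_tl/FP_id.
    by apply: (FP_lift Fx) => //; apply/FP_hd/FP_id.
  + by apply: (FP_lift Ff) => //; apply/FP_tl/FP_tl/FP_id.
- exists 2 => d e b _; rewrite /dif; case: ifP => _; last by rewrite leq_addr.
  have := fs b; have : 0 < data_size (Pair d e) ^ 2 by rewrite expn_gt0.
  by lia.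
Qed.

Lemma FP_dnth D idx l i : FP D idx -> FP D l -> FP D i ->
  FP D (fun d => dnth (idx d) (l d) (i d)).
Proof.
move=> Fi Fl Fx; apply/FP_hd/FP_drep => //; first exact/FP_tl/FP_id.
by move=> d; rewrite !leqW// data_size_tl.
Qed.

Lemma FP_dpow2 D idx i : FP D idx -> FP D i -> FP D (fun d => dpow2 (idx d) (i d)).
Proof.
move=> Fi Fx; apply/FP_drep => //; last exact: FP_const.
  by apply/FP_arith/FP_id/FP_const.
move=> d; apply: leq_trans (data_size_darith _ _ _) _.
by rewrite (_ : data_size (dint 2) = 2).
Qed.

Lemma data_size_dclamp W a : data_size (dclamp W a) <= data_size W.
Proof.
rewrite /dclamp /dif /=; case: ifP => //= aW; last exact: data_size_gt0.
case: ifP => //= Wa; last exact: data_size_gt0.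
apply: leq_trans _ (bit_length_to_int W); apply: bit_length_mono.
by move: aW Wa; case: lerP => // aW _; case: lerP => // Wa _; lia.
Qed.

Lemma data_size_dmk idx F t P : (forall e, data_size (F e) <= P) ->
  data_size (dmk idx F t) <= data_size t + data_size idx * P.+1.
Proof.
by move=> H; apply: dfold_size => e a _ /=; have := H e; lia.
Qed.

Ltac fp_step :=
  lazymatch goal with
  | |- FP2 _ _ => unfold FP2; cbv beta
  | |- FP ?D hd => apply: (@FP_hd D id)
  | |- FP ?D tl => apply: (@FP_tl D id)
  | |- FP _ id => exact: FP_id
  | |- FP ?D (fun d => Pair (@?f d) (@?g d)) => apply: (@FP_pair D f g)
  | |- FP ?D (fun d => d) => exact: FP_id
  | |- FP _ (fun _ => Int _) => exact: FP_const
  | |- FP ?D (fun d => hd (@?f d)) => apply: (@FP_hd D f)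
  | |- FP ?D (fun d => tl (@?f d)) => apply: (@FP_tl D f)
  | |- FP ?D (fun d => of_bool (is_pair (@?f d))) => apply: (@FP_is_pair D f)
  | |- FP ?D (fun d => darith ?op (@?f d) (@?g d)) => apply: (@FP_arith D op f g)
  | |- FP ?D (fun d => dlt (@?f d) (@?g d)) => apply: (@FP_dlt D f g)
  | |- FP ?D (fun d => deq (@?f d) (@?g d)) => apply: (@FP_deq D f g)
  | |- FP ?D (fun d => dand (@?f d) (@?g d)) => apply: (@FP_dand D f g)
  | |- FP ?D (fun d => dmod (@?f d) (@?g d)) => apply: (@FP_dmod D f g)
  | |- FP ?D (fun d => dclamp (@?f d) (@?g d)) => apply: (@FP_dclamp D f g)
  | |- FP ?D (fun d => dif (@?f d) (@?g d) (@?h d)) => apply: (@FP_if_simple D f g h)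
  | |- FP ?D (fun d => dnth (@?f d) (@?g d) (@?h d)) => apply: (@FP_dnth D f g h)
  | |- FP ?D (fun d => dpow2 (@?f d) (@?g d)) => apply: (@FP_dpow2 D f g)
  | |- FP ?D (fun d => dmk (@?f d) (@?g d) (@?h d)) => apply: (@FP_dmk D f g h)
  | |- FP ?D (fun d => dsum (@?f d) (@?g d)) => apply: (@FP_dsum D f g)
  end.
Ltac fp := repeat fp_step.

(** * Values of the operations on encoded arrays *)

Definition didx n : data := encode_seq [seq dint i | i <- rev (iota 0 n)].
Definition dvec (V : seq int) : data := encode_seq [seq Int z | z <- V].

Lemma dfold_encode g l a : dfold g (encode_seq l) a = foldl (fun acc e => g e acc) a l.
Proof. by elim: l a => //= e l IH a; rewrite IH. Qed.

Lemma dmk_encode n F l :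
  dmk (didx n) F (encode_seq l) = encode_seq ([seq F (dint i) | i <- iota 0 n] ++ l).
Proof.
rewrite /dmk /didx dfold_encode map_rev foldl_rev.
by elim: (iota 0 n) => //= i s ->.
Qed.

Lemma dmk_dvec n F (f : nat -> int) : (forall i, i < n -> F (dint i) = Int (f i)) ->
  dmk (didx n) F (dint 0) = dvec (mkseq f n).
Proof.
move=> Ff; rewrite (dmk_encode n F [::]) cats0 /dvec /mkseq -map_comp.
by congr encode_seq; apply/eq_in_map => i; rewrite mem_iota => /andP[_ /Ff].
Qed.

Lemma dsum_didx n F (f : nat -> int) : (forall i, i < n -> F (dint i) = Int (f i)) ->
  dsum (didx n) F = Int (\sum_(i < n) f i)%R.
Proof.
move=> Ff; rewrite /dsum /didx dfold_encode map_rev foldl_rev -(big_mkord xpredT) /index_iota subn0.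
have : forall i, i \in iota 0 n -> F (dint i) = Int (f i).
  by move=> i; rewrite mem_iota => /andP[_ /Ff].
elim: (iota 0 n) => [|i s IH] H /=; first by rewrite big_nil.
rewrite IH; last by move=> j js; apply: H; rewrite inE js orbT.
by rewrite H ?mem_head// big_cons /darith /= addrC.
Qed.

Lemma drep_didx n f x a : drep f (didx n) (dint x) a = iter (minn x n) f a.
Proof.
rewrite /drep /didx dfold_encode map_rev foldl_rev.
have : minn x n = count (fun i => i < x) (iota 0 n).
  elim: n => [|n IH]; first by rewrite minn0.
  by rewrite -addn1 iotaD count_cat -IH /= add0n addn0; case: ltnP; lia.
move=> ->; elim: (iota 0 n) => //= i s IH; rewrite IH /dif /dlt /dif /darith /= lez_nat.
by case: leqP.
Qed.

Lemma iter_tl_encode k (l : seq data) : size l <= k -> iter k tl (encode_seq l) = dint 0.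
Proof.
have H : iter k tl (dint 0) = dint 0 by elim: k => //= k ->.
elim: l k H => [|e l IH] k H //= lk; case: k H lk => // k H lk.
rewrite iterSr /=; apply: IH => //.
by move: H; rewrite iterSr.
Qed.

Lemma hd_iter_tl l i : hd (iter i tl (encode_seq l)) = nth (dint 0) l i.
Proof.
elim: l i => [|e l IH] i; first by rewrite nth_nil (iter_tl_encode (l := [::])).
by case: i => [|i] //; rewrite iterSr /= IH.
Qed.

Lemma dnth_encode n l i : size l <= n ->
  dnth (didx n) (encode_seq l) (dint i) = nth (dint 0) l i.
Proof.
move=> ln; rewrite /dnth drep_didx hd_iter_tl; case: (leqP i n) => // ni.
by rewrite !nth_default// (leq_trans ln)// ltnW.
Qed.

Lemma dnth_dvec n V i : size V <= n ->
  dnth (didx n) (dvec V) (dint i) = Int V`_i.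
Proof.
move=> Vn; rewrite dnth_encode ?size_map//.
case: (ltnP i (size V)) => iV; first by rewrite (nth_map 0%R).
by rewrite !nth_default// size_map.
Qed.

Lemma dpow2_didx n k : k <= n -> dpow2 (didx n) (dint k) = Int (Posz (2 ^ k)).
Proof.
move=> kn; rewrite /dpow2 drep_didx (minn_idPl kn).
by elim: k {kn} => //= k ->; rewrite /darith /= expnS PoszM.
Qed.

(** * The program *)

Definition dcube n := dmul n (dmul n n).

(* The Minkowski instance for the numbers [V_(cb), ..., V_(cb+b-1)]: blocks of
   [b] coordinates bounded by 2 and one slack coordinate, repeated as long as they
   fit, and remaining coordinates that are bounded by [1/n]. *)
Definition dentry (idx n b D V c i j : data) : data :=
  let p := dadd b (dint 1) in
  dif (dlt i (dmul (ddiv n p) p))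
    (dif (dlt (dmod i p) b)
      (dif (deq i j) (dint 1) (dint 0))
      (dif (deq i j) (dmul (dpow2 idx b) (dmul (dcube n) D))
        (dif (deq (ddiv i p) (ddiv j p))
          (dmul (dpow2 idx b) (dnth idx V (dadd (dmul c b) (dmod j p))))
          (dint 0))))
    (dif (deq i j) n (dint 0)).

Definition drhs (n b D i : data) : data :=
  let p := dadd b (dint 1) in
  dif (dlt i (dmul (ddiv n p) p))
    (dif (dlt (dmod i p) b) (dint 2) (dmul (dmul (dcube n) D) (dcube n)))
    (dint 1).

Definition dinst (idx n b D V c : data) : data :=
  let row s i :=
    Pair (dmk idx (fun j => Pair (dmul s (dentry idx n b D V c i j)) (dint 1)) (dint 0))
      (Pair (drhs n b D i) (dint 1)) in
  dmk idx (row (dint 1)) (dmk idx (row (dsub (dint 0) (dint 1))) (dint 0)).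

Definition dpick (idx b o : data) : data :=
  dfold (fun e acc =>
    dif (dsum idx (fun i =>
           let x := dnth idx o (dadd (dmul e (dadd b (dint 1))) i) in
           dif (dlt i b) (dmul x x) (dint 0)))
      e acc) idx (dint 0).

(** The oracle call is repeated for every entry, which avoids storing answers. The clamp is inert
    once the coefficients are at most $2^{T+1} - 1 \le n$. *)
Definition dbase (orc : data -> data) (idx n b D V : data) : data :=
  dmk idx (fun i =>
    let o := orc (dinst idx n b D V (ddiv i b)) in
    dclamp n (dnth idx o (dadd (dmul (dpick idx b o) (dadd b (dint 1))) (dmod i b))))
  (dint 0).

Definition dthr (c x : data) : data :=
  dif (dlt c x) (dint 1) (dif (dlt x (dsub (dint 0) c)) (dsub (dint 0) (dint 1)) (dint 0)).

Definition dblock (idx B : data) (F : data -> data) (j : data) : data :=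
  dsum idx (fun r => dif (dlt r B) (F (dadd (dmul j B) r)) (dint 0)).

Definition dvalues (idx W B c V X : data) : data :=
  dmk idx (fun j => dclamp W (dblock idx B
    (fun i => dmul (dnth idx V i) (dthr c (dnth idx X i))) j)) (dint 0).

Definition dsquare x := dmul x x.

Definition dcombine (idx n B c X Y : data) : data :=
  let S i := dthr c (dnth idx X i) in
  let U y i := dsub (dmul y (S i)) (dmul (dthr (dint 0) y) (dnth idx X i)) in
  dmk idx (fun i =>
    let j := ddiv i B in
    let y := dnth idx Y j in
    dclamp n
      (dif y
        (dif (dblock idx B (fun i => dsquare (S i)) j)
          (dif (dand (dle y c) (dle (dsub (dint 0) c) y))
            (dmul y (S i))
            (dif (dblock idx B (fun i => dsquare (U y i)) j) (U y i) (S i)))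
          (dnth idx X i))
        (dint 0))) (dint 0).

Definition dnorm (idx W V : data) : data :=
  dmk idx (fun i => dclamp W (dnth idx V i)) (dint 0).

(* The recursion of the halving argument is run by a stack machine.  Items are
   (tag, (level, vector)): 0 asks to solve for the vector, 1 returns a solution,
   2 and 3 are the return addresses of the inner and of the outer call. *)
Definition ditem t l v := Pair t (Pair l v).

Definition dstep (orc : data -> data) (idx n b beta D T st : data) : data :=
  let W := dmul n D in
  let B t := dpow2 idx (dmul beta (dpow2 idx (dsub t (dint 1)))) in
  let c t := dsub (dmul (dint 2) (dpow2 idx (dsub T t))) (dint 1) in
  let m := hd st in
  let mt := hd m in let ml := hd (tl m) in let mv := tl (tl m) in
  let f := hd (tl st) in
  let ft := hd f in let fl := hd (tl f) in let fv := tl (tl f) in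
  dif (deq mt (dint 0))
    (dif (deq ml (dint 0))
      (Pair (ditem (dint 1) (dint 0) (dbase orc idx n b D mv)) (tl st))
      (Pair (ditem (dint 0) (dclamp n (dsub ml (dint 1))) (dnorm idx W mv))
        (Pair (ditem (dint 2) (dclamp n ml) (dnorm idx W mv)) (tl st))))
    (dif (deq ft (dint 2))
      (Pair (ditem (dint 0) (dclamp n (dsub fl (dint 1)))
              (dvalues idx W (B fl) (c fl) fv mv))
        (Pair (ditem (dint 3) (dclamp n fl) (dnorm idx W mv)) (tl (tl st))))
      (dif (deq ft (dint 3))
        (Pair (ditem (dint 1) (dclamp n fl) (dcombine idx n (B fl) (c fl) fv mv))
          (tl (tl st)))
        st)).

Definition drun (orc : data -> data) (idx n b beta D T V : data) : data :=
  tl (tl (hd (dfold (fun _ st => dstep orc idx n b beta D T st) idx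
    (Pair (ditem (dint 0) T V) (dint 0))))).

Definition dunit (idx : data) := dmk idx (fun i => dif i (dint 0) (dint 1)) (dint 0).

Definition dlog (idx n : data) : data :=
  dsum idx (fun e => dif (dle (dpow2 idx (dadd e (dint 1))) n) (dint 1) (dint 0)).

(* Ensures that all Minkowski instances of the run are in the domain of the oracle. *)
Definition dguard (idx n beta T : data) : data :=
  let b := dpow2 idx beta in
  dand (dle (dint 1) T) (dand (dle (dint 2) b) (dle (dmul b b) n)).

(* The clamp makes the result an array of integers even when nothing is known
   about the run. *)
Definition dcandidate (orc : data -> data) (idx n D V T : data) : data :=
  let beta := ddiv (dlog idx n) (dpow2 idx T) in
  let b := dpow2 idx beta in
  dif (dguard idx n beta T)
    (dmk idx (fun i => dif (dlt i (dpow2 idx (dmul beta (dpow2 idx T))))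
       (dclamp (dint 1) (dnth idx (drun orc idx n b beta D T V) i)) (dint 0)) (dint 0))
    (dunit idx).

Definition ddiff (idx e1 e2 : data) : data :=
  dmk idx (fun i => dsub (deq i e1) (deq i e2)) (dint 0).

Definition ddot (idx V X : data) : data :=
  dsum idx (fun i => dmul (dnth idx V i) (dnth idx X i)).

(** Absolute values are compared through squares, and an entry lies in $\{-1, 0, 1\}$ exactly when
    clamping to 1 fixes it. *)
Definition dbetter (idx V X Y : data) : data :=
  dand (dand (dsum idx (fun i => dsquare (dnth idx X i)))
    (dlt (dsum idx (fun i => dif (deq (dclamp (dint 1) (dnth idx X i)) (dnth idx X i))
      (dint 0) (dint 1))) (dint 1)))
  (dlt (dsquare (ddot idx V X)) (dsquare (ddot idx V Y))).

Definition dimprove (idx V X Y : data) : data := dif (dbetter idx V X Y) X Y.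

Definition dsearch (orc : data -> data) (idx n D V : data) : data :=
  dfold (fun T Y => dimprove idx V (dcandidate orc idx n D V T) Y) idx
    (dfold (fun e1 Y => dfold (fun e2 Y => dimprove idx V (ddiff idx e1 e2) Y) idx Y) idx
      (dunit idx)).

Definition dlength (d : data) : data := dfold (fun _ acc => dadd acc (dint 1)) d (dint 0).

(** Each round puts the successor of the current head in front. The clamp to the length never acts
    on an encoded list; it is there to bound the increment of the fold. *)
Definition dindex (d : data) : data :=
  dfold (fun _ acc => Pair (dclamp (dlength d)
    (dif (of_bool (is_pair acc)) (dadd (hd acc) (dint 1)) (dint 0))) acc) d (dint 0).

Definition ddenom (d : data) : data := dfold (fun e acc => dmul acc (tl e)) d (dint 1).

Definition dscaled (d : data) : data :=
  dmk (dindex d) (fun i =>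
    let a := dnth (dindex d) d i in dmul (hd a) (ddiv (ddenom d) (tl a))) (dint 0).

Definition dmain (orc : data -> data) (d : data) : data :=
  dsearch orc (dindex d) (dlength d) (ddenom d) (dscaled d).

(** * Polynomial running time of the program *)

Definition base_env (q : data) : Prop :=
  exists n b D V, [/\ q = Pair (didx n) (Pair (dint n) (Pair (dint b) (Pair (dint D) V))),
    2 <= b, b * b <= n & 0 < D].

(** [V] and [c] are arbitrary data: ill-typed entries count as 0, so every call is legal whatever
    the stack contains, and the running time can be bounded without knowing what the run
    computes. *)
Definition oracle_ok (Dorc : data -> Prop) := forall n b D V c,
  2 <= b -> b * b <= n -> 0 < D ->
  Dorc (dinst (didx n) (dint n) (dint b) (dint D) V c).

Lemma FP_dinst :
  FP (fun=> True) (fun q => dinst (hd q) (hd (tl q)) (hd (tl (tl q)))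
    (hd (tl (tl (tl q)))) (hd (tl (tl (tl (tl q))))) (tl (tl (tl (tl (tl q)))))).
Proof. rewrite /dinst /dentry /drhs /dcube; cbv beta zeta; fp. Qed.

Lemma FP_dpick : FP (fun=> True) (fun q => dpick (hd q) (hd (tl q)) (tl (tl q))).
Proof.
rewrite /dpick.
apply: (@FP_fold_FP (fun=> True) (fun q e acc => dif (dsum (hd q) (fun i =>
           let x := dnth (hd q) (tl (tl q)) (dadd (dmul e (dadd (hd (tl q)) (dint 1))) i) in
           dif (dlt i (hd (tl q))) (dmul x x) (dint 0))) e acc) (fun q e _ => e)); try by fp.
by move=> d e a _; rewrite /dif; case: ifP => _; lia.
Qed.

Lemma FP_dbase orc Dorc : FP Dorc orc -> oracle_ok Dorc ->
  FP base_env (fun q => dbase orc (hd q) (hd (tl q)) (hd (tl (tl q)))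
    (hd (tl (tl (tl q)))) (tl (tl (tl (tl q))))).
Proof.
move=> Forc Hok.
pose o q := orc (dinst (hd (hd q)) (hd (tl (hd q))) (hd (tl (tl (hd q))))
  (hd (tl (tl (tl (hd q))))) (tl (tl (tl (tl (hd q)))))
  (ddiv (tl q) (hd (tl (tl (hd q)))))).
have Fo : FP (fun q => base_env (hd q)) o.
  apply: (FP_lift Forc (g := fun q => dinst (hd (hd q)) (hd (tl (hd q)))
   (hd (tl (tl (hd q)))) (hd (tl (tl (tl (hd q)))))
   (tl (tl (tl (tl (hd q))))) (ddiv (tl q) (hd (tl (tl (hd q))))))).
    apply: (FP_lift FP_dinst (g := fun q => Pair (hd (hd q)) (Pair (hd (tl (hd q)))
     (Pair (hd (tl (tl (hd q)))) (Pair (hd (tl (tl (tl (hd q)))))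
     (Pair (tl (tl (tl (tl (hd q))))) (ddiv (tl q) (hd (tl (tl (hd q)))))))))) ) => //.
    by fp.
  by move=> q [n [b [D [V [-> b2 bn D0]]]]] /=; apply: Hok.
have Fp : FP (fun q => base_env (hd q))
    (fun q => dpick (hd (hd q)) (hd (tl (tl (hd q)))) (o q)).
  apply: (FP_lift FP_dpick (g := fun q => Pair (hd (hd q)) (Pair (hd (tl (tl (hd q)))) (o q)))) => //.
  by fp.
by rewrite /dbase; cbv beta zeta; fp.
Qed.

Lemma data_size_dif c a b P : data_size a <= P -> data_size b <= P ->
  data_size (dif c a b) <= P.
Proof. by rewrite /dif; case: ifP. Qed.

Lemma data_size_ditem t l v r X M R : data_size t <= 2 -> data_size l <= X ->
  data_size v <= M -> data_size r <= R ->
  data_size (Pair (ditem t l v) r) <= X + M + R + 5.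
Proof. by rewrite /=; lia. Qed.

(** All vectors and levels that get pushed are clamped, so a step adds an amount that depends on the
    inputs only and not on the stack, as the rule for folds demands. *)
Lemma data_size_dstep orc idx n b beta D T st X :
  data_size idx <= X -> data_size n <= X -> data_size D <= X ->
  data_size (dstep orc idx n b beta D T st) <= data_size st + (8 * X * X + 8 * X + 20).
Proof.
move=> iX nX DX.
have WX : data_size (dmul n D) <= X + X.
  by apply: leq_trans (data_size_darith _ _ _) _; apply: leq_add.
pose M := 1 + X * (X + X).+1.
have mk W F : data_size W <= X + X ->
    data_size (dmk idx (fun i => dclamp W (F i)) (dint 0)) <= M.
  move=> WX'; apply: leq_trans (data_size_dmk _ _ (P := X + X) _) _.
    by move=> e; apply: leq_trans (data_size_dclamp _ _) WX'.
  by rewrite leq_add// leq_mul.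
have cl a : data_size (dclamp n a) <= X by apply: leq_trans (data_size_dclamp _ _) nX.
have nXX : data_size n <= X + X by apply: leq_trans nX (leq_addr _ _).
have X1 : 0 < X by apply: leq_trans (data_size_gt0 n) nX.
set R := data_size st.
have tl1 : data_size (tl st) <= R by apply: data_size_tl.
have tl2 : data_size (tl (tl st)) <= R by apply: leq_trans (data_size_tl _) tl1.
have one r : data_size r <= R + (X + M + 5) ->
    data_size r <= R + (8 * X * X + 8 * X + 20).
  by move=> /leq_trans; apply; rewrite /M; nia.
have two t l v t' l' v' r : data_size t <= 2 -> data_size l <= X ->
    data_size v <= M -> data_size t' <= 2 -> data_size l' <= X ->
    data_size v' <= M -> data_size r <= R ->
    data_size (Pair (ditem t l v) (Pair (ditem t' l' v') r)) <=
      R + (8 * X * X + 8 * X + 20).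
  move=> H1 H2 H3 H4 H5 H6 H7.
  apply: leq_trans (data_size_ditem H1 H2 H3 (data_size_ditem H4 H5 H6 H7)) _.
  by rewrite /M; nia.
have single t l v r : data_size t <= 2 -> data_size l <= X ->
    data_size v <= M -> data_size r <= R ->
    data_size (Pair (ditem t l v) r) <= R + (8 * X * X + 8 * X + 20).
  move=> H1 H2 H3 H4; apply: leq_trans (data_size_ditem H1 H2 H3 H4) _.
  by rewrite /M; nia.
rewrite /dstep; cbv zeta; do ![apply: data_size_dif].
- by apply: single => //; apply: mk.
- by apply: two => //; apply: mk.
- by apply: two => //; apply: mk.
- by apply: single => //; apply: mk.
- by rewrite leq_addr.
Qed.

Lemma FP_dstep orc Dorc : FP Dorc orc -> oracle_ok Dorc ->
  FP (fun q => base_env (hd q)) (fun q => dstep orc (hd (hd q)) (hd (tl (hd q)))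
    (hd (tl (tl (hd q)))) (hd (tl (tl (tl (tl (hd q))))))
    (hd (tl (tl (tl (hd q))))) (tl (tl (tl (tl (tl (hd q)))))) (tl q)).
Proof.
move=> Forc Hok.
have Fb : FP (fun q => base_env (hd q)) (fun q => dbase orc (hd (hd q)) (hd (tl (hd q)))
    (hd (tl (tl (hd q)))) (hd (tl (tl (tl (hd q))))) (tl (tl (hd (tl q))))).
  apply: (FP_lift (FP_dbase Forc Hok) (g := fun q => Pair (hd (hd q)) (Pair (hd (tl (hd q)))
    (Pair (hd (tl (tl (hd q)))) (Pair (hd (tl (tl (tl (hd q))))) (tl (tl (hd (tl q))))))))).
    by fp.
  move=> q [n [b [D [V [-> b2 bn D0]]]]] /=.
  by exists n, b, D, (tl (tl (hd (tl q)))).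
rewrite /dstep /dvalues /dcombine /dnorm /dthr /dblock /dsquare /ditem; cbv beta zeta.
by fp.
Qed.

Lemma FP_drun orc Dorc : FP Dorc orc -> oracle_ok Dorc ->
  FP (fun q => base_env (hd q)) (fun q => drun orc (hd (hd q)) (hd (tl (hd q)))
    (hd (tl (tl (hd q)))) (hd (tl (tl (tl (tl (hd q))))))
    (hd (tl (tl (tl (hd q))))) (tl (tl (tl (tl (tl (hd q)))))) (tl q)).
Proof.
move=> Forc Hok; rewrite /drun; do !apply: FP_tl; apply: FP_hd.
apply: (@FP_fold _ (fun q _ st => dstep orc (hd (hd q)) (hd (tl (hd q)))
    (hd (tl (tl (hd q)))) (hd (tl (tl (tl (tl (hd q))))))
    (hd (tl (tl (tl (hd q))))) (tl (tl (tl (tl (tl (hd q)))))) st)).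
- by fp.
- by rewrite /ditem; fp.
- apply: (FP_lift (FP_dstep Forc Hok) (g := fun q => Pair (hd (hd q)) (tl (tl q)))) => //.
  by fp.
have [K HK] : poly_bounded (fun X => 8 * X * X + 8 * X + 20) by pbnd.
exists K => d e a _; apply: leq_trans (@data_size_dstep _ _ _ _ _ _ _ _ (data_size (Pair d e)) _ _ _) _.
all: try by rewrite /= leqW// ltnW// ?ltnS.
all: have d1 := data_size_hd d; have d2 := data_size_hd (hd d); have d3 := data_size_tl (hd d);
  have d4 := data_size_hd (tl (hd d)); have d5 := data_size_tl (tl (hd d));
  have d6 := data_size_tl (tl (tl (hd d))); have d7 := data_size_hd (tl (tl (tl (hd d)))).
- by rewrite /=; lia.
- by rewrite /=; lia.
- by rewrite /=; lia.
- by rewrite leq_add2l HK.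
Qed.

Lemma dpow2_int n x : exists m, dpow2 (didx n) x = dint m.
Proof.
rewrite /dpow2 /drep; move: (didx n) => l.
suff: forall m, exists m', dfold (fun e acc => dif (dlt e x) (dmul (dint 2) acc) acc) l (dint m) = dint m'.
  by apply.
elim: l => [z|e _ l IH] m /=; first by exists m.
by rewrite {2}/dif; case: ifP => _; [exact: (IH (2 * m))|exact: IH].
Qed.

Lemma truthy_dand a b : truthy (dand a b) -> truthy a /\ truthy b.
Proof. by rewrite /dand /dif; case: ifP. Qed.

Lemma truthy_dle x y : truthy (dle (Int x) (Int y)) = (x <= y)%R.
Proof. by rewrite /darith /=; case: (x <= y)%R. Qed.

Lemma dguardP n beta T : truthy (dguard (didx n) (dint n) beta T) ->
  exists2 m, dpow2 (didx n) beta = dint m & 2 <= m /\ m * m <= n.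
Proof.
have [m Hm] := dpow2_int n beta; rewrite /dguard Hm => /truthy_dand[_ /truthy_dand[]].
have -> : dmul (dint m) (dint m) = dint (m * m) by rewrite /darith /= PoszM.
by rewrite !truthy_dle !lez_nat => m2 mn; exists m.
Qed.

Definition search_env (q : data) : Prop :=
  exists n D V, q = Pair (didx n) (Pair (dint n) (Pair (dint D) V)) /\ 0 < D.

Lemma FP_dcandidate orc Dorc : FP Dorc orc -> oracle_ok Dorc ->
  FP (fun q => search_env (hd q)) (fun q => dcandidate orc (hd (hd q)) (hd (tl (hd q)))
    (hd (tl (tl (hd q)))) (tl (tl (tl (hd q)))) (tl q)).
Proof.
move=> Forc Hok; rewrite /dcandidate; cbv beta zeta.
pose beta q := ddiv (dlog (hd (hd q)) (hd (tl (hd q)))) (dpow2 (hd (hd q)) (tl q)).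
have Fbeta D : FP D beta by rewrite /beta /dlog; fp.
apply: (@FP_if _ (fun q => dguard (hd (hd q)) (hd (tl (hd q))) (beta q) (tl q))).
- by rewrite /dguard; cbv beta zeta; fp; apply: Fbeta.
(* In this branch the guard supplies $2 \le b$ and $b^2 \le n$, without which the oracle could not
   be called. *)
- set D' := fun d => _ /\ _.
  have Frun : FP D' (fun q => drun orc (hd (hd q)) (hd (tl (hd q)))
      (dpow2 (hd (hd q)) (beta q)) (beta q) (hd (tl (tl (hd q)))) (tl q) (tl (tl (tl (hd q))))).
    apply: (FP_lift (FP_drun Forc Hok) (g := fun q => Pair
      (Pair (hd (hd q)) (Pair (hd (tl (hd q))) (Pair (dpow2 (hd (hd q)) (beta q))
      (Pair (hd (tl (tl (hd q)))) (Pair (beta q) (tl q)))))) (tl (tl (tl (hd q)))))).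
      by fp; apply: Fbeta.
    move=> q []; case=> n [D [V [qE D0]]]; rewrite qE /= => /dguardP[m Hm [m2 mn]].
    by exists n, m, D, (Pair (beta q) (tl q)); rewrite -Hm.
  fp_step; [by fp| |by fp].
  unfold FP2; cbv beta.
  have FB : FP (fun q => D' (hd q)) (fun q => dlog (hd (hd (hd q))) (hd (tl (hd (hd q))))).
    by rewrite /dlog; fp.
  have FR : FP (fun q => D' (hd q)) (fun q => drun orc (hd (hd (hd q))) (hd (tl (hd (hd q))))
      (dpow2 (hd (hd (hd q))) (beta (hd q))) (beta (hd q)) (hd (tl (tl (hd (hd q))))) (tl (hd q)) (tl (tl (tl (hd (hd q)))))).
    by apply: (FP_lift Frun (g := hd)) => //; fp.
  by fp; first [exact: FB | exact: FR].
- by rewrite /dunit; fp.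
Qed.

Lemma data_size_ddiff idx e1 e2 : data_size (ddiff idx e1 e2) <= 1 + data_size idx * 3.
Proof.
apply: data_size_dmk => e; apply: leq_trans (data_size_darith _ _ _) _.
have H a b : data_size (deq a b) <= 1.
  rewrite /deq; apply: data_size_dif => //.
  by rewrite /darith /= bit_length_bool.
by rewrite -[2]/(1 + 1) leq_add.
Qed.

Lemma data_size_dimprove idx V X Y P : data_size X <= P -> data_size Y <= P ->
  data_size (dimprove idx V X Y) <= P.
Proof. exact: data_size_dif. Qed.

Lemma FP_dimprove :
  FP (fun=> True) (fun q => dimprove (hd q) (hd (tl q)) (hd (tl (tl q))) (tl (tl (tl q)))).
Proof. by rewrite /dimprove /dbetter /ddot /dsquare; fp. Qed.

Lemma FP_dsearch orc Dorc : FP Dorc orc -> oracle_ok Dorc ->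
  FP search_env (fun q => dsearch orc (hd q) (hd (tl q)) (hd (tl (tl q))) (tl (tl (tl q)))).
Proof.
move=> Forc Hok; rewrite /dsearch.
apply: (@FP_fold_FP search_env (fun q T Y => dimprove (hd q) (tl (tl (tl q)))
    (dcandidate orc (hd q) (hd (tl q)) (hd (tl (tl q))) (tl (tl (tl q))) T) Y)
  (fun q T _ => dcandidate orc (hd q) (hd (tl q)) (hd (tl (tl q))) (tl (tl (tl q))) T)).
- by fp.
- apply: (@FP_fold _ (fun q e1 Y => dfold (fun e2 Y =>
    dimprove (hd q) (tl (tl (tl q))) (ddiff (hd q) e1 e2) Y) (hd q) Y)).
  + by fp.
  + by rewrite /dunit; fp.
  + apply: (@FP_fold _ (fun q e2 Y =>
      dimprove (hd (hd q)) (tl (tl (tl (hd q)))) (ddiff (hd (hd q)) (hd (tl q)) e2) Y)).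
    * by fp.
    * by fp.
    * apply: (FP_lift FP_dimprove (g := fun q => Pair (hd (hd (hd q)))
        (Pair (tl (tl (tl (hd (hd q))))) (Pair (ddiff (hd (hd (hd q))) (hd (tl (hd q)))
        (hd (tl q))) (tl (tl q)))))) => //.
      by rewrite /ddiff; fp.
    * exists 4 => q e a _; apply: data_size_dimprove; last by rewrite leq_addr.
      apply: leq_trans (data_size_ddiff _ _ _) _.
      apply: leq_trans _ (leq_addl _ _).
      have := data_size_hd (hd q); have := data_size_hd q; rewrite /=.
      move: (data_size (hd (hd q))) (data_size (hd q)) (data_size q) => x y z.
      have := leq_pexp2l (isT : 0 < (z + data_size e).+1) (isT : 1 <= 4); lia.
  + exists 10 => q e a _.
    have H e2 a' : data_size e2 <= data_size (hd q) ->
        data_size (dimprove (hd q) (tl (tl (tl q))) (ddiff (hd q) e e2) a') <=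
        data_size a' + (1 + data_size (hd q) * 3).
      move=> _; apply: data_size_dimprove; last by rewrite leq_addr.
      by apply: leq_trans (data_size_ddiff _ _ _) (leq_addl _ _).
    apply: leq_trans (dfold_size _ H) _; rewrite leq_add2l /=.
    have := data_size_hd q.
    move: (data_size (hd q)) (data_size q) => x y xy.
    apply: leq_trans (leq_mul (leqnn 10) (leq_pexp2l (isT : 0 < (y + data_size e).+1) (isT : 2 <= 10))).
    move: (data_size e) => z; rewrite expnS expn1; nia.
- apply: (FP_lift FP_dimprove (g := fun q => Pair (hd (hd q)) (Pair (tl (tl (tl (hd q))))
    (Pair (dcandidate orc (hd (hd q)) (hd (tl (hd q))) (hd (tl (tl (hd q)))) (tl (tl (tl (hd q)))) (hd (tl q)))
    (tl (tl q)))))) => //.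
  apply: FP_pair; first by fp.
  apply: FP_pair; first by fp.
  apply: FP_pair; last by fp.
  by apply: (FP_lift (FP_dcandidate Forc Hok) (g := fun q => Pair (hd q) (hd (tl q)))) => //; fp.
- exact: (FP_dcandidate Forc Hok).
- move=> q e a _; apply: data_size_dimprove; first by lia.
  by rewrite leq_addr.
Qed.

Lemma FP_dlength D : FP D dlength.
Proof.
apply: (@FP_fold_FP D (fun _ _ acc => dadd acc (dint 1)) (fun _ _ _ => dint 1) id (fun=> dint 0)); try by fp.
by move=> d e a _; apply: leq_trans (data_size_darith _ _ _) _; rewrite addnS leqnSn.
Qed.

Lemma FP_dindex D : FP D dindex.
Proof.
have F D' : FP D' (fun q => dlength (hd q)) by apply: (FP_lift (FP_dlength (fun=> True))) => //; fp.
apply: (@FP_fold_FP D (fun d _ acc => Pair (dclamp (dlength d)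
    (dif (of_bool (is_pair acc)) (dadd (hd acc) (dint 1)) (dint 0))) acc)
  (fun d _ _ => dlength d) id (fun=> dint 0)); try by fp.
move=> d e a _; rewrite -[data_size (Pair _ _)]/(_ + _).+1 addnS ltnS addnC leq_add2l.
exact: data_size_dclamp.
Qed.

Lemma FP_ddenom D : FP D ddenom.
Proof.
apply: (@FP_fold_FP D (fun _ e acc => dmul acc (tl e)) (fun _ e _ => tl e) id (fun=> dint 1)); try by fp.
by move=> d e a _; apply: leq_trans (data_size_darith _ _ _) _; rewrite addnS leqnSn.
Qed.

Definition main_env (d : data) : Prop :=
  exists n D, [/\ dindex d = didx n, dlength d = dint n, ddenom d = dint D & 0 < D].

Lemma FP_dmain orc Dorc : FP Dorc orc -> oracle_ok Dorc -> FP main_env (dmain orc).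
Proof.
move=> Forc Hok.
apply: (FP_lift (FP_dsearch Forc Hok) (g := fun d => Pair (dindex d) (Pair (dlength d)
   (Pair (ddenom d) (dscaled d))))).
  have Fi D : FP D (fun d => dindex d) by apply: FP_dindex.
  have Fl D : FP D (fun d => dlength d) by apply: FP_dlength.
  have Fd D : FP D (fun d => ddenom d) by apply: FP_ddenom.
  rewrite /dscaled; cbv beta zeta.
  have Fi' D : FP D (fun q => dindex (hd q)) by apply: (FP_lift (Fi (fun=> True))) => //; fp.
  have Fd' D : FP D (fun q => ddenom (hd q)) by apply: (FP_lift (Fd (fun=> True))) => //; fp.
  by fp; first [exact: Fi|exact: Fl|exact: Fd|exact: Fi'|exact: Fd'].
by move=> d [n [D [-> -> -> D0]]]; exists n, D, (dscaled d).
Qed.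

Arguments darith : simpl never.
Lemma darithE op x y : darith op (Int x) (Int y) = eval_arith op x y. Proof. by []. Qed.
Lemma dadd_int a b : dadd (dint a) (dint b) = dint (a + b). Proof. by []. Qed.
Lemma dmul_int a b : dmul (dint a) (dint b) = dint (a * b).
Proof. by rewrite darithE /= -PoszM. Qed.
Lemma ddiv_int a b : ddiv (dint a) (dint b) = dint (a %/ b).
Proof. by rewrite darithE /= divz_nat. Qed.
Lemma dle_int x y : dle (Int x) (Int y) = dint (x <= y)%R. Proof. by []. Qed.
Lemma dif_bool (b : bool) u v : dif (dint b) u v = if b then u else v.
Proof. by case: b. Qed.
Lemma dlt_int x y : dlt (Int x) (Int y) = dint (x < y)%R.
Proof. by rewrite /dlt dle_int dif_bool ltNge; case: (y <= x)%R. Qed.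
Lemma deq_int x y : deq (Int x) (Int y) = dint (x == y).
Proof.
by rewrite /deq !dle_int dif_bool eq_le; case: (x <= y)%R => //=; rewrite dle_int.
Qed.
Lemma dand_bool (a b : bool) : dand (dint a) (dint b) = dint (a && b).
Proof. by case: a. Qed.
Lemma dmod_int a b : dmod (dint a) (dint b) = dint (a %% b).
Proof.
rewrite /dmod ddiv_int dmul_int darithE /=; congr Int.
by rewrite {1}(divn_eq a b) PoszD addrC addKr.
Qed.

Definition dint_simpl := (dadd_int, dmul_int, ddiv_int, dlt_int, deq_int, dmod_int, dif_bool,
  ltz_nat, eqz_nat, dpow2_didx).

Local Open Scope ring_scope.

Local Open Scope classical_set_scope.

(** * The Minkowski instance *)

(** The offset [t] serves the induction on the dimension: slices of such a body are of the same form
    with shifted centres. *)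
Definition triangular_body (R : realType) (n : nat) (B : nat -> nat -> R) (r t : nat -> R) :
    set 'rV[R]_n :=
  [set x | forall i : 'I_n, `|\sum_(j < n) B i j * x 0 j + t i| <= r i].

Lemma vol_set0 (R : realType) n : vol (set0 : set 'rV[R]_n) = 0%E.
Proof.
elim: n => [|n IH] /=; first by rewrite indicE in_set0.
under eq_integral => x _.
  rewrite (_ : [set v | _] = set0); last by apply/seteqP; split.
  rewrite IH; over.
by rewrite integral0.
Qed.

(** Fixing the first coordinate in its interval [I] leaves a body of one dimension less, of which
    only the offset depends on that coordinate. The volume of slices is thus constant on [I] and 0
    elsewhere. *)
Lemma vol_triangular_body (R : realType) n (B : nat -> nat -> R) (r t : nat -> R) :
  (forall i, 0 < B i i) -> (forall i j, (i < j)%N -> B i j = 0) -> (forall i, 0 <= r i) ->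
  vol (triangular_body (n := n) B r t) = (\prod_(i < n) (2 * r i / B i i))%:E.
Proof.
elim: n B r t => [|n IH] B r t B0 Bt r0 /=.
  rewrite big_ord0 indicE mem_set//; by move=> [].
rewrite big_ord_recl.
set c := \prod_(i < n) _.
pose I : set R := `[(- r 0%N - t 0%N) / B 0%N 0%N, (r 0%N - t 0%N) / B 0%N 0%N].
have sliceE (x : R) :
    [set v : 'rV[R]_n | triangular_body B r t (row_mx (x%:M : 'rV_1) v)] =
    if x \in I then triangular_body (fun i j => B i.+1 j.+1) (fun i => r i.+1)
      (fun i => t i.+1 + B i.+1 0%N * x) else set0.
  have sumE (v : 'rV[R]_n) (i : nat) :
      \sum_(j < n.+1) B i j * (row_mx (x%:M : 'rV_1) v) 0 j =
      B i 0%N * x + \sum_(j < n) B i j.+1 * v 0 j.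
    rewrite big_ord_recl; congr (_ * _ + _).
      have -> : ord0 = lshift n (0 : 'I_1) by apply/val_inj.
      by rewrite row_mxEl mxE eqxx.
    apply: eq_bigr => j _; congr (_ * _).
    have -> : lift ord0 j = rshift 1 j by apply/val_inj.
    by rewrite row_mxEr.
  have row0 v : (`|\sum_(j < n.+1) B 0%N j * (row_mx (x%:M : 'rV_1) v) 0 j + t 0%N| <= r 0%N)
      = (x \in I).
    rewrite sumE big1 ?addr0; last by move=> j _; rewrite Bt// mul0r.
    have -> : (x \in I) = ((- r 0%N - t 0%N) / B 0%N 0%N <= x <= (r 0%N - t 0%N) / B 0%N 0%N).
      by apply/idP/idP; rewrite in_setE /I /= in_itv.
    rewrite ler_norml ler_pdivrMr// ler_pdivlMr//.
    by rewrite lerBlDr lerBrDr (mulrC x).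
  apply/seteqP; split=> v /=.
    move=> H; have := H ord0; rewrite row0 => xI; rewrite xI => i.
    have := H (lift ord0 i); rewrite sumE lift0; set S := \sum_(_ < _) _.
    by rewrite (_ : S + _ = B i.+1 0%N * x + S + t i.+1)//; ring.
  case: ifP => // xI H i; case: (unliftP ord0 i) => [j ->|->]; last by rewrite row0.
  have := H j; rewrite sumE lift0; set S := \sum_(_ < _) _.
  by rewrite (_ : S + _ = B j.+1 0%N * x + S + t j.+1)//; ring.
under eq_integral => x _.
  rewrite sliceE (_ : vol _ = (c%:E * (\1_I x)%:E)%E); last first.
    rewrite indicE; case: (x \in I); last by rewrite vol_set0 mule0.
    by rewrite mule1 IH// => i j ij; apply: Bt.
  over.
have c0 : 0 <= c.
  by apply: prodr_ge0 => i _; rewrite mulr_ge0 ?mulr_ge0 ?invr_ge0 ?(ltW (B0 _)) ?r0.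
have mI : measurable I by exact: measurable_itv.
rewrite ge0_integralZl//=.
- rewrite integral_indic// setIT; transitivity (c%:E * lebesgue_measure I)%E => //.
  rewrite /I lebesgue_measure_itv /= lte_fin.
  have d : (r 0%N - t 0%N) / B 0%N 0%N - (- r 0%N - t 0%N) / B 0%N 0%N = 2 * r 0%N / B 0%N 0%N.
    by field; rewrite gt_eqF.
  case: ltP => [lt|le].
    by rewrite -EFinB d -EFinM mulrC.
  rewrite mule0; congr EFin; rewrite -d.
  have -> : (r 0%N - t 0%N) / B 0%N 0%N - (- r 0%N - t 0%N) / B 0%N 0%N = 0; last by rewrite mul0r.
  apply/eqP; rewrite eq_le subr_le0 le d.
  by rewrite mulr_ge0 ?mulr_ge0 ?invr_ge0 ?(ltW (B0 _)) ?r0.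
- by apply/measurable_EFinP; exact: measurable_indic.
Qed.

Local Close Scope classical_set_scope.

(** With numbers at most $nD$ and coefficients at most $2P$, the sum $\langle v, x\rangle$ is at
    most $2bPnD$, which is less than half of $n^3D$ as soon as $4bP < n^2$. *)
Definition slack_weight (n D : nat) : nat := (n * (n * n) * D)%N.

Definition entry (n b D : nat) (v : nat -> int) (i j : nat) : int :=
  let p := b.+1 in
  if (i < n %/ p * p)%N then
    if (i %% p < b)%N then (i == j)%:Z
    else if i == j then (2 ^ b * slack_weight n D)%N%:Z
    else if (i %/ p == j %/ p)%N then (2 ^ b)%N%:Z * v (j %% p)%N else 0
  else if i == j then n%:Z else 0.

Definition bound (n b D : nat) (i : nat) : int :=
  let p := b.+1 in
  if (i < n %/ p * p)%N then
    if (i %% p < b)%N then 2 else (slack_weight n D * (n * (n * n)))%N%:Z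
  else 1.

Definition instance (n b D : nat) (v : nat -> int) : minkowski_instance :=
  @MinkowskiInstance n (n + n)
    (\matrix_(i, j) ((if (i < n)%N then entry n b D v i j else - entry n b D v (i - n) j)%:~R))
    (\col_i ((bound n b D (if (i < n)%N then i : nat else i - n)%N)%:~R)).

Lemma encode_rat_int (z : int) : encode_rat z%:~R = Pair (Int z) (dint 1).
Proof. by rewrite /encode_rat numq_int denq_int. Qed.

Lemma dentryE n b D V c i j (v := fun r : nat => to_int (dnth (didx n) V (dadd (dmul c (dint b)) (dint r)))) :
  (b <= n)%N ->
  dentry (didx n) (dint n) (dint b) (dint D) V c (dint i) (dint j) = Int (entry n b D v i j).
Proof.
move=> bn; rewrite /dentry /entry /dcube /slack_weight.
have E : dpow2 (didx n) (dint b) = dint (2 ^ b) by rewrite dpow2_didx.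
rewrite E !dint_simpl !addn1; case: ifP => _; last by case: ifP.
case: ifP => _; first by case: eqP.
case: ifP => _ //; case: ifP => _ //.
Qed.

Lemma drhsE n b D i : drhs (dint n) (dint b) (dint D) (dint i) = Int (bound n b D i).
Proof.
rewrite /drhs /bound /dcube /slack_weight !dint_simpl !addn1.
by case: ifP => _ //; case: ifP.
Qed.

Lemma map_enum_ord T n (F : nat -> T) : [seq F (val i) | i <- enum 'I_n] = [seq F i | i <- iota 0 n].
Proof. by rewrite -val_enum_ord -map_comp. Qed.

Lemma dinstE n b D V c (v := fun r : nat => to_int (dnth (didx n) V (dadd (dmul c (dint b)) (dint r)))) :
  (b <= n)%N ->
  dinst (didx n) (dint n) (dint b) (dint D) V c = encode_minkowski_instance (instance n b D v).
Proof.
move=> bn; rewrite /dinst.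
pose row s i := Pair (dmk (didx n) (fun j => Pair (dmul s
  (dentry (didx n) (dint n) (dint b) (dint D) V c i j)) (dint 1)) (dint 0))
  (Pair (drhs (dint n) (dint b) (dint D) i) (dint 1)).
transitivity (dmk (didx n) (row (dint 1))
  (dmk (didx n) (row (dsub (dint 0) (dint 1))) (dint 0))); first by [].
rewrite (dmk_encode n (row _) [::]) cats0 dmk_encode /encode_minkowski_instance.
have rowE s i : row (Int s) (dint i) = Pair (encode_seq
    [seq Pair (Int (s * entry n b D v i j)) (dint 1) | j <- iota 0 n])
    (Pair (Int (bound n b D i)) (dint 1)).
  rewrite /row drhsE (dmk_encode n _ [::]) cats0; congr (Pair (encode_seq _) _).
  by apply/eq_map => j; rewrite dentryE.
congr encode_seq.
pose F i := Pair (encode_seq [seq Pair (Int (if (i < n)%N then entry n b D v i j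
  else - entry n b D v (i - n) j)) (dint 1) | j <- iota 0 n])
  (Pair (Int (bound n b D (if (i < n)%N then i else i - n)%N)) (dint 1)).
transitivity [seq F i | i <- iota 0 (n + n)].
  rewrite iotaD map_cat add0n; congr (_ ++ _).
    apply/eq_in_map => i; rewrite mem_iota /= => i_n; rewrite rowE /F i_n.
    by congr (Pair (encode_seq _) _); apply/eq_map => j; rewrite mul1r.
  have -> : iota n n = [seq (n + i)%N | i <- iota 0 n] by rewrite -iotaDl addn0.
  rewrite -map_comp; apply/eq_map => i /=.
  rewrite darithE rowE /F ltnNge leq_addr /= addKn.
  by congr (Pair (encode_seq _) _); apply/eq_map => j; rewrite mulN1r.
rewrite -map_enum_ord; apply/eq_map => i; rewrite /F /=; congr Pair.
  rewrite /encode_row -map_enum_ord; congr encode_seq; apply/eq_map => j.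
  by rewrite !mxE encode_rat_int.
by rewrite mxE encode_rat_int.
Qed.

Lemma entry_diag_gt0 n b D v i : (0 < n)%N -> (0 < D)%N -> 0 < entry n b D v i i.
Proof.
move=> n0 D0; rewrite /entry /slack_weight eqxx.
by do ![case: ifP => _] => //; rewrite ltz_nat ?muln_gt0 ?expn_gt0 ?n0 ?D0.
Qed.

(** The slack coordinate comes last in its block, so its row only reaches backwards. *)
Lemma entry_triangular n b D v i j : (i < j)%N -> entry n b D v i j = 0.
Proof.
move=> ij; rewrite /entry (ltn_eqF ij); case: ifP => // _; case: ltnP => // bi.
case: eqP => // e; exfalso.
have := ltn_pmod i (ltn0Sn b); have := ltn_pmod j (ltn0Sn b).
have := divn_eq i b.+1; have := divn_eq j b.+1; rewrite -e.
lia.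
Qed.

Lemma bound_ge0 n b D i : 0 <= bound n b D i.
Proof. by rewrite /bound; do ![case: ifP => _]. Qed.

Lemma polyhedron_instance (R : realType) n b D v (x : 'rV[R]_n) :
  polyhedron R (instance n b D v) x <->
  forall i : 'I_n, `|\sum_(j < n) (entry n b D v i j)%:~R * x 0 j| <= (bound n b D i)%:~R.
Proof.
split=> [H i|H i].
- have := H (lshift n i); have := H (rshift n i); rewrite /= !mxE /= ltn_ord ltnNge leq_addr /= addKn.
  rewrite !ratr_int ler_norml.
  under eq_bigr do rewrite !mxE /= ltnNge leq_addr /= addKn ratr_int mulrNz mulNr.
  rewrite sumrN lerNl => ->.
  by under eq_bigr do rewrite !mxE /= ltn_ord ratr_int; move=> ->.
- rewrite /= mxE; case: (ltnP i n) => i_n.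
    have := H (Ordinal i_n); rewrite ler_norml => /andP[_] /=.
    rewrite ratr_int; under [in X in _ -> X]eq_bigr do rewrite !mxE i_n ratr_int.
    by [].
  have i_n' : (i - n < n)%N by rewrite ltn_subLR.
  have := H (Ordinal i_n'); rewrite ler_norml => /andP[+ _] /=.
  rewrite ratr_int; under [in X in _ -> X]eq_bigr do
    rewrite !mxE ltnNge i_n /= ratr_int mulrNz mulNr.
  by rewrite sumrN lerNl.
Qed.

(** Row [k] bounds coordinate [k] once all earlier coordinates are bounded. *)
Lemma triangular_bounded (R : realType) n (B : nat -> nat -> R) (r : nat -> R) :
  (forall i, 0 < B i i) -> (forall i j, (i < j)%N -> B i j = 0) ->
  coord_bounded (triangular_body (n := n) B r (fun=> 0)).
Proof.
move=> B0 Bt.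
suff H k : (k <= n)%N -> exists C : R, forall x, triangular_body (n := n) B r (fun=> 0) x ->
    forall j : 'I_n, (j < k)%N -> `|x 0 j| <= C.
  by have [C HC] := H n (leqnn n); exists C => x Kx i; apply: HC.
elim: k => [|k IH] kn; first by exists 0.
have [C HC] := IH (ltnW kn); pose o := Ordinal kn.
pose C' := (r k + \sum_(j < n) `|B k j| * `|C|) / B k k.
exists (Num.max C C') => x Kx j; rewrite ltnS leq_eqVlt => /orP[/eqP jk|jk]; last first.
  by rewrite le_max HC.
have -> : j = o by apply/val_inj.
rewrite le_max; apply/orP; right.
rewrite /C' ler_pdivlMr//.
have := Kx o; rewrite addr0 (bigD1 o) //= => Ko.
rewrite -[X in _ * X]gtr0_norm// -normrM mulrC.
set S := \sum_(i < n | i != o) _ in Ko.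
have SC : `|S| <= \sum_(j < n) `|B k j| * `|C|.
  apply: le_trans (ler_norm_sum _ _ _) _.
  rewrite [leRHS](bigD1 o)//= -[leLHS]add0r lerD ?mulr_ge0//.
  apply: ler_sum => i io; rewrite normrM.
  case: (ltngtP i k) => ik.
  - by rewrite ler_wpM2l// (le_trans (HC _ Kx i ik))// ler_norm.
  - by rewrite Bt// normr0 !mul0r.
  - by move: io; rewrite -val_eqE /= ik eqxx.
by rewrite (le_trans _ (lerD Ko SC))// -[X in `|X| <= _](addrK S) (le_trans (ler_normB _ _)).
Qed.

Lemma prod_periodic (R : realType) (f : nat -> R) p q :
  (forall i, f (p + i)%N = f i) ->
  \prod_(0 <= i < q * p) f i = (\prod_(0 <= i < p) f i) ^+ q.
Proof.
move=> fp; elim: q => [|q IH]; first by rewrite mul0n big_geq.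
rewrite exprS -IH mulSn (@big_cat_nat _ _ _ p) ?leq_addr//=; congr (_ * _).
rewrite -[X in index_iota X]add0n big_addn addKn; apply: eq_bigr => i _.
by rewrite addnC fp.
Qed.

(** Since $b^2 \le n$, there are at least $b - 1$ blocks, at most $b$ coordinates are left over, and
    $b < 3(b - 1)$. *)
Lemma leftover_lt n b : (2 <= b)%N -> (b * b <= n)%N -> (n %% b.+1 < 3 * (n %/ b.+1))%N.
Proof.
move=> b2 bn; have : (b.-1 <= n %/ b.+1)%N by rewrite leq_divRL//; nia.
by have := ltn_pmod n (ltn0Sn b); lia.
Qed.

(** In a block the cube coordinates contribute $2^b$ and the slack contributes $n^3/2^b$. Each block
    is thus worth $n^3$, which pays for fewer than three leftover coordinates per block at $1/n$
    each. *)
Lemma big_nat_ratio_gt1 (R : realType) n b D v : (2 <= b)%N -> (b * b <= n)%N -> (0 < D)%N ->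
  1 < \prod_(0 <= i < n) ((bound n b D i)%:~R / (entry n b D v i i)%:~R : R).
Proof.
move=> b2 bn D0.
have n1 : (1 < n)%N by nia.
have n0 : (0 < n)%N by nia.
pose m : R := n%:R.
have m1 : 1 < m by rewrite ltr1n.
have m0 : 0 < m by apply: lt_trans m1.
have qp : (n %/ b.+1 * b.+1 <= n)%N by rewrite leq_divM.
rewrite (@big_cat_nat _ _ _ (n %/ b.+1 * b.+1)) //=.
have -> : \prod_(n %/ b.+1 * b.+1 <= i < n)
    ((bound n b D i)%:~R / (entry n b D v i i)%:~R) = (m ^+ (n %% b.+1))^-1 :> R.
  rewrite (eq_big_nat _ _ (F2 := fun=> m^-1)); last first.
    by move=> i /andP[qi _]; rewrite /bound /entry eqxx ltnNge qi /= mul1r.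
  rewrite big_const_nat iter_mulr_1 exprVn; congr (_ ^- _).
  by rewrite {1}(divn_eq n b.+1) addKn.
have -> : \prod_(0 <= i < n %/ b.+1 * b.+1)
    ((bound n b D i)%:~R / (entry n b D v i i)%:~R) = m ^+ (3 * (n %/ b.+1)) :> R.
  pose f i : R := if (i %% b.+1 < b)%N then 2 else m ^+ 3 / 2 ^+ b.
  rewrite (eq_big_nat _ _ (F2 := f)); last first.
    move=> i /andP[_ qi]; rewrite /bound /entry /f eqxx qi.
    case: ifP => _; first by rewrite divr1.
    rewrite /m !PoszM !intrM -!pmulrn natrX -/m.
    have b0 : (2 : R) ^+ b != 0 by rewrite expf_neq0// pnatr_eq0.
    by field; rewrite b0 !pnatr_eq0 -!lt0n n0 D0.
  rewrite prod_periodic; last by move=> i; rewrite /f -{1}(mul1n b.+1) modnMDl.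
  rewrite big_nat_recr//= (eq_big_nat _ _ (F2 := fun=> 2)); last first.
    by move=> i /andP[_ ib]; rewrite /f modn_small ?ib// ltnW// ltnS.
  rewrite big_const_nat subn0 iter_mulr_1 /f modn_small// ltnn.
  by rewrite mulrC divfK ?expf_neq0 ?pnatr_eq0// -exprM.
rewrite ltr_pdivlMr ?exprn_gt0// mul1r ltr_eXn2l//.
exact: leftover_lt.
Qed.

Lemma instance_dom (R : realType) n b D v : (2 <= b)%N -> (b * b <= n)%N -> (0 < D)%N ->
  minkowski_dom R 2 (instance n b D v).
Proof.
move=> b2 bn D0.
have n0 : (0 < n)%N by nia.
pose B i j : R := (entry n b D v i j)%:~R.
pose r i : R := (bound n b D i)%:~R.
have B0 i : 0 < B i i by rewrite ltr0z entry_diag_gt0.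
have Bt i j : (i < j)%N -> B i j = 0 by move=> ij; rewrite /B entry_triangular.
have r0 i : 0 <= r i by rewrite ler0z bound_ge0.
have KE : polyhedron R (instance n b D v) = triangular_body (n := n) B r (fun=> 0).
  apply/seteqP; split=> x /=.
    by move=> /polyhedron_instance H i; rewrite addr0; apply: H.
  by move=> H; apply/polyhedron_instance => i; have := H i; rewrite addr0.
split => //=; rewrite ?KE.
- by rewrite mul2n addnn.
- exact: triangular_bounded.
- move=> x H i; rewrite addr0; have := H i; rewrite addr0.
  under [in X in _ -> X]eq_bigr do rewrite mxE mulrN.
  by rewrite sumrN normrN.
- rewrite (vol_triangular_body n (fun=> 0) B0 Bt r0) lte_fin.
  under eq_bigr do rewrite -mulrA.
  rewrite big_split /= prodr_const card_ord ltr_pMr ?exprn_gt0//.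
  have := @big_nat_ratio_gt1 R n b D v b2 bn D0.
  by rewrite big_mkord.
Qed.

Lemma size_le_data_size s : (size s <= data_size (encode_seq s))%N.
Proof. by elim: s => //= d s IH; have := data_size_gt0 d; lia. Qed.

Lemma data_size_dvec V :
  (data_size (dvec V) <= size V * (leaf_size (dvec V)).+1 + 1)%N.
Proof.
have H L : (leaf_size (dvec V) <= L)%N -> (data_size (dvec V) <= size V * L.+1 + 1)%N.
  rewrite /dvec; elim: V => //= z V IH; rewrite geq_max => /andP[zL /IH].
  by nia.
exact: H.
Qed.

Lemma oracle_exists (R : realType) (rho : nat -> R) :
  (forall n, 1 <= rho n) -> minkowski_approximation 2 rho ->
  exists orc Dorc, [/\ FP Dorc orc, oracle_ok Dorc
    & forall n b D v, (2 <= b)%N -> (b * b <= n)%N -> (0 < D)%N ->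
      exists x : 'rV[int]_n,
        [/\ orc (encode_minkowski_instance (instance n b D v)) =
              dvec [seq x 0 i | i <- enum 'I_n],
            x != 0
          & forall i : 'I_n, `|\sum_(j < n) entry n b D v i j * x 0 j|%:~R <=
              rho n * (bound n b D i)%:~R]].
Proof.
move=> rho1 [p [k Hp]].
pose Q d out := exists t, runs p d t out.
(* Runs are deterministic, so the output of the given program is a function of its input; [orc]
   extends it by a default value. *)
have Quniq d o1 o2 : Q d o1 -> Q d o2 -> o1 = o2.
  by move=> [t1 [s1 E1 <-]] [t2 [s2 E2 <-]]; have [_ ->] := exec_deterministic E1 E2.
pose orc d := if pselect (exists o, Q d o) is left H then projT1 (cid H) else Int 0.
have orcE d o : Q d o -> orc d = o.
  move=> Qo; rewrite /orc; case: pselect => [H|[]]; last by exists o.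
  by case: cid => o' /= /Quniq; apply.
(* The bound on the dimension limits the number of entries of an answer by the size of the input. *)
pose Dorc d := exists I, [/\ minkowski_dom R 2 I,
  (mk_dim I <= data_size (encode_minkowski_instance I))%N & encode_minkowski_instance I = d].
have rowE n (x : 'rV[int]_n) : encode_row Int x = dvec [seq x 0 i | i <- enum 'I_n].
  by rewrite /encode_row /dvec -map_comp.
exists orc, Dorc; split.
- apply: (@FP_oracle p k).
    move=> d [I [ID _ <-]]; have [t [out [ro tk _]]] := Hp I ID.
    by exists t => //; rewrite (orcE _ (encode_row Int out))//; exists t.
  move=> d [I [ID Idim <-]]; have [t [out [ro tk _]]] := Hp I ID.
  have -> : orc (encode_minkowski_instance I) = encode_row Int out by apply: orcE; exists t.
  rewrite rowE; set V := [seq _ | _ <- _]; have := data_size_dvec V.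
  rewrite /V size_map size_enum_ord -/V => /leq_trans; apply.
  by rewrite mulSn addnC leq_add// leq_mul.
- move=> n b D V c b2 bn D0; have b_n : (b <= n)%N by nia.
  rewrite dinstE//; set v := fun r => _; exists (instance n b D v); split => //.
    exact: instance_dom.
  apply: leq_trans _ (size_le_data_size _).
  by rewrite size_map size_enum_ord /= leq_addr.
- move=> n b D v b2 bn D0.
  have [t [out [ro tk [out0 [y Ky yo]]]]] := Hp _ (instance_dom R v b2 bn D0).
  exists out; split => //; first by rewrite -rowE; apply: orcE; exists t.
  move=> i; have /polyhedron_instance /(_ i) Kyi := Ky.
  have rho0 : 0 <= rho n by apply: le_trans (rho1 n).
  have oE j : (out 0 j)%:~R = rho n * y 0 j.
    by have := congr1 (fun M : 'rV[R]_n => M 0 j) yo; rewrite !mxE.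
  rewrite intr_norm raddf_sum /=; under eq_bigr do rewrite intrM oE mulrCA.
  by rewrite -mulr_sumr normrM (ger0_norm rho0) ler_wpM2l.
Qed.

(** * Halving the coefficients *)

Definition threshold (c x : int) : int :=
  if c < x then 1 else if x < - c then -1 else 0.

Definition clamp (W a : int) : int :=
  if - W <= a then (if a <= W then a else 0) else 0.

Definition block (n B : nat) (F : nat -> int) (j : nat) : int :=
  \sum_(r < n) (if (r < B)%N then F (j * B + r)%N else 0).

Definition values (n : nat) (W : int) (B : nat) (c : int) (V X : seq int) : seq int :=
  mkseq (fun j => clamp W (block n B (fun i => V`_i * threshold c X`_i) j)) n.

Definition residue (c y x : int) : int := y * threshold c x - threshold 0 y * x.

(** The sums of squares ask whether a vector vanishes on the whole block, so that all entries of a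
    block take the same branch. *)
Definition combine_entry (n B : nat) (c : int) (X Y : seq int) (i : nat) : int :=
  let j := (i %/ B)%N in
  let y := Y`_j in
  if y == 0 then 0
  else if block n B (fun i => threshold c X`_i ^+ 2) j == 0 then X`_i
  else if (- c <= y) && (y <= c) then y * threshold c X`_i
  else if block n B (fun i => residue c y X`_i ^+ 2) j == 0 then threshold c X`_i
  else residue c y X`_i.

Definition combine (n B : nat) (c : int) (X Y : seq int) : seq int :=
  mkseq (fun i => clamp n (combine_entry n B c X Y i)) n.

(* [solve t] turns a solver [base] with coefficients at most [2^(T+1)-1] into one
   with coefficients at most [2^(T+1-t)-1]; the lengths of the inputs get squared
   [t] times. *)
Definition len (beta t : nat) : nat := (2 ^ (beta * 2 ^ t))%N.
Definition norm_bound (T t : nat) : int := 2 * (2 ^ (T - t))%N%:Z - 1.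

Fixpoint solve (base : seq int -> seq int) (n : nat) (W : int) (beta T t : nat)
    (V : seq int) : seq int :=
  if t is t'.+1 then
    let X := solve base n W beta T t' V in
    let Y := solve base n W beta T t'
      (values n W (len beta t') (norm_bound T t) V X) in
    combine n (len beta t') (norm_bound T t) X Y
  else base V.

Lemma clamp_id W a : `|a| <= W -> clamp W a = a.
Proof. by rewrite ler_norml /clamp => /andP[-> ->]. Qed.

Lemma clamp_norm W a : 0 <= W -> `|clamp W a| <= W.
Proof.
by move=> W0; rewrite /clamp; do ![case: ifP => ? //]; rewrite ?normr0// ler_norml; apply/andP.
Qed.

Lemma blockE n B F j : (B <= n)%N -> block n B F j = \sum_(r < B) F (j * B + r)%N.
Proof.
move=> Bn; rewrite /block -big_mkcond /=.
by rewrite (big_ord_widen n (fun r => F (j * B + r)%N) Bn).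
Qed.

Lemma sum_sqr_eq0 B (F : nat -> int) :
  (\sum_(r < B) F r ^+ 2 == 0) = [forall r : 'I_B, F r == 0].
Proof.
rewrite psumr_eq0; last by move=> i _; rewrite sqr_ge0.
apply/allP/forallP => H r; last by move=> _; rewrite sqrf_eq0 H implybT.
by have := H r; rewrite mem_index_enum sqrf_eq0; apply.
Qed.

Lemma threshold_cases c x : 0 <= c ->
  [\/ c < x /\ threshold c x = 1, x < - c /\ threshold c x = -1
    | `|x| <= c /\ threshold c x = 0].
Proof.
move=> c0; rewrite /threshold; case: ltP => [cx|xc]; first by constructor 1.
by case: ltP => [xc'|cx]; [constructor 2|constructor 3; rewrite ler_norml cx xc].
Qed.

(* The coefficients of one block after the combination step: modulo the relation
   [x] of the block they are congruent to [y] times its thresholding. *)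
Lemma combine_block B (c y : int) (x v w : nat -> int) (s := fun r => threshold c (x r)) :
  1 <= c -> `|y| <= 2 * c + 1 -> (forall r, (r < B)%N -> `|x r| <= 2 * c + 1) ->
  (exists2 r, (r < B)%N & x r != 0) ->
  (forall r, (r < B)%N -> w r = if y == 0 then 0
    else if \sum_(r < B) s r ^+ 2 == 0 then x r
    else if (- c <= y) && (y <= c) then y * s r
    else if \sum_(r < B) residue c y (x r) ^+ 2 == 0 then s r
    else residue c y (x r)) ->
  [/\ y != 0 -> exists2 r, (r < B)%N & w r != 0,
      forall r, (r < B)%N -> `|w r| <= c
    & `|\sum_(r < B) v r * w r - y * \sum_(r < B) v r * s r| <=
      2 * `|\sum_(r < B) v r * x r|].
Proof.
move=> c1 yc xc [r0 r0B x0] wE.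
have c0 : 0 <= c by apply: le_trans c1.
have sumw (w' : nat -> int) : (forall r, (r < B)%N -> w r = w' r) ->
    \sum_(r < B) v r * w r = \sum_(r < B) v r * w' r.
  by move=> ww; apply: eq_bigr => r _; rewrite ww.
have E0 : 0 <= 2 * `|\sum_(r < B) v r * x r| by rewrite mulr_ge0.
case: (eqVneq y 0) wE => [->|y0] wE.
  split => // [r rB|]; first by rewrite wE// normr0.
  by rewrite (sumw (fun=> 0))// big1 ?mul0r ?subr0 ?normr0// => r _; rewrite mulr0.
have s1 r : `|s r| <= c.
  by rewrite /s; case: (threshold_cases (x r) c0) => -[_ ->]; rewrite ?normrN ?normr1 ?normr0.
(* No entry of [x] exceeds [c] here, so [x] itself serves; its own error replaces the value 0 of
   [s]. *)
case s0: (\sum_(r < B) s r ^+ 2 == 0) wE => wE.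
  have {}s0 r : (r < B)%N -> s r = 0.
    move=> rB; apply/eqP; move: s0; rewrite (sum_sqr_eq0 B s) => /forallP/(_ (Ordinal rB)).
    by [].
  split.
  - by move=> _; exists r0 => //; rewrite wE.
  - move=> r rB; rewrite wE//; have := s0 r rB; rewrite /s.
    by case: (threshold_cases (x r) c0) => -[] // _ ->.
  - rewrite (sumw x)// [X in _ - y * X]big1 ?mulr0 ?subr0.
      by rewrite mulr_natl mulr2n lerDl.
    by move=> r _; rewrite s0// mulr0.
have [r1 r1B sr1] : exists2 r, (r < B)%N & s r != 0.
  move/negbT: s0; rewrite (sum_sqr_eq0 B s) negb_forall => /existsP[r sr].
  by exists r.
case ync: ((- c <= y) && (y <= c)) wE => wE.
  have /andP[yc1 yc2] := ync.
  split.
  - by move=> _; exists r1 => //; rewrite wE// mulf_neq0.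
  - move=> r rB; rewrite wE// /s.
    have yc' : `|y| <= c by rewrite ler_norml yc1.
    by case: (threshold_cases (x r) c0) => -[_ ->]; rewrite ?mulr0 ?normr0 ?mulrN ?normrN ?mulr1.
  - rewrite (sumw (fun r => y * s r))// mulr_sumr -sumrB big1 ?normr0// => r _.
    by rewrite mulrCA subrr.
(* The sign [e] of [y] is kept abstract, so that both signs share one argument. *)
have sg : exists2 e : int, (e = 1 \/ e = -1) & threshold 0 y = e /\ c < e * y.
  move/negbT: ync; rewrite negb_and -!ltNge /threshold oppr0 => /orP[h|h].
    exists (-1); first by right.
    have yn : y < 0 by apply: lt_le_trans h _; rewrite oppr_le0.
    by rewrite ltNge (ltW yn) /= yn mulN1r ltrNr.
  exists 1; first by left.
  by rewrite (le_lt_trans c0 h) mul1r.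
case: sg => e e1 [eE ey].
have ee : e * e = 1 by case: e1 => ->.
have sumU : \sum_(r < B) v r * residue c y (x r) =
    y * (\sum_(r < B) v r * s r) - e * (\sum_(r < B) v r * x r).
  rewrite !mulr_sumr -sumrB; apply: eq_bigr => r _; rewrite /residue eE /s; ring.
(* If the residue vanishes, then $ys = ex$ on the block and $\langle v, x\rangle = ey\langle v,
   s\rangle$. As $ey > c \ge 1$, the vector [s] is at least as good a relation as [x]. *)
case U0: (\sum_(r < B) residue c y (x r) ^+ 2 == 0) wE => wE.
  have {}U0 r : (r < B)%N -> y * s r = e * x r.
    move=> rB; move: U0; rewrite (sum_sqr_eq0 B (fun r => residue c y (x r))).
    by move=> /forallP/(_ (Ordinal rB)) /=; rewrite /residue eE -/(s r) subr_eq0 => /eqP.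
  split.
  - by move=> _; exists r1 => //; rewrite wE.
  - by move=> r rB; rewrite wE.
  - rewrite (sumw s)//; set S := \sum_(r < B) v r * s r; set E := \sum_(r < B) v r * x r.
    have yS : e * y * S = E.
      rewrite /S /E mulr_sumr; apply: eq_bigr => r _.
      transitivity (e * v r * (y * s r)); first by ring.
      rewrite U0//; transitivity (e * e * (v r * x r)); first by ring.
      by rewrite ee mul1r.
    have SE : `|S| <= `|E| by rewrite -yS; nia.
    have -> : S - y * S = S - e * E by rewrite -yS !mulrA ee mul1r.
    by case: e1 => ->; lia.
have [r2 r2B ur2] : exists2 r, (r < B)%N & residue c y (x r) != 0.
  move/negbT: U0; rewrite (sum_sqr_eq0 B (fun r => residue c y (x r))) negb_forall.
  by move=> /existsP[r ur]; exists r.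
split.
- by move=> _; exists r2 => //; rewrite wE.
- move=> r rB; rewrite wE// /residue eE.
  have := xc r rB; case: (threshold_cases (x r) c0) => -[h ->];
  by case: e1 ey => ->; lia.
- rewrite (sumw (fun r => residue c y (x r)))// sumU.
  by set S := \sum_(r < B) v r * s r; set E := \sum_(r < B) _; case: e1 => ->; lia.
Qed.

Lemma sum_blocks (a B : nat) (f : nat -> int) :
  \sum_(r < a * B) f r = \sum_(s < a) \sum_(r < B) f (s * B + r)%N.
Proof.
elim: a => [|a IH]; first by rewrite mul0n !big_ord0.
rewrite big_ord_recr /= -IH -!(big_mkord xpredT f) mulSn addnC.
rewrite (@big_cat_nat _ _ _ (a * B)) ?leq_addr//=; congr (_ + _).
rewrite -[X in index_iota X]add0n big_addn addKn big_mkord.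
by apply: eq_bigr => r _; rewrite addnC.
Qed.

(* [q] clears the denominator of the error bound. *)
Definition good_block (q : int) (V X : seq int) (off L : nat) (K E : int) : Prop :=
  [/\ exists2 r, (r < L)%N & X`_(off + r) != 0,
      forall r, (r < L)%N -> `|X`_(off + r)| <= K
    & `|\sum_(r < L) V`_(off + r) * X`_(off + r)| * q <= E].

Lemma len_gt0 beta t : (0 < len beta t)%N.
Proof. by rewrite /len expn_gt0. Qed.

Lemma lenS beta t : len beta t.+1 = (len beta t * len beta t)%N.
Proof. by rewrite /len -expnD expnS; congr (2 ^ _)%N; nia. Qed.

Lemma norm_boundS T t : (t < T)%N -> norm_bound T t = 2 * norm_bound T t.+1 + 1.
Proof.
move=> tT; rewrite /norm_bound (_ : T - t = (T - t.+1).+1)%N; last by lia.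
by rewrite expnS PoszM; ring.
Qed.

Lemma norm_bound_ge1 T t : 1 <= norm_bound T t.
Proof. by rewrite /norm_bound; have := expn_gt0 2 (T - t); lia. Qed.

Lemma norm_bound_le T t : norm_bound T t <= norm_bound T 0.
Proof.
rewrite /norm_bound lerD2r ler_wpM2l// lez_nat leq_pexp2l//; lia.
Qed.

Lemma size_solve base n W beta T t V : (forall V, size (base V) = n) ->
  size (solve base n W beta T t V) = n.
Proof. by move=> sb; case: t => [|t] /=; rewrite ?sb// size_mkseq. Qed.

Lemma threshold_le1 c x : `|threshold c x| <= 1.
Proof. by rewrite /threshold; do ![case: ifP => _ //]. Qed.

(** Block [J] of length $B^2$ consists of the blocks $JB, \dots, JB + B - 1$ of length $B$, and
    their values form exactly block [J] of [V']. This alignment is why one call on the array of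
    values serves all blocks. The new error is at most $2BE + E \le n^2E$ for $n \ge 3$. *)
Lemma solve_step base n A beta T t V J q E W :
  0 <= q -> (3 <= n)%N -> norm_bound T 0 <= n%:Z -> (t < T)%N -> 0 <= W ->
  (forall i, `|V`_i| <= W) -> W * (len beta t.+1)%:Z <= A ->
  let X := solve base n A beta T t V in
  let V' := values n A (len beta t) (norm_bound T t.+1) V X in
  let Y := solve base n A beta T t V' in
  ((J.+1 * len beta t.+1)%N <= n)%N ->
  (forall j, (j.+1 * len beta t <= n)%N ->
     good_block q V X (j * len beta t) (len beta t) (norm_bound T t) E) ->
  good_block q V' Y (J * len beta t) (len beta t) (norm_bound T t) E ->
  good_block q V (solve base n A beta T t.+1 V) (J * len beta t.+1) (len beta t.+1)
    (norm_bound T t.+1) (n%:Z ^+ 2 * E).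
Proof.
move=> q0 n3 Kn tT W0 VW WA; rewrite (norm_boundS tT) (lenS beta t).
set B := len beta t; set c := norm_bound T t.+1.
move=> X V' Y Jn HX [[s0 s0B Ys0] Yc YE].
have B0 : (0 < B)%N by apply: len_gt0.
have Bn : (B <= n)%N by nia.
have c1 : 1 <= c by apply: norm_bound_ge1.
have cn : c <= n%:Z by apply: le_trans (norm_bound_le _ _) Kn.
have jn s : (s < B)%N -> ((J * B + s).+1 * B <= n)%N by move=> sB; apply: leq_trans Jn; nia.
pose R := solve base n A beta T t.+1 V.
pose w s r := combine_entry n B c X Y ((J * B + s) * B + r).
have V'E s : (s < B)%N -> V'`_(J * B + s) =
    \sum_(r < B) V`_((J * B + s) * B + r) * threshold c X`_((J * B + s) * B + r).
  move=> sB; have sn : (J * B + s < n)%N by have := jn s sB; nia.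
  (* The clamp inside [values] is inert: a block value is at most [W * B], which is within [A]. *)
  rewrite nth_mkseq// blockE// clamp_id//; apply: le_trans WA.
  apply: le_trans (ler_norm_sum _ _ _) _.
  apply: le_trans (ler_sum (G := fun=> W) _ _) _.
    move=> r _; rewrite normrM -[leRHS]mulr1; apply: ler_pM => //; exact: threshold_le1.
  by rewrite sumr_const card_ord -mulr_natr natz ler_wpM2l// lez_nat lenS leq_pmulr.
have Hw s : (s < B)%N ->
  [/\ Y`_(J * B + s) != 0 -> exists2 r, (r < B)%N & w s r != 0,
      forall r, (r < B)%N -> `|w s r| <= c
    & `|\sum_(r < B) V`_((J * B + s) * B + r) * w s r - Y`_(J * B + s) * V'`_(J * B + s)| <=
      2 * `|\sum_(r < B) V`_((J * B + s) * B + r) * X`_((J * B + s) * B + r)|].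
  move=> sB; have [[r0 r0B Xr0] Xc XE] := HX _ (jn s sB).
  rewrite V'E//.
  apply: (@combine_block B c (Y`_(J * B + s)) (fun r => X`_((J * B + s) * B + r))
     (fun r => V`_((J * B + s) * B + r)) (w s)) => //.
  - exact: Yc.
  - by exists r0.
  - move=> r rB; rewrite /w /combine_entry divnMDl// divn_small// addn0.
    by rewrite !blockE.
have RE s r : (s < B)%N -> (r < B)%N -> R`_((J * B + s) * B + r) = w s r.
  move=> sB rB; have rn : ((J * B + s) * B + r < n)%N by have := jn s sB; nia.
  rewrite /R /= nth_mkseq// clamp_id//.
  by have [_ H _] := Hw s sB; apply: le_trans (H r rB) cn.
have idx s r : (J * (B * B) + (s * B + r) = (J * B + s) * B + r)%N by ring.
split.
- have [H _ _] := Hw s0 s0B; have [r rB wr] := H Ys0.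
  by exists (s0 * B + r)%N; rewrite ?idx ?RE//; nia.
- move=> r rBB; have sB : (r %/ B < B)%N by rewrite ltn_divLR.
  rewrite (divn_eq r B) idx RE ?ltn_pmod//.
  by have [_ H _] := Hw _ sB; apply: H; rewrite ltn_pmod.
- rewrite (sum_blocks B B (fun r => V`_(J * (B * B) + r) * R`_(J * (B * B) + r))).
  under eq_bigr => s _ do under eq_bigr => r _ do rewrite idx RE//.
  set S := \sum_(s < B) _.
  have SE : `|S - \sum_(s < B) V'`_(J * B + s) * Y`_(J * B + s)| * q <= B%:Z * (2 * E).
    rewrite /S -sumrB; apply: le_trans (ler_wpM2r q0 (ler_norm_sum _ _ _)) _.
    rewrite mulr_suml; apply: le_trans (ler_sum (G := fun=> 2 * E) _ _) _.
      move=> s _; have [_ _ H] := Hw s (ltn_ord s); rewrite [_ * Y`_ _]mulrC.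
      apply: le_trans (ler_wpM2r q0 H) _; rewrite -mulrA ler_wpM2l//.
      by have [_ _] := HX _ (jn s (ltn_ord s)).
    by rewrite sumr_const card_ord -[leLHS]mulr_natl (natz B) lexx.
  have E0 : 0 <= E by apply: le_trans YE; rewrite mulr_ge0.
  have BE : B%:Z * (2 * E) <= n%:Z * (2 * E) by rewrite ler_wpM2r ?mulr_ge0// lez_nat.
  set S' := \sum_(s < B) V'`_ _ * _ in SE YE.
  have : `|S| * q <= `|S - S'| * q + `|S'| * q.
    by rewrite -mulrDl ler_wpM2r// -[X in `|X| <= _](subrK S') ler_normD.
  move: SE YE BE; move: (`|S| * q) (`|S - S'| * q) (`|S'| * q) => x y z SE YE BE xyz.
  have n3' : 3 <= n%:Z by [].
  nia.
Qed.

Lemma solve_good base n A beta T q E0 :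
  0 <= q -> (3 <= n)%N -> norm_bound T 0 <= n%:Z ->
  (forall V, size (base V) = n) ->
  (forall V, (forall i, `|V`_i| <= A) ->
    forall J, (J.+1 * len beta 0 <= n)%N ->
    good_block q V (base V) (J * len beta 0) (len beta 0) (norm_bound T 0) E0) ->
  forall t, (t <= T)%N -> forall V W, 0 <= W -> (forall i, `|V`_i| <= W) ->
    W * (len beta t)%:Z <= A ->
    forall J, (J.+1 * len beta t <= n)%N ->
    good_block q V (solve base n A beta T t V) (J * len beta t) (len beta t)
      (norm_bound T t) (n%:Z ^+ (2 * t) * E0).
Proof.
move=> q0 n3 Kn sb Hb; elim=> [|t IH] tT V W W0 VW WA J Jn.
  rewrite mul1r; apply: Hb => // i; apply: le_trans (VW i) _.
  by apply: le_trans WA; rewrite ler_peMr// lez_nat len_gt0.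
have B0 := len_gt0 beta t.
have -> : n%:Z ^+ (2 * t.+1) * E0 = n%:Z ^+ 2 * (n%:Z ^+ (2 * t) * E0).
  by rewrite mulrA -exprD mulnS.
have W1 : W * (len beta t)%:Z <= A.
  apply: le_trans WA; rewrite ler_wpM2l// lez_nat lenS leq_pmulr//.
apply: (solve_step q0 n3 Kn tT W0 VW WA Jn).
  by move=> j jn; apply: (IH (ltnW tT) V W).
have Bn : (len beta t <= n)%N by move: Jn; rewrite lenS; nia.
(* Passing to block values multiplies the bound on the entries by one block length; the squaring of
   lengths from [t] to [t.+1] leaves exactly this room. *)
apply: (IH (ltnW tT) _ (W * (len beta t)%:Z)).
- by rewrite mulr_ge0.
- move=> i; case: (ltnP i n) => i_n; last first.
    by rewrite nth_default ?size_mkseq// normr0 mulr_ge0.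
  rewrite nth_mkseq//; set S := block _ _ _ _.
  have SW : `|S| <= W * (len beta t)%:Z.
    rewrite /S blockE//; apply: le_trans (ler_norm_sum _ _ _) _.
    apply: le_trans (ler_sum (G := fun=> W) _ _) _.
      move=> r _; rewrite normrM -[leRHS]mulr1; apply: ler_pM => //; exact: threshold_le1.
    by rewrite sumr_const card_ord -mulr_natr natz.
  by rewrite clamp_id// (le_trans SW).
- by rewrite -mulrA -PoszM -lenS.
- by move: Jn; rewrite lenS; nia.
Qed.

(** * Lattice points of the dilated body *)

Definition nonzero_block (n b : nat) (o : seq int) (e : nat) : bool :=
  \sum_(i < n) (if (i < b)%N then o`_(e * b.+1 + i) * o`_(e * b.+1 + i) else 0) != 0.

Definition pick_block (n b : nat) (o : seq int) : nat :=
  foldr (fun e acc => if nonzero_block n b o e then e else acc) 0%N (iota 0 n).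

Lemma pick_blockP n b o e : (e < n)%N -> nonzero_block n b o e ->
  nonzero_block n b o (pick_block n b o).
Proof.
move=> en He; have : has (nonzero_block n b o) (iota 0 n).
  by apply/hasP; exists e => //; rewrite mem_iota.
rewrite /pick_block; elim: (iota 0 n) => //= i s IH.
by case: ifP.
Qed.

Lemma nonzero_blockP n b o e : (b <= n)%N ->
  reflect (exists2 r, (r < b)%N & o`_(e * b.+1 + r) != 0) (nonzero_block n b o e).
Proof.
move=> bn; rewrite /nonzero_block -big_mkcond /=.
rewrite -(big_ord_widen n (fun r => o`_(e * b.+1 + r) * o`_(e * b.+1 + r)) bn).
under eq_bigr do rewrite -expr2.
rewrite (sum_sqr_eq0 b (fun r => o`_(e * b.+1 + r))) negb_forall.
apply: (iffP existsP) => [[r H]|[r rb H]]; first by exists r.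
by exists (Ordinal rb).
Qed.

Lemma slack_row n b D v (o : seq int) e : (e < n %/ b.+1)%N ->
  \sum_(j < n) entry n b D v (e * b.+1 + b) j * o`_j =
  (2 ^ b)%N%:Z * ((slack_weight n D)%:Z * o`_(e * b.+1 + b) +
    \sum_(r < b) v r * o`_(e * b.+1 + r)).
Proof.
move=> eq; set i := (e * b.+1 + b)%N.
have q1 : (e.+1 * b.+1 <= n %/ b.+1 * b.+1)%N by rewrite leq_mul2r eq orbT.
have q2 : (n %/ b.+1 * b.+1 <= n)%N by apply: leq_divM.
have i1 : (i < n %/ b.+1 * b.+1)%N by rewrite /i; lia.
have ib : (i %% b.+1 = b)%N by rewrite /i modnMDl modn_small.
have ie : (i %/ b.+1 = e)%N by rewrite /i divnMDl// divn_small// addn0.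
have entE j : entry n b D v i j = if i == j then (2 ^ b * slack_weight n D)%N%:Z
    else if (e == j %/ b.+1)%N then (2 ^ b)%N%:Z * v (j %% b.+1)%N else 0.
  by rewrite /entry i1 ib ltnn ie.
under eq_bigr do rewrite entE.
set F := fun j : nat => (if i == j then (2 ^ b * slack_weight n D)%N%:Z
    else if (e == j %/ b.+1)%N then (2 ^ b)%N%:Z * v (j %% b.+1)%N else 0) * o`_j.
rewrite -(big_mkord xpredT F) /F.
rewrite (@big_cat_nat _ _ _ (e * b.+1)) ?leq0n//=; last by lia.
rewrite [X in X + _]big_nat big1 ?add0r; last first.
  move=> j /= jb; rewrite gtn_eqF; last by rewrite /i; lia.
  rewrite gtn_eqF ?mul0r//; rewrite ltn_divLR//.
rewrite (@big_cat_nat _ _ _ (e.+1 * b.+1)) ?leq_mul2r ?leqnSn ?orbT//=; last by lia.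
rewrite [X in _ + X]big_nat [X in _ + X]big1 ?addr0; last first.
  move=> j /= /andP[jb _]; rewrite ltn_eqF; last by rewrite /i; lia.
  by rewrite ltn_eqF ?mul0r// leq_divRL.
rewrite mulSn addnC -[X in index_iota X]add0n big_addn addKn big_mkord big_ord_recr /=.
rewrite [(b + _)%N]addnC -/i eqxx mulrDr addrC PoszM mulrA; congr (_ + _).
rewrite mulr_sumr; apply: eq_bigr => r _.
rewrite gtn_eqF; last by rewrite /i addnC ltn_add2l.
by rewrite addnC divnMDl// divn_small ?addn0 ?eqxx ?modnMDl ?modn_small ?mulrA// ltnW// ltnS.
Qed.

(** Leftover coordinates satisfy $n|o_i| < P \le n$ and therefore vanish, and so do the slack
    coordinates; hence some copy of the block is nonzero. With $z = 0$ its slack row reads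
    $2^b|\langle v, o\rangle| < P n^6 D \le n^7 D$. *)
Lemma picked_block n b D v P (o : seq int) :
  (2 <= b)%N -> (b * b <= n)%N -> (0 < D)%N -> (P <= n)%N ->
  (4 * b * P < n * n)%N -> (P * (n * (n * n)) * 2 <= 2 ^ b)%N -> size o = n ->
  (forall r, (r < b)%N -> `|v r| <= (n * D)%N%:Z) ->
  (exists2 i, (i < n)%N & o`_i != 0) ->
  (forall i, (i < n)%N -> `|\sum_(j < n) entry n b D v i j * o`_j| < P%:Z * bound n b D i) ->
  let z := pick_block n b o in
  [/\ exists2 r, (r < b)%N & o`_(z * b.+1 + r) != 0,
      forall r, (r < b)%N -> `|o`_(z * b.+1 + r)| <= 2 * P%:Z - 1
    & `|\sum_(r < b) v r * o`_(z * b.+1 + r)| * (2 ^ b)%N%:Z <= (n ^ 7 * D)%N%:Z].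
Proof.
move=> b2 bb D0 Pn bP Pb so vA [i0 i0n oi0] H z.
have n0 : (0 < n)%N by nia.
have bn : (b <= n)%N by nia.
have diag i : (i < n)%N -> (forall j, j != i -> entry n b D v i j = 0) ->
    `|entry n b D v i i * o`_i| < P%:Z * bound n b D i.
  move=> i_n e0; have := H i i_n; rewrite (bigD1 (Ordinal i_n))//= big1 ?addr0//.
  by move=> j ji; rewrite e0 ?mul0r//; apply: contraNneq ji => ji; apply/eqP/val_inj.
have left0 i : (n %/ b.+1 * b.+1 <= i)%N -> o`_i = 0.
  move=> qi; case: (ltnP i n) => i_n; last by rewrite nth_default// so.
  have := diag i i_n; rewrite /entry /bound eqxx ltnNge qi /= mulr1 normrM => /(_ _)/wrap[].
    by move=> j ji; rewrite eq_sym (negbTE ji).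
  have : P%:Z <= n%:Z by [].
  move: (o`_i) => x; rewrite (ger0_norm (_ : 0 <= n%:Z))//.
  have n0' : 0 < n%:Z by [].
  by move=> Pn' nx; apply/eqP; rewrite -normr_le0; nia.
have real i : (i < n %/ b.+1 * b.+1)%N -> (i %% b.+1 < b)%N -> `|o`_i| <= 2 * P%:Z - 1.
  move=> qi ib; have i_n : (i < n)%N by apply: leq_trans qi (leq_divM _ _).
  have := diag i i_n; rewrite /entry /bound eqxx qi ib mul1r => /(_ _)/wrap[]; last by lia.
  by move=> j ji; rewrite eq_sym (negbTE ji).
have blockq e r : (e < n %/ b.+1)%N -> (r < b)%N -> (e * b.+1 + r < n %/ b.+1 * b.+1)%N.
  move=> eq rb; have : (e.+1 * b.+1 <= n %/ b.+1 * b.+1)%N by rewrite leq_mul2r eq orbT.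
  by rewrite mulSn; lia.
have realb e r : (e < n %/ b.+1)%N -> (r < b)%N -> `|o`_(e * b.+1 + r)| <= 2 * P%:Z - 1.
  move=> eq rb; apply: real; first exact: blockq.
  by rewrite modnMDl modn_small// ltnW// ltnS.
have slack e : (e < n %/ b.+1)%N -> o`_(e * b.+1 + b) = 0 /\
    `|\sum_(r < b) v r * o`_(e * b.+1 + r)| * (2 ^ b)%N%:Z <= (n ^ 7 * D)%N%:Z.
  move=> eq; set s := \sum_(r < b) _.
  have q1 : (e.+1 * b.+1 <= n %/ b.+1 * b.+1)%N by rewrite leq_mul2r eq orbT.
  have qn : (n %/ b.+1 * b.+1 <= n)%N by apply: leq_divM.
  have i1 : (e * b.+1 + b < n %/ b.+1 * b.+1)%N by rewrite mulSn in q1; lia.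
  have := H _ (leq_trans i1 qn); rewrite slack_row// -/s /bound i1 modnMDl modn_small// ltnn.
  have sA : `|s| <= (b * (n * D) * (2 * P))%N%:Z.
    apply: le_trans (ler_norm_sum _ _ _) _.
    apply: le_trans (ler_sum (G := fun=> (n * D)%N%:Z * (2 * P%:Z)) _ _) _.
      move=> r _; rewrite normrM; apply: ler_pM => //; first exact: vA.
      by apply: le_trans (realb _ _ eq (ltn_ord r)) _; lia.
    by rewrite sumr_const card_ord -[leLHS]mulr_natl (natz b) -!PoszM lez_nat; lia.
  rewrite normrM (ger0_norm (_ : 0 <= (2 ^ b)%N%:Z))//.
  set x := o`_ _; set M := slack_weight n D.
  have MD : (4 * (b * (n * D) * (2 * P)) < 2 * M)%N.
    by rewrite /M /slack_weight; nia.
  have x0 : x = 0 -> `|s| * (2 ^ b)%N%:Z < P%:Z * (M * (n * (n * n)))%N%:Z ->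
     `|s| * (2 ^ b)%N%:Z <= (n ^ 7 * D)%N%:Z.
    move=> _ /ltW /le_trans; apply; rewrite -PoszM lez_nat /M /slack_weight.
    rewrite (_ : n ^ 7 * D = n * (n * (n * n) * D * (n * (n * n))))%N; last by ring.
    by rewrite leq_mul2r Pn orbT.
  case: (eqVneq x 0) => [xE|xN] Hs.
    split => //; apply: x0 => //.
    by move: Hs; rewrite xE mulr0 add0r mulrC.
  (* If $z \ne 0$, then $|Mz + s| \ge M/2$ and the row is at least $2^b M/2$, while it has to stay
     below $P M n^3 \le 2^b M/2$. *)
  exfalso.
  have x1 : 1 <= `|x| by rewrite -gtz0_ge1 normr_gt0.
  have Mx : M%:Z <= 2 * `|M%:Z * x + s|.
    have : `|M%:Z * x| <= `|M%:Z * x + s| + `|s|.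
      by rewrite -{1}(addrK s (M%:Z * x)) ler_normB.
    rewrite normrM (ger0_norm (_ : 0 <= M%:Z))//.
    have : M%:Z <= M%:Z * `|x| by rewrite ler_peMr.
    by lia.
  have PM : (P * (n * (n * n)) * 2 * M <= 2 ^ b * M)%N by rewrite leq_mul2r Pb orbT.
  have : (2 ^ b)%N%:Z * M%:Z <= 2 * ((2 ^ b)%N%:Z * `|M%:Z * x + s|).
    by rewrite mulrCA ler_wpM2l.
  have PM' : (P%:Z * (M * (n * (n * n)))%N%:Z) * 2 <= (2 ^ b)%N%:Z * M%:Z.
    by rewrite -!PoszM lez_nat; move: PM; lia.
  by move: Hs PM'; lia.
have nz : nonzero_block n b o z.
  have i0q : (i0 < n %/ b.+1 * b.+1)%N.
    by rewrite ltnNge; apply: contra oi0 => /left0 ->.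
  have e0q : (i0 %/ b.+1 < n %/ b.+1)%N by rewrite ltn_divLR.
  apply: (@pick_blockP n b o (i0 %/ b.+1)).
    by apply: leq_ltn_trans (leq_div _ _) i0n.
  apply/nonzero_blockP => //; exists (i0 %% b.+1)%N; last by rewrite -divn_eq.
  have := ltn_pmod i0 (ltn0Sn b); rewrite ltnS leq_eqVlt => /orP[/eqP i0b|//].
  have E : (i0 %/ b.+1 * b.+1 + b)%N = i0 by rewrite [RHS](divn_eq i0 b.+1) i0b.
  by have [xE _] := slack _ e0q; rewrite E in xE; rewrite xE eqxx in oi0.
have /nonzero_blockP [//|r rb orz] := nz.
have zq : (z < n %/ b.+1)%N.
  have : (z * b.+1 + r < n %/ b.+1 * b.+1)%N.
    by rewrite ltnNge; apply: contra orz => /left0 ->.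
  by move=> h; rewrite -(ltn_pmul2r (ltn0Sn b)); apply: leq_ltn_trans h; rewrite leq_addr.
split; first by exists r.
- by move=> r' rb'; apply: realb.
- by have [] := slack z zq.
Qed.

(** * Correctness of the program *)

Lemma dsub_int a b : (b <= a)%N -> dsub (dint a) (dint b) = dint (a - b).
Proof. by move=> ba; rewrite darithE /= -subzn. Qed.

Lemma dclampE W a : dclamp (Int W) (Int a) = Int (clamp W a).
Proof.
rewrite /dclamp darithE /= sub0r dle_int dif_bool dle_int dif_bool /clamp.
by case: ifP => // _; case: ifP => // _; rewrite darithE /= addr0.
Qed.

Lemma dthrE c x : dthr (Int c) (Int x) = Int (threshold c x).
Proof.
by rewrite /dthr darithE /= !dlt_int !dif_bool sub0r /threshold; case: ifP => // _; case: ifP.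
Qed.

Lemma dblockE n B F f j : (forall i : nat, F (dint i) = Int (f i)) ->
  dblock (didx n) (dint B) F (dint j) = Int (block n B f j).
Proof.
move=> Ff; rewrite /dblock (@dsum_didx n _ (fun r => if (r < B)%N then f (j * B + r)%N else 0))// => i _.
by rewrite !dint_simpl Ff; case: ifP.
Qed.

Lemma dvaluesE n W B c V X : (size V <= n)%N -> (size X <= n)%N ->
  dvalues (didx n) (Int W) (dint B) (Int c) (dvec V) (dvec X) = dvec (values n W B c V X).
Proof.
move=> Vn Xn; apply: dmk_dvec => j _.
rewrite (@dblockE n B _ (fun i => V`_i * threshold c X`_i)) ?dclampE// => i.
by rewrite !dnth_dvec// dthrE.
Qed.

Lemma dif_Int x a b : dif (Int x) a b = if x == 0 then b else a.
Proof. by rewrite /dif /=; case: eqP. Qed.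

Lemma dcombineE n B c X Y : (size X <= n)%N -> (size Y <= n)%N ->
  dcombine (didx n) (dint n) (dint B) (Int c) (dvec X) (dvec Y) = dvec (combine n B c X Y).
Proof.
move=> Xn Yn; apply: dmk_dvec => i _; rewrite -dclampE; congr dclamp.
have SE k : dthr (Int c) (dnth (didx n) (dvec X) (dint k)) = Int (threshold c X`_k).
  by rewrite dnth_dvec// dthrE.
have yE : dnth (didx n) (dvec Y) (ddiv (dint i) (dint B)) = Int Y`_(i %/ B).
  by rewrite ddiv_int dnth_dvec.
rewrite /combine_entry; cbv zeta; rewrite yE ddiv_int dif_Int; case: ifP => // _.
rewrite (@dblockE n B _ (fun i => threshold c X`_i ^+ 2)); last first.
  by move=> k; rewrite /dsquare SE darithE /= expr2.
rewrite dif_Int; case: ifP => _; first by rewrite dnth_dvec.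
rewrite (darithE Sub 0 c) /= sub0r !dle_int dand_bool dif_bool andbC.
rewrite SE; case: ifP => _; first by rewrite darithE.
have UE k : dsub (dmul (Int Y`_(i %/ B)) (dthr (Int c) (dnth (didx n) (dvec X) (dint k))))
    (dmul (dthr (dint 0) (Int Y`_(i %/ B))) (dnth (didx n) (dvec X) (dint k))) =
    Int (residue c Y`_(i %/ B) X`_k).
  by rewrite SE dthrE dnth_dvec.
rewrite (@dblockE n B _ (fun k => residue c Y`_(i %/ B) X`_k ^+ 2)); last first.
  by move=> k; rewrite /dsquare UE darithE /= expr2.
by rewrite dif_Int; case: ifP => _ //; rewrite -UE SE.
Qed.

Lemma dnormE n W V : size V = n -> (forall i, `|V`_i| <= W) ->
  dnorm (didx n) (Int W) (dvec V) = dvec V.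
Proof.
move=> Vn VW; rewrite /dnorm (@dmk_dvec n _ (nth 0 V)); first by rewrite -Vn mkseq_nth.
by move=> i _; rewrite dnth_dvec ?Vn// dclampE clamp_id.
Qed.

Lemma dpickE n b o : (size o <= n)%N ->
  dpick (didx n) (dint b) (dvec o) = dint (pick_block n b o).
Proof.
move=> on; rewrite /dpick -[X in dfold _ X _]/(encode_seq [seq dint i | i <- rev (iota 0 n)]) dfold_encode map_rev foldl_rev /pick_block.
elim: (iota 0 n) => //= e s ->.
rewrite (@dsum_didx n _ (fun i => if (i < b)%N then o`_(e * b.+1 + i) * o`_(e * b.+1 + i) else 0)).
  by rewrite dif_Int /nonzero_block; case: eqP.
move=> i _; rewrite !dint_simpl !addn1 dnth_dvec// darithE /=.
by case: ifP.
Qed.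

Definition base_solution (n b : nat) (O : (nat -> int) -> seq int) (V : seq int) : seq int :=
  mkseq (fun i => let out := O (fun r => V`_(i %/ b * b + r)) in
    clamp n out`_(pick_block n b out * b.+1 + i %% b)) n.

Lemma dbaseE orc n b D O V : (b <= n)%N -> size V = n ->
  (forall v, orc (encode_minkowski_instance (instance n b D v)) = dvec (O v)) ->
  (forall v, size (O v) = n) ->
  dbase orc (didx n) (dint n) (dint b) (dint D) (dvec V) = dvec (base_solution n b O V).
Proof.
move=> bn Vn orcE sO; apply: dmk_dvec => i _; cbv zeta.
rewrite ddiv_int dinstE//.
have -> : (fun r => to_int (dnth (didx n) (dvec V) (dadd (dmul (dint (i %/ b)) (dint b)) (dint r)))) =
    (fun r => V`_(i %/ b * b + r)).
  by apply/funext => r; rewrite !dint_simpl dnth_dvec// Vn.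
by rewrite orcE dpickE ?sO// !dint_simpl addn1 dnth_dvec ?sO// dclampE.
Qed.

(** * The stack machine and the recursion *)

Fixpoint run_time (t : nat) : nat := if t is t'.+1 then (2 * run_time t' + 3)%N else 1%N.

(** The closed form is $2^{t+2} - 3$: a level makes two recursive calls and three steps of its
    own. *)
Lemma run_time_le t : (run_time t + 3 <= 4 * 2 ^ t)%N.
Proof. by elim: t => //= t IH; rewrite expnS; lia. Qed.

Lemma clamped_mkseq W n f i : 0 <= W -> `|(mkseq (fun i => clamp W (f i)) n)`_i| <= W.
Proof.
move=> W0; case: (ltnP i n) => i_n; first by rewrite nth_mkseq// clamp_norm.
by rewrite nth_default ?size_mkseq// normr0.
Qed.

Section Machine.
Variables (orc : data -> data) (n beta D T : nat) (O : (nat -> int) -> seq int).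
Let b := (2 ^ beta)%N.
Let A : int := (n * D)%N%:Z.
Hypotheses (bn : (b <= n)%N) (D0 : (0 < D)%N) (Tn : (T <= n)%N) (lenn : (len beta T <= n)%N).
Hypothesis orcE : forall v, orc (encode_minkowski_instance (instance n b D v)) = dvec (O v).
Hypothesis sO : forall v, size (O v) = n.

Let step := dstep orc (didx n) (dint n) (dint b) (dint beta) (dint D) (dint T).
Let sol := solve (base_solution n b O) n A beta T.

Lemma sol_entry_le t V i : `|(sol t V)`_i| <= n%:Z.
Proof. by rewrite /sol; case: t => [|t] /=; apply: clamped_mkseq. Qed.

Lemma size_sol t V : size (sol t V) = n.
Proof. by apply: size_solve => V'; rewrite size_mkseq. Qed.

Lemma dlen t : (t < T)%N ->
  dpow2 (didx n) (dmul (dint beta) (dpow2 (didx n) (dsub (dint t.+1) (dint 1)))) = dint (len beta t).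
Proof.
move=> tT; rewrite dsub_int// subn1 /= dpow2_didx; last by apply: leq_trans Tn; apply: ltnW.
rewrite dmul_int dpow2_didx//; apply: leq_trans lenn.
apply: leq_trans (ltnW (ltn_expl _ (isT : 1 < 2)%N)) _.
by rewrite leq_pexp2l// leq_mul// leq_pexp2l// ltnW.
Qed.

Lemma dnorm_bound t : (t <= T)%N ->
  dsub (dmul (dint 2) (dpow2 (didx n) (dsub (dint T) (dint t)))) (dint 1) = Int (norm_bound T t).
Proof.
move=> tT; rewrite dsub_int// dpow2_didx; last by apply: leq_trans (leq_subr _ _) Tn.
by rewrite dmul_int darithE.
Qed.

Lemma dclamp_level t : (t <= T)%N -> dclamp (dint n) (dint t) = dint t.
Proof. by move=> tT; rewrite dclampE clamp_id// lez_nat (leq_trans tT). Qed.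

Lemma nA : n%:Z <= A.
Proof. by rewrite /A lez_nat leq_pmulr. Qed.

Lemma step_base V rest : size V = n ->
  step (Pair (ditem (dint 0) (dint 0) (dvec V)) rest) =
  Pair (ditem (dint 1) (dint 0) (dvec (sol 0 V))) rest.
Proof. by move=> Vn; rewrite /step /dstep /= !deq_int !dif_bool /= (dbaseE bn Vn orcE sO). Qed.

Lemma step_call t V rest : (t < T)%N -> size V = n -> (forall i, `|V`_i| <= A) ->
  step (Pair (ditem (dint 0) (dint t.+1) (dvec V)) rest) =
  Pair (ditem (dint 0) (dint t) (dvec V)) (Pair (ditem (dint 2) (dint t.+1) (dvec V)) rest).
Proof.
move=> tT Vn VA; rewrite /step /dstep /= !deq_int !dif_bool /= dmul_int dnormE//.
by rewrite dsub_int// subn1 /= !dclamp_level// ltnW.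
Qed.

Lemma step_inner t V X l rest : (t < T)%N -> size V = n ->
  size X = n -> (forall i, `|X`_i| <= n%:Z) ->
  step (Pair (ditem (dint 1) l (dvec X)) (Pair (ditem (dint 2) (dint t.+1) (dvec V)) rest)) =
  Pair (ditem (dint 0) (dint t) (dvec (values n A (len beta t) (norm_bound T t.+1) V X)))
    (Pair (ditem (dint 3) (dint t.+1) (dvec X)) rest).
Proof.
move=> tT Vn Xn XA; rewrite /step /dstep /= !deq_int !dif_bool /= dmul_int dnormE//; last first.
  by move=> i; apply: le_trans (XA i) nA.
rewrite dlen// dnorm_bound// dvaluesE ?Vn ?Xn//.
by rewrite dsub_int// subn1 /= !dclamp_level// ltnW.
Qed.

Lemma step_outer t X Y l rest : (t < T)%N -> size X = n -> size Y = n ->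
  step (Pair (ditem (dint 1) l (dvec Y)) (Pair (ditem (dint 3) (dint t.+1) (dvec X)) rest)) =
  Pair (ditem (dint 1) (dint t.+1) (dvec (combine n (len beta t) (norm_bound T t.+1) X Y))) rest.
Proof.
move=> tT Xn Yn; rewrite /step /dstep /= !deq_int !dif_bool /= dlen// dnorm_bound//.
by rewrite dcombineE ?Xn ?Yn// dclamp_level.
Qed.

Lemma machine_solve t V rest : (t <= T)%N -> size V = n -> (forall i, `|V`_i| <= A) ->
  iter (run_time t) step (Pair (ditem (dint 0) (dint t) (dvec V)) rest) =
  Pair (ditem (dint 1) (dint t) (dvec (sol t V))) rest.
Proof.
elim: t V rest => [|t IH] V rest tT Vn VA; first exact: step_base.
(* The summands are the call, the first solution, the hand-over of the block values, the second
   solution and the combination. *)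
have -> : run_time t.+1 = (1 + run_time t + 1 + run_time t + 1)%N by rewrite /=; lia.
rewrite addn1 iterS addnC iterD addn1 iterS [(1 + _)%N]addnC iterD /=.
rewrite step_call// IH// ?(ltnW tT)// step_inner// ?size_sol//; last exact: sol_entry_le.
rewrite IH// ?(ltnW tT)//; last 2 first.
- by rewrite size_mkseq.
- by move=> i; apply: clamped_mkseq.
by rewrite step_outer ?size_sol.
Qed.

Lemma drunE V : (4 * 2 ^ T <= n)%N -> size V = n -> (forall i, `|V`_i| <= A) ->
  drun orc (didx n) (dint n) (dint b) (dint beta) (dint D) (dint T) (dvec V) = dvec (sol T V).
Proof.
move=> T4 Vn VA; rewrite /drun -[X in dfold _ X _]/(encode_seq [seq dint i | i <- rev (iota 0 n)]) dfold_encode.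
have foldE l st : foldl (fun acc _ => step acc) st l = iter (size l) step st :> data.
  by elim: l st => //= e l IH st; rewrite IH -iterSr.
rewrite foldE size_map size_rev size_iota.
have rn : (run_time T <= n)%N by have := run_time_le T; lia.
have -> st : iter n step st = iter (n - run_time T + run_time T) step st by rewrite subnK.
(* An answer on the empty stack is a fixed point, because [dint 0] reads as an item with tag 0; the
   surplus steps are idle. *)
by rewrite iterD machine_solve// iter_fix.
Qed.

End Machine.

(** * Search for the best sign vector *)

Definition dot (n : nat) (V X : seq int) : int := \sum_(i < n) V`_i * X`_i.

Definition sign_vector (n : nat) (X : seq int) : Prop :=
  [/\ size X = n, exists2 i, (i < n)%N & X`_i != 0
    & forall i, (i < n)%N -> `|X`_i| <= 1].

Definition better (n : nat) (V X Y : seq int) : bool :=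
  [&& \sum_(i < n) X`_i ^+ 2 != 0,
      \sum_(i < n) (if clamp 1 X`_i == X`_i then 0 else 1) < 1 :> int
    & dot n V X ^+ 2 < dot n V Y ^+ 2].

Lemma clamp1E x : (clamp 1 x == x) = (`|x| <= 1).
Proof.
apply/eqP/idP => [<-|/clamp_id//]; exact: clamp_norm.
Qed.

Lemma sqr_norm_ltr (x y : int) : (x ^+ 2 < y ^+ 2) = (`|x| < `|y|).
Proof. by rewrite -[x ^+ 2]real_normK ?num_real// -[y ^+ 2]real_normK ?num_real// ltr_pXn2r// nnegrE. Qed.

Lemma betterP n V X Y : size X = n ->
  reflect (sign_vector n X /\ `|dot n V X| < `|dot n V Y|) (better n V X Y).
Proof.
move=> Xn; rewrite /better sqr_norm_ltr; apply: (iffP and3P).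
- move=> [H1 H2 H3]; split => //; split => //.
    move: H1; rewrite (sum_sqr_eq0 n (fun i => X`_i)) negb_forall => /existsP[r Xr].
    by exists r.
  move=> i i_n; rewrite -clamp1E; apply: contraLR H2 => H; rewrite -leNgt.
  rewrite (bigD1 (Ordinal i_n))//= (negbTE H) lerDl sumr_ge0// => j _.
  by case: ifP.
- move=> [[_ [r rn Xr] X1] H]; split => //.
    rewrite (sum_sqr_eq0 n (fun i => X`_i)) negb_forall; apply/existsP.
    by exists (Ordinal rn).
  by rewrite big1// => i _; rewrite clamp1E X1.
Qed.

Lemma dimproveE n V X Y : (size V <= n)%N -> (size X <= n)%N -> (size Y <= n)%N ->
  dimprove (didx n) (dvec V) (dvec X) (dvec Y) = dvec (if better n V X Y then X else Y).
Proof.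
move=> Vn Xn Yn; rewrite /dimprove /dbetter /better.
have dotE Z : (size Z <= n)%N -> ddot (didx n) (dvec V) (dvec Z) = Int (dot n V Z).
  move=> Zn; apply: (@dsum_didx n _ (fun i => V`_i * Z`_i)) => i _.
  by rewrite !dnth_dvec.
rewrite !dotE// /dsquare !darithE /= dlt_int -!expr2.
rewrite (@dsum_didx n _ (fun i => X`_i ^+ 2)); last first.
  by move=> i _; rewrite dnth_dvec// darithE /= expr2.
rewrite (@dsum_didx n _ (fun i => if clamp 1 X`_i == X`_i then 0 else 1)); last first.
  by move=> i _; rewrite dnth_dvec// dclampE deq_int dif_bool; case: ifP.
rewrite dlt_int /dand !dif_Int; case: eqP => //= _; case: (_ < 1) => //=.
by case: (_ < _).
Qed.

Definition at_most (n : nat) (V : seq int) (m : int) (d : data) : Prop :=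
  exists2 y, d = dvec y & sign_vector n y /\ `|dot n V y| <= m.

(** The value achieved never increases along the fold, so what one element guarantees survives to
    the end. This is the reason for the monotonicity asked of [Q]. *)
Lemma foldl_improves n V (g : data -> nat -> data) (Q : nat -> int -> Prop) s d m :
  (forall e m m', m' <= m -> Q e m -> Q e m') ->
  (forall e d m, e \in s -> at_most n V m d ->
     exists m', [/\ m' <= m, Q e m' & at_most n V m' (g d e)]) ->
  at_most n V m d ->
  exists m', [/\ m' <= m, forall e, e \in s -> Q e m' & at_most n V m' (foldl g d s)].
Proof.
move=> Qmon; elim: s d m => [|e s IH] d m Hg dm /=; first by exists m.
have [m1 [m1m Qe g1]] := Hg e d m (mem_head _ _) dm.
have [|m2 [m2m Qs g2]] := IH (g d e) m1 _ g1.
  by move=> e' d' m' es; apply: Hg; rewrite inE es orbT.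
exists m2; split => //; first exact: le_trans m1m.
by move=> e'; rewrite inE => /orP[/eqP ->|/Qs//]; apply: Qmon Qe.
Qed.

Lemma improve_step n V X d m : size V = n -> size X = n -> at_most n V m d ->
  exists m', [/\ m' <= m, sign_vector n X -> m' <= `|dot n V X|
    & at_most n V m' (dimprove (didx n) (dvec V) (dvec X) d)].
Proof.
move=> Vn Xn [y -> [ysgn ym]]; have yn : size y = n by case: ysgn.
rewrite dimproveE ?Vn ?Xn ?yn//; case: betterP => // [[Xs Xy]|nb].
  exists `|dot n V X|; split => //; first by apply: le_trans ym; apply: ltW.
  by exists X.
exists `|dot n V y|; split => //; last by exists y.
by move=> Xs; rewrite leNgt; apply/negP => Xy; apply: nb.
Qed.

Lemma dfold_didx g n a : dfold g (didx n) a = foldl (fun acc i => g (dint i) acc) a (rev (iota 0 n)).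
Proof.
rewrite -[X in dfold _ X _]/(encode_seq [seq dint i | i <- rev (iota 0 n)]) dfold_encode.
by elim: (rev _) a => //= e s IH a; rewrite IH.
Qed.

Definition unit_vector n : seq int := mkseq (fun i => (i == 0)%N%:Z) n.
Definition difference_vector n e1 e2 : seq int := mkseq (fun i => (i == e1)%N%:Z - (i == e2)%N%:Z) n.

Lemma dunitE n : dunit (didx n) = dvec (unit_vector n).
Proof. by apply: dmk_dvec => i _; rewrite dif_Int eqz_nat; case: eqP. Qed.

Lemma ddiffE n e1 e2 : ddiff (didx n) (dint e1) (dint e2) = dvec (difference_vector n e1 e2).
Proof. by apply: dmk_dvec => i _; rewrite !deq_int !eqz_nat darithE. Qed.

Lemma dot_indicator n V e : (e < n)%N -> \sum_(i < n) V`_i * (val i == e)%N%:Z = V`_e.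
Proof.
move=> en; rewrite (bigD1 (Ordinal en))//= eqxx mulr1 big1 ?addr0// => i ie.
rewrite (_ : (val i == e) = false) ?mulr0//; apply/negbTE; apply: contra ie => /eqP ie.
exact/eqP/val_inj.
Qed.

Lemma unit_vector_sign n : (0 < n)%N -> sign_vector n (unit_vector n).
Proof.
move=> n0; split; first by rewrite size_mkseq.
  by exists 0%N => //; rewrite nth_mkseq.
by move=> i i_n; rewrite nth_mkseq//; case: eqP.
Qed.

Lemma dot_unit_vector n V : (0 < n)%N -> dot n V (unit_vector n) = V`_0.
Proof.
move=> n0; rewrite -[RHS](dot_indicator V n0); apply: eq_bigr => i _.
by rewrite nth_mkseq.
Qed.

Lemma difference_vector_sign n e1 e2 : (e1 < n)%N -> e1 != e2 ->
  sign_vector n (difference_vector n e1 e2).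
Proof.
move=> en ee; split; first by rewrite size_mkseq.
  by exists e1 => //; rewrite nth_mkseq// eqxx (negbTE ee).
by move=> i i_n; rewrite nth_mkseq//; do 2 case: eqP.
Qed.

Lemma dot_difference_vector n V e1 e2 : (e1 < n)%N -> (e2 < n)%N ->
  dot n V (difference_vector n e1 e2) = V`_e1 - V`_e2.
Proof.
move=> en1 en2; rewrite -(dot_indicator V en1) -(dot_indicator V en2) -sumrB.
by apply: eq_bigr => i _; rewrite nth_mkseq// mulrBr.
Qed.

Lemma dclamp_Int W a : exists x, dclamp W a = Int x.
Proof.
rewrite /dclamp {1}/dif; case: ifP => _; last by exists 0.
by rewrite /dif; case: ifP => _; [exists (to_int a + 0)|exists 0].
Qed.

Lemma dvec_inj : injective dvec.
Proof. by rewrite /dvec; elim=> [|x s IH] [|x' s'] //= [-> /IH ->]. Qed.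

Lemma dmk_Int n F : (forall d, exists x, F d = Int x) ->
  exists2 X, dmk (didx n) F (dint 0) = dvec X & size X = n.
Proof.
move=> FI; exists (mkseq (fun i => to_int (F (dint i))) n); last by rewrite size_mkseq.
by apply: dmk_dvec => i _; have [x ->] := FI (dint i).
Qed.

Lemma dcandidate_vec orc n D V T :
  exists2 X, dcandidate orc (didx n) (dint n) D V T = dvec X & size X = n.
Proof.
rewrite /dcandidate; cbv zeta; set c := dguard _ _ _ _.
rewrite {1}/dif; case: ifP => _; last first.
  by exists (unit_vector n); rewrite ?dunitE ?size_mkseq.
apply: dmk_Int => d; rewrite {1}/dif; case: ifP => _; [exact: dclamp_Int|by exists 0].
Qed.

Lemma dsearchE orc n D V : size V = n -> (0 < n)%N ->
  exists2 y, dsearch orc (didx n) (dint n) D (dvec V) = dvec y &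
  [/\ sign_vector n y, `|dot n V y| <= `|V`_0|,
      forall e1 e2, (e1 < n)%N -> (e2 < n)%N -> e1 != e2 ->
        `|dot n V y| <= `|V`_e1 - V`_e2|
    & forall T X, (T < n)%N ->
        dcandidate orc (didx n) (dint n) D (dvec V) (dint T) = dvec X ->
        sign_vector n X -> `|dot n V y| <= `|dot n V X|].
Proof.
move=> Vn n0; rewrite /dsearch dunitE.
have inI i : (i \in rev (iota 0 n)) = (i < n)%N by rewrite mem_rev mem_iota.
have S0 : at_most n V `|V`_0| (dvec (unit_vector n)).
  exists (unit_vector n) => //; split; first exact: unit_vector_sign.
  by rewrite dot_unit_vector.
pose Q1 e1 m := forall e2, (e2 < n)%N -> e1 != e2 -> (e1 < n)%N -> m <= `|V`_e1 - V`_e2|.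
rewrite [X in dfold _ _ X]dfold_didx.
pose g1 acc i := dfold (fun e2 Y =>
  dimprove (didx n) (dvec V) (ddiff (didx n) (dint i) e2) Y) (didx n) acc.
have [|e1 d m e1s dm|m1 [m1m Q1m S1]] := @foldl_improves n V g1 Q1 (rev (iota 0 n)) _ _ _ _ S0.
- by move=> e m m' mm Qe e2 e2n ee en; apply: le_trans (Qe _ e2n ee en).
- rewrite /g1 dfold_didx.
  pose Q2 e2 m := e1 != e2 -> m <= `|V`_e1 - V`_e2|.
  pose g2 acc i := dimprove (didx n) (dvec V) (ddiff (didx n) (dint e1) (dint i)) acc.
  have [|e2 d' m' e2s dm'|m2 [m2m Q2m S2]] := @foldl_improves n V g2 Q2 (rev (iota 0 n)) _ _ _ _ dm.
  + by move=> e m' m'' mm Qe ee; apply: le_trans (Qe ee).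
  + rewrite /g2 ddiffE.
    have [|m2 [h1 h2 h3]] := @improve_step n V (difference_vector n e1 e2) d' m' Vn _ dm'.
      by rewrite size_mkseq.
    exists m2; split => // ee; rewrite inI in e1s; rewrite inI in e2s.
    rewrite -(@dot_difference_vector n)//; apply: h2.
    exact: difference_vector_sign.
  + by exists m2; split => // e2 e2n ee _; apply: Q2m => //; rewrite inI.
rewrite dfold_didx.
pose Q3 T m := forall X, dcandidate orc (didx n) (dint n) D (dvec V) (dint T) = dvec X ->
  size X = n -> sign_vector n X -> m <= `|dot n V X|.
pose g3 acc i := dimprove (didx n) (dvec V)
  (dcandidate orc (didx n) (dint n) D (dvec V) (dint i)) acc.
have [|T d m Ts dm|m3 [m3m Q3m S3]] := @foldl_improves n V g3 Q3 (rev (iota 0 n)) _ _ _ _ S1.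
- by move=> e m m' mm Qe X XE Xn Xs; apply: le_trans (Qe X XE Xn Xs).
- rewrite /g3; have [X XE Xn] := dcandidate_vec orc n D (dvec V) (dint T).
  rewrite XE; have [m2 [h1 h2 h3]] := @improve_step n V X d m Vn Xn dm.
  exists m2; split => // X' X'E X'n X's.
  have XX : X = X' by exact: dvec_inj (etrans (esym XE) X'E).
  by rewrite -XX; apply: h2; rewrite XX.
have [y yE [ys ym]] := S3; exists y => //; split => //.
- by apply: le_trans ym _; apply: le_trans m3m _.
- move=> e1 e2 en1 en2 ee; apply: le_trans ym _; apply: le_trans m3m _.
  by apply: (Q1m e1) => //; rewrite inI.
- move=> T X Tn XE Xs; apply: le_trans ym _.
  by apply: (Q3m T) => //; [rewrite inI|case: Xs].
Qed.

(** * The candidate for a given number of rounds *)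

Lemma trunc_log2_le n : (0 < n)%N -> (2 ^ trunc_log 2 n <= n)%N.
Proof. by move=> n0; apply: trunc_logP. Qed.

Lemma trunc_log2_ltn n : (0 < n)%N -> (trunc_log 2 n < n)%N.
Proof. by move=> n0; apply: leq_trans (trunc_log2_le n0); apply: ltn_expl. Qed.

Lemma dlogE n : (0 < n)%N -> dlog (didx n) (dint n) = dint (trunc_log 2 n).
Proof.
move=> n0; rewrite /dlog.
rewrite (@dsum_didx n _ (fun e => if (e < trunc_log 2 n)%N then 1 else 0)); last first.
  move=> e en; rewrite dadd_int dpow2_didx; last by rewrite addn1.
  rewrite dle_int dif_bool lez_nat addn1.
  have -> : (2 ^ e.+1 <= n)%N = (e < trunc_log 2 n)%N; last by case: ifP.
  apply/idP/idP => [/trunc_log_max|h]; first by apply.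
  by apply: leq_trans (trunc_log2_le n0); rewrite leq_pexp2l.
have := @blockE n (trunc_log 2 n) (fun=> 1) 0 (ltnW (trunc_log2_ltn n0)).
rewrite /block => ->; rewrite sumr_const card_ord.
by congr Int; rewrite natz.
Qed.

Definition candidate (n beta T : nat) (X : seq int) : seq int :=
  mkseq (fun i => if (i < len beta T)%N then clamp 1 X`_i else 0) n.

(** From $1 \le T$ follows $2\beta \le \beta 2^T \le \log n$, hence $b^2 \le n$ and the guard holds.
    From $1 \le \beta$ follows $2^T \le \log n \le n/4$, so the loop is long enough for the
    recursion. *)
Lemma dcandidateE orc n D T O V (beta := (trunc_log 2 n %/ 2 ^ T)%N) (b := (2 ^ beta)%N) :
  (16 <= n)%N -> (1 <= T)%N -> (1 <= beta)%N -> (0 < D)%N ->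
  (forall v, orc (encode_minkowski_instance (instance n b D v)) = dvec (O v)) ->
  (forall v, size (O v) = n) ->
  size V = n -> (forall i, `|V`_i| <= (n * D)%N%:Z) ->
  dcandidate orc (didx n) (dint n) (dint D) (dvec V) (dint T) =
  dvec (candidate n beta T (solve (base_solution n b O) n (n * D)%N%:Z beta T T V)).
Proof.
move=> n16 T1 beta1 D0 orcE sO Vn VA.
have n0 : (0 < n)%N by apply: leq_trans n16.
set nu := trunc_log 2 n.
have nu_n : (2 ^ nu <= n)%N by apply: trunc_log2_le.
have nu4 : (4 <= nu)%N by apply: trunc_log_max.
have bT : (beta * 2 ^ T <= nu)%N by apply: leq_divM.
have T_nu : (2 ^ T <= nu)%N by apply: leq_trans bT; rewrite leq_pmull.
have nu4n : (4 * nu <= n)%N.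
  apply: leq_trans nu_n; rewrite -(subnK nu4); elim: (nu - 4)%N => // m IH.
  by rewrite addSn expnS; lia.
have Tn : (T <= n)%N.
  by have := ltn_expl T (isT : (1 < 2)%N); lia.
have lenn : (len beta T <= n)%N by apply: leq_trans nu_n; rewrite leq_pexp2l.
have b_len : (b <= len beta T)%N by rewrite leq_pexp2l// leq_pmulr// expn_gt0.
have bn : (b <= n)%N by apply: leq_trans lenn.
have beta_n : (beta <= n)%N by apply: leq_trans (ltnW (ltn_expl _ (isT : (1 < 2)%N))) bn.
have b2 : (2 <= b)%N by rewrite -[X in (X <= _)%N](expn1 2) leq_pexp2l.
have bb : (b * b <= n)%N.
  apply: leq_trans nu_n; rewrite -expnD leq_pexp2l// addnn -muln2.
  by apply: leq_trans bT; rewrite leq_mul2l -{1}(expn1 2) leq_pexp2l ?orbT.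
have betaE : ddiv (dlog (didx n) (dint n)) (dpow2 (didx n) (dint T)) = dint beta.
  by rewrite dlogE// dpow2_didx// ddiv_int.
rewrite /dcandidate; cbv zeta; rewrite betaE.
have -> : dguard (didx n) (dint n) (dint beta) (dint T) = dint 1.
  rewrite /dguard; cbv zeta; rewrite dpow2_didx// -/b dmul_int !dle_int !dand_bool !lez_nat.
  by rewrite T1 b2 bb.
rewrite (dif_bool true); apply: dmk_dvec => i i_n.
rewrite !dpow2_didx// ?dmul_int ?dpow2_didx//; last first.
  by apply: leq_trans bT (ltnW (trunc_log2_ltn n0)).
rewrite dlt_int dif_bool ltz_nat.
rewrite (drunE bn D0 Tn lenn orcE sO)//; last by apply: leq_trans nu4n; rewrite leq_mul2l T_nu orbT.
rewrite dnth_dvec ?size_solve// => [|V']; last by rewrite size_mkseq.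
by rewrite (dclampE 1); case: ifP.
Qed.

(** * Reading the input *)

Lemma dlength_encode l : dlength (encode_seq l) = dint (size l).
Proof.
rewrite /dlength dfold_encode.
suff H m : foldl (fun acc _ => dadd acc (dint 1)) (dint m) l = dint (m + size l) by exact: (H 0%N).
elim: l m => [|e l IH] m /=; first by rewrite addn0.
by rewrite dadd_int IH addn1 addSnnS.
Qed.

Lemma didxS m : didx m.+1 = Pair (dint m) (didx m).
Proof. by rewrite /didx -addn1 iotaD rev_cat. Qed.

Lemma dindex_encode l : dindex (encode_seq l) = didx (size l).
Proof.
rewrite /dindex dlength_encode dfold_encode; set n := size l.
pose g acc (e : data) := Pair (dclamp (dint n)
  (dif (of_bool (is_pair acc)) (dadd (hd acc) (dint 1)) (dint 0))) acc.
suff H s k : (k + size s <= n)%N -> foldl g (didx k) s = didx (k + size s).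
  exact: (H l 0%N).
elim: s k => [|e s IH] k /=; first by rewrite addn0.
rewrite addnS -addSn => kn; rewrite -IH//; congr foldl.
rewrite /g didxS; congr Pair.
have -> : dif (of_bool (is_pair (didx k))) (dadd (hd (didx k)) (dint 1)) (dint 0) = dint k.
  by case: k {kn} => // k; rewrite didxS /= dif_bool dadd_int addn1.
by rewrite dclampE clamp_id// lez_nat; lia.
Qed.

(** The product is taken as common denominator: it needs only multiplications, and it is no longer
    than its factors together. *)
Definition denominator (l : seq rat) : nat := \prod_(r <- l) `|denq r|%N.

Lemma denominator_gt0 l : (0 < denominator l)%N.
Proof. by apply: prodn_cond_gt0 => r _; rewrite absz_gt0 denq_neq0. Qed.

Lemma denq_dvd_denominator l r : r \in l -> (`|denq r| %| denominator l)%N.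
Proof. by move=> rl; rewrite /denominator (big_rem r rl)/= dvdn_mulr. Qed.

Lemma ddenom_encode (l : seq rat) :
  ddenom (encode_seq (map encode_rat l)) = dint (denominator l).
Proof.
rewrite /ddenom dfold_encode -(mul1n (denominator l)).
suff H m : foldl (fun acc e => dmul acc (tl e)) (dint m) (map encode_rat l) =
  dint (m * denominator l) by exact: (H 1%N).
elim: l m => [|r l IH] m /=; first by rewrite /denominator big_nil muln1.
rewrite (_ : Int (denq r) = dint `|denq r|); last by rewrite gez0_abs// ltW// denq_gt0.
by rewrite dmul_int IH /denominator big_cons mulnA.
Qed.

Definition scaled (l : seq rat) : seq int :=
  mkseq (fun i => numq l`_i * (denominator l %/ `|denq l`_i|)%N%:Z) (size l).

Lemma dscaled_encode (l : seq rat) :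
  dscaled (encode_seq (map encode_rat l)) = dvec (scaled l).
Proof.
rewrite /dscaled dindex_encode size_map; apply: dmk_dvec => i i_n; cbv zeta.
rewrite dnth_encode ?size_map// (nth_map 0)// ddenom_encode /=.
rewrite (_ : Int (denq l`_i) = dint `|denq l`_i|); last by rewrite gez0_abs// ltW// denq_gt0.
by rewrite ddiv_int darithE.
Qed.

Lemma scaledE (l : seq rat) i : (i < size l)%N ->
  ((scaled l)`_i)%:~R = l`_i * (denominator l)%:R :> rat.
Proof.
move=> i_n; rewrite nth_mkseq// intrM -pmulrn.
have /dvdnP[k dk] := denq_dvd_denominator (mem_nth 0 i_n).
rewrite dk mulnK ?absz_gt0 ?denq_neq0// natrM -[X in _ = X * _](divq_num_den l`_i).
have d0 : (denq l`_i)%:~R != 0 :> rat by rewrite intr_eq0 denq_neq0.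
have -> : (`|denq l`_i|%N)%:R = (denq l`_i)%:~R :> rat.
  by rewrite pmulrn gez0_abs// ltW// denq_gt0.
by field.
Qed.

Lemma dmainE orc (l : seq rat) : dmain orc (encode_seq (map encode_rat l)) =
  dsearch orc (didx (size l)) (dint (size l)) (dint (denominator l)) (dvec (scaled l)).
Proof.
by rewrite /dmain dindex_encode dlength_encode ddenom_encode dscaled_encode size_map.
Qed.

Lemma main_env_encode (l : seq rat) : main_env (encode_seq (map encode_rat l)).
Proof.
exists (size l), (denominator l).
by rewrite dindex_encode dlength_encode ddenom_encode size_map denominator_gt0.
Qed.

(** * Quality of the solution *)

Lemma base_good n b D P (O : (nat -> int) -> seq int) V T :
  (2 <= b)%N -> (b * b <= n)%N -> (0 < D)%N -> (P <= n)%N -> P = (2 ^ T)%N ->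
  (4 * b * P < n * n)%N -> (P * (n * (n * n)) * 2 <= 2 ^ b)%N -> norm_bound T 0 <= n%:Z ->
  (forall v, size (O v) = n) ->
  (forall v, exists2 i, (i < n)%N & (O v)`_i != 0) ->
  (forall v i, (i < n)%N ->
    `|\sum_(j < n) entry n b D v i j * (O v)`_j| < P%:Z * bound n b D i) ->
  (forall i, `|V`_i| <= (n * D)%N%:Z) ->
  forall J, (J.+1 * b <= n)%N ->
  good_block (2 ^ b)%N%:Z V (base_solution n b O V) (J * b) b (norm_bound T 0) (n ^ 7 * D)%N%:Z.
Proof.
move=> b2 bb D0 Pn PT bP Pb Kn sO nzO HO VA J Jn.
have b0 : (0 < b)%N by apply: ltnW.
have Jr r : (r < b)%N -> (J * b + r < n)%N by rewrite mulSn in Jn; lia.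
pose v r := V`_(J * b + r).
have [[r0 r0b z0] zK zE] := @picked_block n b D v P (O v) b2 bb D0 Pn bP Pb (sO v)
  (fun r _ => VA _) (nzO v) (HO v).
have KE : norm_bound T 0 = 2 * P%:Z - 1 by rewrite /norm_bound subn0 PT.
have XE r : (r < b)%N -> (base_solution n b O V)`_(J * b + r) =
    (O v)`_(pick_block n b (O v) * b.+1 + r).
  move=> rb; rewrite nth_mkseq ?Jr//; cbv zeta.
  rewrite divnMDl// divn_small// addn0 modnMDl modn_small// clamp_id//.
  by apply: le_trans Kn; rewrite KE; apply: zK.
split; first by exists r0; rewrite ?XE.
- by move=> r rb; rewrite XE// KE zK.
- by under eq_bigr => r _ do rewrite XE//.
Qed.

(** Two of the $n$ numbers share one of $n - 1$ cells of length $D/(n - 1)$. *)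
Lemma pigeonhole n D (V : nat -> int) : (2 <= n)%N ->
  (0 < D)%N -> (forall i, (i < n)%N -> 0 <= V i <= D%:Z) ->
  exists e1 e2, [/\ (e1 < n)%N, (e2 < n)%N, e1 != e2
    & `|V e1 - V e2| * (n.-1)%:Z <= D%:Z].
Proof.
case: n => // -[//|n] _ D0 VD.
(* The minimum puts the right end point [D] into the last cell. *)
pose h (i : 'I_n.+2) : 'I_n.+1 := inord (minn (`|V i|%N * n.+1 %/ D) n).
have : ~~ injectiveb h.
  apply/negP => /injectiveP /leq_card; by rewrite !card_ord ltnn.
move/injectivePn => [i [j ij hij]].
exists i, j; split=> //.
have VE k : (k < n.+2)%N -> V k = `|V k|%N%:Z.
  by move=> kn; rewrite gez0_abs//; case/andP: (VD k kn).
have cell (k : 'I_n.+2) : (h k * D <= `|V k|%N * n.+1 <= (h k).+1 * D)%N.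
  have kD : (`|V k|%N <= D)%N by rewrite -lez_nat -VE//; case/andP: (VD k (ltn_ord k)).
  rewrite /h inordK; last by rewrite ltnS geq_minr.
  set x := (`|V k|%N * n.+1)%N; have xD : (x <= D * n.+1)%N by rewrite leq_mul2r kD orbT.
  have := ltn_ceil x D0; have := leq_divM x D; case: (leqP (x %/ D) n) => h1 h2 h3.
    by rewrite h2 ltnW.
  by rewrite mulnC [(n.+1 * _)%N]mulnC xD andbT; nia.
have := cell i; have := cell j; rewrite -hij => /andP[j1 j2] /andP[i1 i2].
rewrite (VE i)// (VE j)//=; move: j1 j2 i1 i2; rewrite mulSn.
set x := `|V i|%N; set y := `|V j|%N; set c := (h i * D)%N.
by case: (lerP x%:Z y%:Z) => xy; nia.
Qed.

(** The fourth power leaves room for both cases to come: $m = 2^{\beta-1}$ for large blocks, and $m$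
    about $\log n$ when $2^\beta = O(\log^2 n)$. *)
Lemma exp4_root (R : realType) (k m : nat) : (2 ^ k <= m ^ 4)%N ->
  (2 : R) `^ (k%:R / 4) <= m%:R.
Proof.
move=> km; have h : (2 : R) `^ (k%:R / 4) ^+ 4 <= m%:R ^+ 4.
  rewrite -powR_mulrn ?powR_ge0// -powRrM -mulrA mulVf ?mulr1// powR_mulrn//.
  by rewrite -!natrX ler_nat.
by move: h; rewrite ler_pXn2r// nnegrE ?powR_ge0.
Qed.

(* [n < 2^((beta+1) 2^T)] and [2^T <= 2 rho], so [n^(1/(8 rho)) <= 2^((beta+1)/4)]. *)
Lemma power_bound (R : realType) (n T m : nat) (rho : R) (beta := (trunc_log 2 n %/ 2 ^ T)%N) :
  (0 < n)%N -> 1 <= rho -> (2 ^ T)%:R <= 2 * rho -> (2 ^ beta.+1 <= m ^ 4)%N ->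
  n%:R `^ (1 / 8 / rho) <= m%:R :> R.
Proof.
move=> n0 rho1 Trho bm; apply: le_trans (exp4_root R bm).
have rho0 : 0 < rho by apply: lt_le_trans rho1.
set nu := trunc_log 2 n.
have e0 : 0 <= 1 / 8 / rho by rewrite !mulr_ge0// invr_ge0 ltW.
have nnu : (n <= 2 ^ nu.+1)%N by apply/ltnW/trunc_log_ltn.
have step1 : n%:R `^ (1 / 8 / rho) <= ((2 ^ nu.+1)%:R : R) `^ (1 / 8 / rho).
  by apply: ge0_ler_powR; rewrite // ?nnegrE// ler_nat.
apply: le_trans step1 _; rewrite natrX -powR_mulrn// -powRrM.
rewrite ler_powR ?ler1n//.
have bT : (nu.+1 <= beta.+1 * 2 ^ T)%N by apply: ltn_ceil; rewrite expn_gt0.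
have : nu.+1%:R <= beta.+1%:R * (2 * rho) :> R.
  apply: le_trans (_ : beta.+1%:R * (2 ^ T)%:R <= _); first by rewrite -natrM ler_nat.
  by rewrite ler_wpM2l.
move=> h; rewrite mulrA ler_pdivrMr//; move: h; set x := nu.+1%:R; set y := beta.+1%:R.
by move=> h; lra.
Qed.

Lemma exists_power2 (R : realType) (rho : R) : 1 <= rho ->
  exists2 T, (1 <= T)%N & rho < (2 ^ T)%:R <= 2 * rho.
Proof.
move=> rho1; have rho0 : 0 <= rho by apply: le_trans rho1.
have ex : exists T, rho < (2 ^ T)%:R.
  exists (Num.truncn rho).+1; apply: lt_trans (truncnS_gt rho) _.
  by rewrite ltr_nat ltn_expl.
case: (ex_minnP ex) => -[|T] hT minT.
  by move: hT; rewrite expn0 ltNge rho1.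
exists T.+1 => //; rewrite hT expnS natrM ler_wpM2l//.
by rewrite leNgt; apply/negP => /minT; rewrite ltnn.
Qed.

(** As [r < P] and all right-hand sides are positive, the real inequalities become strict integer
    ones, and the unknown factor [r] disappears from the argument. *)
Lemma oracle_vector (R : realType) (orc : data -> data) (r : R) n b D P v :
  (0 < D)%N -> 0 < r -> r < P%:R ->
  (exists x : 'rV[int]_n,
     [/\ orc (encode_minkowski_instance (instance n b D v)) =
           dvec [seq x 0 i | i <- enum 'I_n],
         x != 0
       & forall i : 'I_n, `|\sum_(j < n) entry n b D v i j * x 0 j|%:~R <=
           r * (bound n b D i)%:~R]) ->
  exists s : seq int,
     [/\ orc (encode_minkowski_instance (instance n b D v)) = dvec s,
         size s = n, exists2 i, (i < n)%N & s`_i != 0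
       & forall i, (i < n)%N ->
           `|\sum_(j < n) entry n b D v i j * s`_j| < P%:Z * bound n b D i].
Proof.
move=> D0 r0 rP [x [xE x0 xH]]; exists [seq x 0 i | i <- enum 'I_n].
have nthE (i : 'I_n) : [seq x 0 i | i <- enum 'I_n]`_i = x 0 i.
  by rewrite (nth_map i) ?size_enum_ord// nth_ord_enum.
split=> //.
- by rewrite size_map size_enum_ord.
- by have /rV0Pn[i xi] := x0; exists i => //; rewrite nthE.
- move=> i i_n; have := xH (Ordinal i_n).
  under [in X in _ -> X]eq_bigr do rewrite nthE.
  rewrite -(ltr_int R) /= => /le_lt_trans; apply.
  have B0 : 0 < bound n b D i.
    rewrite /bound /slack_weight; do ![case: ifP => _ //].
    by rewrite ltz_nat !muln_gt0 D0 (leq_ltn_trans _ i_n).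
  by rewrite intrM ltr_pM2r ?ltr0z.
Qed.

Lemma log2_facts n (nu := trunc_log 2 n) : (64 <= n)%N ->
  [/\ (6 <= nu)%N, (2 ^ nu <= n)%N, (n < 2 ^ nu.+1)%N & (4 * nu <= n)%N].
Proof.
move=> n64; have nu_n : (2 ^ nu <= n)%N by apply: trunc_log2_le; apply: leq_trans n64.
have nu6 : (6 <= nu)%N by apply: trunc_log_max.
split=> //; first exact: trunc_log_ltn.
apply: leq_trans nu_n; rewrite -(subnK nu6); elim: (nu - 6)%N => // m IH.
by rewrite addSn expnS; lia.
Qed.

Lemma PoszX (n k : nat) : (n ^ k)%N%:Z = n%:Z ^+ k.
Proof. by elim: k => // k IH; rewrite expnS PoszM IH exprS. Qed.

Lemma candidate_good n beta T q V X E : (len beta T <= n)%N -> size X = n ->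
  good_block q V X 0 (len beta T) 1 E ->
  sign_vector n (candidate n beta T X) /\ `|dot n V (candidate n beta T X)| * q <= E.
Proof.
move=> ln Xn [[r rl Xr] X1 XE].
have cE i : (i < len beta T)%N -> (candidate n beta T X)`_i = X`_i.
  by move=> il; rewrite nth_mkseq ?il ?clamp_id ?X1 ?(leq_trans il ln).
split.
  split; first by rewrite size_mkseq.
  - by exists r; [apply: leq_trans ln|rewrite cE].
  - move=> i i_n; rewrite nth_mkseq//; case: ifP => // _; exact: clamp_norm.
suff -> : dot n V (candidate n beta T X) = \sum_(r < len beta T) V`_(0 + r) * X`_(0 + r) by [].
rewrite /dot (big_ord_widen n (fun r => V`_(0 + r) * X`_(0 + r)) ln) [RHS]big_mkcond /=.
apply: eq_bigr => i _; case: ifP => il; first by rewrite cE.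
by rewrite nth_mkseq//= il mulr0.
Qed.

(** After [T] rounds the error is at most $n^{2T+7}D/2^b$. The lower bound on [b] gives $n^{2T+7}
    \le 2^{b/2}$, so half of the exponent is kept; $b/2$ is $2^{\beta-1}$. *)
Lemma large_block_bound (R : realType) (orc : data -> data) (r : R) n T D V X
    (nu := trunc_log 2 n) (beta := (nu %/ 2 ^ T)%N) (b := (2 ^ beta)%N) :
  1 <= r -> r < (2 ^ T)%:R -> (1 <= T)%N -> (64 <= n)%N -> (0 < D)%N -> size V = n ->
  (forall i, `|V`_i| <= D%:Z) ->
  (2 * nu.+1 * (2 * nu + 7) <= b)%N ->
  (forall v, exists x : 'rV[int]_n,
     [/\ orc (encode_minkowski_instance (instance n b D v)) =
           dvec [seq x 0 i | i <- enum 'I_n],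
         x != 0
       & forall i : 'I_n, `|\sum_(j < n) entry n b D v i j * x 0 j|%:~R <=
           r * (bound n b D i)%:~R]) ->
  (forall Z, dcandidate orc (didx n) (dint n) (dint D) (dvec V) (dint T) = dvec Z ->
     sign_vector n Z -> X <= `|dot n V Z|) ->
  X * (2 ^ 2 ^ beta.-1)%N%:Z <= D%:Z.
Proof.
move=> r1 rT T1 n64 D0 Vn VD bG Horc HX.
have [nu6 nu_n n_nu nu4] := log2_facts n64; rewrite -/nu in nu6 nu_n n_nu nu4.
have r0 : 0 < r by apply: lt_le_trans r1.
have n0 : (0 < n)%N by apply: leq_trans n64.
have beta1 : (1 <= beta)%N by rewrite lt0n; apply/eqP => b0; move: bG; rewrite /b b0; nia.
have bT : (beta * 2 ^ T <= nu)%N by apply: leq_divM.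
have T_nu : (2 ^ T <= nu)%N by apply: leq_trans bT; rewrite leq_pmull.
have Tnu : (T <= nu)%N by apply: leq_trans T_nu; apply/ltnW/ltn_expl.
have lenn : (len beta T <= n)%N by apply: leq_trans nu_n; rewrite leq_pexp2l.
have b2 : (2 <= b)%N by nia.
have bb : (b * b <= n)%N.
  apply: leq_trans nu_n; rewrite -expnD leq_pexp2l// addnn -muln2.
  by apply: leq_trans bT; rewrite leq_mul2l -{1}(expn1 2) leq_pexp2l ?orbT.
have /choice[Ov HO] := fun v => oracle_vector D0 r0 rT (Horc v).
(* With $P = 2^T \le \log n$ and thus $2P \le n$, this yields the condition $2Pn^3 \le 2^b$ that
   makes the slack vanish. *)
have n4 : (n ^ 4 <= 2 ^ b)%N.
  apply: leq_trans (_ : (2 ^ nu.+1) ^ 4 <= _)%N; first by rewrite leq_exp2r// ltnW.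
  by rewrite -expnM leq_pexp2l//; nia.
have Kn : norm_bound T 0 <= n%:Z by rewrite /norm_bound subn0; lia.
have Hb : forall U, (forall i, `|U`_i| <= (n * D)%N%:Z) ->
    forall J, (J.+1 * len beta 0 <= n)%N ->
    good_block (2 ^ b)%N%:Z U (base_solution n b Ov U) (J * len beta 0) (len beta 0)
      (norm_bound T 0) (n ^ 7 * D)%N%:Z.
  move=> U UA J; rewrite (_ : len beta 0 = b); last by rewrite /len muln1.
  apply: (@base_good n b D (2 ^ T)%N) => //; try by move=> v; have [] := HO v.
  - by lia.
  - by nia.
  - apply: leq_trans n4; rewrite (_ : n ^ 4 = n * (n * (n * n)))%N; last by rewrite !expnS expn0 muln1.
    by rewrite mulnAC leq_mul2r; apply/orP; right; lia.
have D0' : 0 <= D%:Z by [].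
have WA : D%:Z * (len beta T)%:Z <= (n * D)%N%:Z.
  by rewrite -PoszM lez_nat mulnC leq_mul2r lenn orbT.
have n3 : (3 <= n)%N by apply: leq_trans n64.
have q0 : 0 <= (2 ^ b)%N%:Z by [].
have sb U : size (base_solution n b Ov U) = n by rewrite size_mkseq.
have Jn : (0.+1 * len beta T <= n)%N by rewrite mul1n.
have := @solve_good _ n (n * D)%N%:Z beta T _ _ q0 n3 Kn sb Hb T (leqnn T) V D%:Z D0' VD WA 0%N Jn.
rewrite mul0n (_ : norm_bound T T = 1); last by rewrite /norm_bound subnn.
move=> /(candidate_good lenn (size_solve _ _ _ _ _ sb))[Zs ZE].
have VA i : `|V`_i| <= (n * D)%N%:Z by apply: le_trans (VD i) _; rewrite lez_nat leq_pmull.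
have ZX := HX _ (@dcandidateE orc n D T Ov V (leq_trans _ n64) T1 beta1 D0
  (fun v => let: And4 h _ _ _ := HO v in h) (fun v => let: And4 _ h _ _ := HO v in h) Vn VA) Zs.
have {ZX} XE : X * (2 ^ b)%N%:Z <= (n ^ (2 * T + 7) * D)%N%:Z.
  apply: le_trans (ler_wpM2r q0 (ZX isT)) _; apply: le_trans ZE _.
  by rewrite expnD !PoszM !PoszX mulrA lexx.
have nb : (n ^ (2 * T + 7) <= 2 ^ 2 ^ beta.-1)%N.
  apply: leq_trans (_ : (2 ^ nu.+1) ^ (2 * T + 7) <= _)%N.
    by rewrite leq_exp2r ?addnS// ltnW.
  rewrite -expnM leq_pexp2l//.
  have b2E : (2 * 2 ^ beta.-1 = b)%N by rewrite -expnS prednK.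
  have : (nu.+1 * (2 * T + 7) <= nu.+1 * (2 * nu + 7))%N by rewrite leq_mul2l leq_add2r leq_mul2l Tnu.
  by move: bG b2E; lia.
have b2E : (2 ^ b = 2 ^ 2 ^ beta.-1 * 2 ^ 2 ^ beta.-1)%N.
  by rewrite -expnD addnn -mul2n -expnS prednK.
have m0 : (0 < 2 ^ 2 ^ beta.-1)%N by rewrite expn_gt0.
move: XE nb; rewrite b2E !PoszM; move: (2 ^ 2 ^ _)%N (n ^ _)%N m0 => m k m0 XE km.
have m0' : 0 < m%:Z by [].
rewrite -(ler_pM2r m0') -mulrA; apply: le_trans XE _.
by rewrite mulrC ler_wpM2l.
Qed.

(** The split is at $2^\beta = 2(\nu + 1)(2\nu + 7)$ with $\nu = \lfloor\log_2 n\rfloor$. Below it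
    the oracle gains nothing over a difference of two inputs, whose error $D/(n - 1)$ is at most
    $D/2^{\nu-1}$. *)
Lemma search_quality (R : realType) (orc : data -> data) (r : R) n D V X :
  1 <= r -> (64 <= n)%N -> (0 < D)%N -> size V = n ->
  (forall i, (i < n)%N -> 0 <= V`_i <= D%:Z) ->
  (forall b v, (2 <= b)%N -> (b * b <= n)%N -> exists x : 'rV[int]_n,
     [/\ orc (encode_minkowski_instance (instance n b D v)) =
           dvec [seq x 0 i | i <- enum 'I_n],
         x != 0
       & forall i : 'I_n, `|\sum_(j < n) entry n b D v i j * x 0 j|%:~R <=
           r * (bound n b D i)%:~R]) ->
  (forall e1 e2, (e1 < n)%N -> (e2 < n)%N -> e1 != e2 -> X <= `|V`_e1 - V`_e2|) ->
  (forall T Z, (T < n)%N ->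
     dcandidate orc (didx n) (dint n) (dint D) (dvec V) (dint T) = dvec Z ->
     sign_vector n Z -> X <= `|dot n V Z|) ->
  exists2 m, X * (2 ^ m)%N%:Z <= D%:Z & n%:R `^ (1 / 8 / r) <= m%:R :> R.
Proof.
move=> r1 n64 D0 Vn VD Horc HX1 HX2.
have [nu6 nu_n n_nu nu4] := log2_facts n64; set nu := trunc_log 2 n in nu6 nu_n n_nu nu4.
have n0 : (0 < n)%N by apply: leq_trans n64.
have [T T1 /andP[rT Tr]] := exists_power2 r1.
pose beta := (nu %/ 2 ^ T)%N.
case: (leqP (2 * nu.+1 * (2 * nu + 7)) (2 ^ beta)) => bG.
  have beta2 : (8 <= beta)%N.
    rewrite leqNgt; apply/negP => b8; have : (2 ^ beta <= 2 ^ 7)%N by rewrite leq_pexp2l.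
    by rewrite (_ : 2 ^ 7 = 128)%N//; nia.
  have bT : (beta * 2 ^ T <= nu)%N by apply: leq_divM.
  have T_nu : (2 ^ T <= nu)%N by apply: leq_trans bT; rewrite leq_pmull//; lia.
  have Tn : (T < n)%N by have := ltn_expl T (isT : (1 < 2)%N); lia.
  exists (2 ^ beta.-1)%N.
    apply: (@large_block_bound R orc r n T D V X) => //.
    - move=> i; case: (ltnP i n) => i_n; last by rewrite nth_default ?Vn// normr0.
      by have /andP[V0 V1] := VD i i_n; rewrite ger0_norm.
    - move=> v; apply: Horc.
        by rewrite -[X in (X <= _)%N](expn1 2) leq_pexp2l//; apply: leq_trans beta2.
      apply: leq_trans nu_n; rewrite -expnD leq_pexp2l// addnn -muln2.
      by apply: leq_trans bT; rewrite leq_mul2l (@leq_pexp2l 2 1 T) ?orbT.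
    - by move=> Z; apply: HX2.
  apply: (power_bound n0 r1 Tr); rewrite -expnM leq_pexp2l//.
  by rewrite -/nu -/beta; lia.
exists nu.-1.
  have [e1 [e2 [en1 en2 ee VE]]] := @pigeonhole n D (nth 0 V) (leq_trans (isT : (2 <= 64)%N) n64) D0 VD.
  apply: le_trans VE; apply: le_trans (ler_wpM2r _ (HX1 e1 e2 en1 en2 ee)) _ => //.
  rewrite ler_wpM2l// lez_nat.
  have : (2 * 2 ^ nu.-1 <= n)%N by rewrite -expnS prednK//; lia.
  have : (0 < 2 ^ nu.-1)%N by rewrite expn_gt0.
  by lia.
apply: (power_bound n0 r1 Tr); rewrite -/nu -/beta expnS.
apply: leq_trans (_ : 2 * (2 * nu.+1 * (2 * nu + 7)) <= _)%N; first by rewrite leq_mul2l ltnW.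
(* For $k = \nu - 1 \ge 5$ one has $8k^2 + 52k + 72 \le 25k^2 \le k^4$. The outer inequality fails
   at $k = 4$, which explains the threshold $64 = 2^6$. *)
case: (nu) nu6 => // k k5; rewrite /= (_ : k ^ 4 = k * k * (k * k))%N; last first.
  by rewrite !expnS expn0 muln1 !mulnA.
have -> : (2 * (2 * k.+2 * (2 * k.+1 + 7)) = 8 * (k * k) + 52 * k + 72)%N by nia.
have k25 : (25 <= k * k)%N by nia.
have k5s : (5 * k <= k * k)%N by nia.
by have := leq_mul k25 (leqnn (k * k)%N); lia.
Qed.

Lemma sign_mem (x : int) : `|x| <= 1 -> x \in [:: -1; 0; 1].
Proof. by rewrite !inE; lia. Qed.

Theorem theorem1 (R : realType) :
  exists (C n0 : nat) (c1 c2 : R),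
    [/\ 0 < c1, 0 < c2
      & forall rho : nat -> R,
          (forall n, 1 <= rho n) ->
          minkowski_approximation C rho ->
          exists e delta : nat -> R,
            [/\ forall n, 0 < delta n,
                forall n, (n0 <= n)%N ->
                  c1 / rho n <= e n <= c2 / rho n /\
                  delta n = 2 `^ (- (n%:R `^ e n))
              & number_balancing_approximation delta]].
Proof.
(* An instance has two rows per coordinate. The exponent is exactly $1/(8\rho)$, with a factor 4
   from the fourth root and a factor 2 from $2^T \le 2\rho$, so both constants of the $\Theta$
   agree. *)
exists 2, 64, (1 / 8), (1 / 8); split; [by lra|by lra|] => rho rho1 mink.
pose e n : R := 1 / 8 / rho n.
(* Below the threshold a unit vector suffices, because its error is at most 1. *)
pose delta n : R := if (64 <= n)%N then 2 `^ (- (n%:R `^ e n)) else 1.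
exists e, delta; split.
- by move=> n; rewrite /delta; case: ifP => // _; apply: powR_gt0.
- by move=> n n64; rewrite /delta n64 /e !lexx.
have [orc [Dorc [Forc Hok Horc]]] := oracle_exists rho1 mink.
have [c [m [K Hc]]] := FP_dmain Forc Hok.
exists c, K => -[n a] /= [n0 a01].
pose l := [seq a 0 i | i <- enum 'I_n].
have sl : size l = n by rewrite size_map size_enum_ord.
have lE (i : 'I_n) : l`_i = a 0 i by rewrite (nth_map i) ?size_enum_ord// nth_ord_enum.
have dE : encode_row encode_rat a = encode_seq (map encode_rat l).
  by rewrite /encode_row /l -map_comp.
pose V := scaled l; pose D := denominator l.
have D0 : (0 < D)%N := denominator_gt0 l.
have Vn : size V = n by rewrite size_mkseq.
have VE (i : 'I_n) : (V`_i)%:~R = a 0 i * D%:R :> rat by rewrite scaledE ?sl// lE.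
have VD i : (i < n)%N -> 0 <= V`_i <= D%:Z.
  move=> i_n; have := VE (Ordinal i_n); have /andP[a0 a1] := a01 (Ordinal i_n) => /= VEi.
  rewrite -(ler0z rat) -(ler_int rat) VEi mulr_ge0//=.
  by rewrite -pmulrn ler_piMl.
have [|_] := Hc (update (fun=> Int 0) 0 (encode_row encode_rat a)).
  by rewrite update_same dE; apply: main_env_encode.
rewrite update_same => -[t [s' [E outE tK _]]].
have [y yE [ys yV0 yP yC]] := @dsearchE orc n (dint D) V Vn n0.
have outy : s' 0%N = dvec y by rewrite outE dE dmainE sl yE.
exists t, (\row_i y`_i); split => //.
- exists s' => //; rewrite outy /encode_row /dvec; congr encode_seq.
  have [yn _ _] := ys; rewrite -{1}(mkseq_nth 0 y) yn -map_comp -(map_enum_ord n (fun i => Int y`_i)).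
  by apply/eq_map => i; rewrite /= mxE.
have [yn [i0 i0n yi0] y1] := ys.
split.
- by move=> i; rewrite mxE sign_mem// y1.
- by apply/rV0Pn; exists (Ordinal i0n); rewrite mxE.
have DR : 0 < D%:R :> R by rewrite ltr0n.
have sumE : (\sum_(i < n) ratr (a 0 i) * ((\row_i y`_i) 0 i)%:~R) * D%:R = (dot n V y)%:~R :> R.
  rewrite mulr_suml /dot raddf_sum /=; apply: eq_bigr => i _.
  rewrite mxE intrM mulrAC; congr (_ * _).
  by rewrite -[RHS]ratr_int VE rmorphM /= ratr_nat.
have Dnorm x : `|x : R| * D%:R = `|x * D%:R| by rewrite normrM (gtr0_norm DR).
rewrite -(ler_pM2r DR) Dnorm sumE -intr_norm /delta; case: ifP => n64; last first.
  rewrite mul1r pmulrn ler_int; apply: le_trans yV0 _.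
  by have /andP[V0 V1] := VD 0%N n0; rewrite ger0_norm.
have [|k Xk ek] := @search_quality R orc (rho n) n D V `|dot n V y| (rho1 n) n64 D0 Vn VD _ yP yC.
  by move=> b v b2 bb; apply: Horc.
rewrite -(ler_pM2r (_ : 0 < (2 : R) ^+ k)) ?exprn_gt0//.
have Xk' : `|dot n V y|%:~R * 2 ^+ k <= D%:R :> R.
  by move: Xk; rewrite -(ler_int R) intrM -!pmulrn natrX.
apply: le_trans Xk' _; rewrite mulrAC ler_peMl ?ler0n//.
rewrite powRN mulrC ler_pdivlMr ?powR_gt0// mul1r -powR_mulrn//.
by rewrite ler_powR// ler1n.
Qed.
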